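(* Let $f\in\mathcal D$ have negative spectrum. Then: (1) for every $t>\Theta_f$, $\sup_{w\in\overline\Omega}\mathcal L_t\mathbb 1(w)<+\infty$, and for every $\tilde\gamma\in(0,1)$ and $p>1$ with $\frac1p<\frac t{\Theta_f}-1$ there is $C_{p,t}$ with $\mathcal L_t\mathbb 1(w)\le C_{p,t}(\log|w|)^{-1/p}$ for all $|w|>e^{\tilde\gamma}$; (2) for every $t<\Theta_f$, the series defining $\mathcal L_t\mathbb 1(w)$ diverges at every point $w\in\Omega$.
   Context: $\mathbb D=\{|z|<1\}$, $\mathbb D^*=\{|z|>1\}$, $\mathcal H=\{\Re\xi>0\}$, $Q_T=\{0<\Re\xi<4T,|\Im\xi|<4T\}$. Class $\mathcal D$: either an entire $f$ with $S(f)$ (closure of critical and finite asymptotic values) in $\mathbb D$ and finitely many components $\Omega_1,\dots,\Omega_N$ of $f^{-1}(\mathbb D^* )$ ($f=\exp\circ\tau_j$ on $\Omega_j$, $\tau_j:\Omega_j\to\mathcal H$ conformal), or a model function $f=e^{\tau_j}$ on a finite disjoint union $\Omega=\bigcup\Omega_j$ of unbounded simply connected domains with conformal $\tau_j$ onto $\mathcal H$ whose inverses $\varphi_j$ satisfy $|\varphi_j(\xi_n)|\to\infty$ as $|\xi_n|\to\infty$; in both cases $\overline\Omega\cap\overline{\mathbb D}=\emptyset$ and for each $j$ there is $M$ with $|\varphi_j(\xi)|\le M|\varphi_j(\xi')|$ for $\xi,\xi'\in Q_T\setminus Q_{T/8}$, $T$ large. Spectrum: $\varphi_{j,T}(\xi)=\varphi_j(T\xi)/|\varphi_j(T)|$,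 $\beta_h(r,t)=\log\int_I|h'(r+iy)|^tdy/\log(1/r)$ with $I=[-2,-1]\cup[1,2]$, $\beta_{\infty,j}(t)=\limsup_{T\to\infty}\beta_{\varphi_{j,T}}(1/T,t)$, $b_{\infty,j}(t)=\beta_{\infty,j}(t)-t+1$, $\Theta_f=\max_j$(smallest positive zero of $b_{\infty,j}$), $b_\infty=\max_jb_{\infty,j}$; negative spectrum: $b_\infty(t)<0$ for all $t>\Theta_f$. $\mathcal L_t\mathbb 1(w)=\sum_{z\in f^{-1}(w)}|f'(z)|_1^{-t}$, $|f'(z)|_1=|f'(z)||z|/|f(z)|$. *)

(* Defs.v *)
From Stdlib Require Import Reals List.
From Coquelicot Require Import Coquelicot.
Export Reals List Coquelicot.
Open Scope R_scope.

Definition Cexp (z : C) : C :=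
  (exp (fst z) * cos (snd z), exp (fst z) * sin (snd z)).

Definition unit_disk (z : C) : Prop := Cmod z < 1.
Definition ext_disk (z : C) : Prop := 1 < Cmod z.
Definition right_half_plane (xi : C) : Prop := 0 < fst xi.
Definition Qsq (T : R) (xi : C) : Prop :=
  0 < fst xi < 4 * T /\ Rabs (snd xi) < 4 * T.

Definition closureC (A : C -> Prop) (w : C) : Prop :=
  forall eps, 0 < eps -> exists z, A z /\ Cmod (z - w) < eps.

Definition openC (A : C -> Prop) : Prop :=
  forall z, A z -> exists eps, 0 < eps /\ forall u, Cmod (u - z) < eps -> A u.

Definition connectedC (A : C -> Prop) : Prop :=
  forall U V : C -> Prop, openC U -> openC V ->
    (forall z, A z -> U z \/ V z) ->
    (forall z, A z -> U z -> V z -> False) ->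
    (exists z, A z /\ U z) -> (exists z, A z /\ V z) -> False.

Definition domainC (A : C -> Prop) : Prop :=
  (exists z, A z) /\ openC A /\ connectedC A.

Definition unboundedC (A : C -> Prop) : Prop :=
  forall M, exists z, A z /\ M < Cmod z.

Definition holo_on (f : C -> C) (A : C -> Prop) : Prop :=
  forall z, A z -> exists l : C, is_derive (K := C_AbsRing) (V := C_NormedModule) f z l.

Definition conformal_onto_H (Om : C -> Prop) (tau phi : C -> C) : Prop :=
  holo_on tau Om /\
  (forall z, Om z -> right_half_plane (tau z) /\ phi (tau z) = z) /\
  (forall xi, right_half_plane xi -> Om (phi xi) /\ tau (phi xi) = xi).

Definition critical_value (f df : C -> C) (a : C) : Prop :=
  exists z, df z = 0 /\ f z = a.

Definition asymptotic_value (f : C -> C) (a : C) : Prop :=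
  exists gam : R -> C,
    (forall s, 0 <= s -> continuous gam s) /\
    filterlim (fun s => Cmod (gam s)) (Rbar_locally p_infty) (Rbar_locally p_infty) /\
    filterlim (fun s => f (gam s)) (Rbar_locally p_infty) (locally a).

Definition sing_set (f df : C -> C) : C -> Prop :=
  closureC (fun a => critical_value f df a \/ asymptotic_value f a).

Definition common_hyps (N : nat) (Om : nat -> C -> Prop)
    (tau phi : nat -> C -> C) (f : C -> C) : Prop :=
  (forall j, (j < N)%nat -> conformal_onto_H (Om j) (tau j) (phi j)) /\
  (forall j, (j < N)%nat -> forall z, Om j z -> f z = Cexp (tau j z)) /\
  (forall j k, (j < N)%nat -> (k < N)%nat -> j <> k ->
      forall z, Om j z -> Om k z -> False) /\
  (forall w, closureC (fun z => exists j, (j < N)%nat /\ Om j z) w -> 1 < Cmod w) /\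
  (forall j, (j < N)%nat -> exists M T0, forall T, T0 <= T ->
     forall xi xi', Qsq T xi -> ~ Qsq (T / 8) xi -> Qsq T xi' -> ~ Qsq (T / 8) xi' ->
       Cmod (phi j xi) <= M * Cmod (phi j xi')).

Definition entire_case (N : nat) (Om : nat -> C -> Prop)
    (tau phi : nat -> C -> C) (f df : C -> C) : Prop :=
  (forall z, is_derive (K := C_AbsRing) (V := C_NormedModule) f z (df z)) /\
  (forall a, sing_set f df a -> unit_disk a) /\
  (* Om 0, ..., Om (N-1) are the components of f^{-1}(D^* ) *)
  (forall j, (j < N)%nat -> domainC (Om j)) /\
  (forall z, ext_disk (f z) <-> exists j, (j < N)%nat /\ Om j z).

Definition model_case (N : nat) (Om : nat -> C -> Prop)
    (tau phi : nat -> C -> C) (f df : C -> C) : Prop :=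
  (forall z, (exists j, (j < N)%nat /\ Om j z) ->
     is_derive (K := C_AbsRing) (V := C_NormedModule) f z (df z)) /\
  (forall j, (j < N)%nat -> domainC (Om j) /\ unboundedC (Om j)) /\
  (forall j, (j < N)%nat -> forall xi : nat -> C,
     (forall n, right_half_plane (xi n)) ->
     is_lim_seq (fun n => Cmod (xi n)) p_infty ->
     is_lim_seq (fun n => Cmod (phi j (xi n))) p_infty).

Definition classD (N : nat) (Om : nat -> C -> Prop)
    (tau phi dphi : nat -> C -> C) (f df : C -> C) : Prop :=
  (0 < N)%nat /\
  common_hyps N Om tau phi f /\
  (forall j, (j < N)%nat -> forall xi, right_half_plane xi ->
     is_derive (K := C_AbsRing) (V := C_NormedModule) (phi j) xi (dphi j xi)) /\
  (entire_case N Om tau phi f df \/ model_case N Om tau phi f df).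

(* derivative of phi_{j,T}(xi) = phi_j(T xi) / |phi_j(T)| (chain rule) *)
Definition dphiT (phi dphi : C -> C) (T : R) (xi : C) : C :=
  (RtoC T * dphi (RtoC T * xi) / RtoC (Cmod (phi (RtoC T))))%C.

Definition beta (dh : C -> C) (r t : R) : R :=
  ln (RInt (fun y => Rpower (Cmod (dh (r, y))) t) (-2) (-1)
      + RInt (fun y => Rpower (Cmod (dh (r, y))) t) 1 2)
  / ln (1 / r).

Definition limsup_pinfty (g : R -> R) : Rbar :=
  Rbar_glb (fun y => exists M : R,
    y = Rbar_lub (fun x => exists T, M < T /\ x = Finite (g T))).

Definition beta_inf (phi dphi : C -> C) (t : R) : Rbar :=
  limsup_pinfty (fun T => beta (dphiT phi dphi T) (1 / T) t).

Definition b_inf_j (phi dphi : C -> C) (t : R) : Rbar :=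
  Rbar_plus (beta_inf phi dphi t) (Finite (1 - t)).

Definition Rbar_max (x y : Rbar) : Rbar := if Rbar_le_dec x y then y else x.

Definition b_inf (N : nat) (phi dphi : nat -> C -> C) (t : R) : Rbar :=
  fold_right Rbar_max m_infty (map (fun j => b_inf_j (phi j) (dphi j) t) (seq 0 N)).

Definition smallest_pos_zero (b : R -> Rbar) (th : R) : Prop :=
  0 < th /\ b th = Finite 0 /\ forall s, 0 < s < th -> b s <> Finite 0.

Definition is_Theta (N : nat) (phi dphi : nat -> C -> C) (Th : R) : Prop :=
  exists th : nat -> R,
    (forall j, (j < N)%nat -> smallest_pos_zero (b_inf_j (phi j) (dphi j)) (th j)) /\
    Th = fold_right Rmax (th 0%nat) (map th (seq 0 N)).

Definition negative_spectrum (N : nat) (phi dphi : nat -> C -> C) (Th : R) : Prop :=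
  forall t, Th < t -> Rbar_lt (b_inf N phi dphi t) (Finite 0).

Definition logderiv_norm (f df : C -> C) (z : C) : R :=
  Cmod (df z) * Cmod z / Cmod (f z).

(* L_t 1 (w) = sum_{z in f^{-1}(w)} |f'(z)|_1^{-t}, as a sum of nonnegative terms
   in [0, +oo] (supremum of finite partial sums); preimages are taken in Omega. *)
Definition transfer1 (N : nat) (Om : nat -> C -> Prop) (f df : C -> C)
    (t : R) (w : C) : Rbar :=
  Lub_Rbar (fun s => exists l : list C,
    NoDup l /\
    (forall z, In z l -> (exists j, (j < N)%nat /\ Om j z) /\ f z = w) /\
    s = fold_right Rplus 0 (map (fun z => Rpower (logderiv_norm f df z) (- t)) l)).

(* Main.v *)
(* Write q_j = phi_j'/phi_j on the half-plane and x = ln |w|. The preimages of w in Omega_j are the points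
   phi_j (x + i(arg w + 2 pi k)), and L_t 1(w) is the sum over j and k of |q_j|^t at these arguments.
   A Koebe-type distortion theorem makes |q_j| comparable at points of bounded hyperbolic distance, so for
   bounded x the sum over k is comparable with the integral of |q_j|^t over the line Re = 1. Its dyadic blocks
   T <= |y| <= 2T are, after rescaling, integral means of phi_{j,T}', hence of size T^(b_T(t)) with
   limsup b_T(t) = b_{infty,j}(t). So the sum converges if b_{infty,j}(t) < 0 and diverges if it is > 0.
   As |q_j| is bounded on the line, b_{infty,j}(t) < 0 persists for larger t; hence b_{infty,j} > 0 on
   (0, Theta) for the j realizing Theta. Theta >= 1 because log |phi_j| is unbounded on the line while its
   derivative is dominated by |q_j|. For large x, |q_j| <= C/x gives |q_j|^t <= (C/x)^(1/p) |q_j|^s with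
   s = t - 1/p > Theta, and the power sums with exponent s >= 1 are controlled on the whole half-plane by
   their values near Re = 1 through Phragmen-Lindelof. *)

Require Import Defs.
From Stdlib Require Import Reals List Lra Lia Psatz ZArith Classical ClassicalEpsilon Ranalysis5.
From Stdlib Require FinFun.
From Coquelicot Require Import Coquelicot.
Open Scope R_scope.

(** * Complex differentiation *)

(** The condition on squares is what replaces phi' by phi'/phi: for large T and T <= |y| <= 2T,
    |phi(1 + iy)| agrees with |phi(T)| up to a bounded factor, so the rescaled means see only |q_j|.
    Distortion is wanted up to constants only, so a square root does the work of the sharp Koebe
    theorem. A univalent f omitting a has branches g of sqrt(f - a) that never take both of the
    values c and -c, and a Moebius map turns this omission into boundedness. For large |w| the
    obstacle is that comparing Re = x with Re = 1 by distortion costs a factor growing with x, while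
    a sum of powers |q_j|^s is not the modulus of a holomorphic function. At a fixed target point it
    is therefore written as a linear form in the q_j with coefficients of modulus |q_j|^(s - 1), and
    Phragmen-Lindelof is applied to that form. This duality works for s >= 1, whence the interest of
    Theta >= 1; the same inequality turns 1/p < t/Theta - 1 into t - 1/p > Theta. *)

Definition ccont (f : C -> C) (z : C) : Prop :=
  forall eps, 0 < eps -> exists d, 0 < d /\
    forall u, Cmod (u - z) < d -> Cmod (f u - f z) < eps.

(* Caratheodory's form of complex differentiability: the calculus rules become algebraic identities. *)
Definition cdiff (f : C -> C) (z l : C) : Prop :=
  exists g, ccont g z /\ g z = l /\ forall u, f u = (f z + (u - z) * g u)%C.

Lemma Cmod_minus_sym (x y : C) : Cmod (x - y) = Cmod (y - x).
Proof. rewrite <- Cmod_opp. f_equal. ring. Qed.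

Lemma Cmod_triangle_sub (x y z : C) : Cmod (x - z) <= Cmod (x - y) + Cmod (y - z).
Proof. replace (x - z)%C with ((x - y) + (y - z))%C by ring. apply Cmod_triangle. Qed.

Lemma Cmod_sub_le (x y : C) : Cmod x <= Cmod (x - y) + Cmod y.
Proof. replace x with ((x - y) + y)%C at 1 by ring. apply Cmod_triangle. Qed.

Lemma cdiff_eq (f : C -> C) (z l m : C) : cdiff f z l -> l = m -> cdiff f z m.
Proof. intros H E. rewrite <- E. exact H. Qed.

Lemma Cmod_self (z : C) : Cmod (z - z) = 0.
Proof. replace (z - z)%C with (RtoC 0) by ring. apply Cmod_0. Qed.

Lemma ccont_const (c z : C) : ccont (fun _ => c) z.
Proof.
  intros eps He. exists 1. split; [lra|]. intros u _.
  rewrite Cmod_self. exact He.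
Qed.

Lemma ccont_id (z : C) : ccont (fun u => u) z.
Proof. intros eps He. exists eps. split; auto. Qed.

Lemma ccont_plus (f g : C -> C) (z : C) :
  ccont f z -> ccont g z -> ccont (fun u => (f u + g u)%C) z.
Proof.
  intros Hf Hg eps He.
  destruct (Hf (eps / 2)) as [d1 [Hd1 H1]]; [lra|].
  destruct (Hg (eps / 2)) as [d2 [Hd2 H2]]; [lra|].
  exists (Rmin d1 d2). split; [apply Rmin_pos; auto|]. intros u Hu.
  assert (Hu1 := H1 u (Rlt_le_trans _ _ _ Hu (Rmin_l _ _))).
  assert (Hu2 := H2 u (Rlt_le_trans _ _ _ Hu (Rmin_r _ _))).
  replace (f u + g u - (f z + g z))%C with ((f u - f z) + (g u - g z))%C by ring.
  eapply Rle_lt_trans; [apply Cmod_triangle|]. lra.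
Qed.

Lemma ccont_mult (f g : C -> C) (z : C) :
  ccont f z -> ccont g z -> ccont (fun u => (f u * g u)%C) z.
Proof.
  intros Hf Hg eps He.
  assert (P1 := Cmod_ge_0 (f z)). assert (P2 := Cmod_ge_0 (g z)).
  set (K := Cmod (f z) + Cmod (g z) + 1).
  assert (HK : 0 < K) by (unfold K; lra).
  set (e := Rmin 1 (eps / (2 * K))).
  assert (H0 : 0 < e).
  { apply Rmin_pos; [lra|]. apply Rdiv_lt_0_compat; lra. }
  assert (He1 : e <= 1) by apply Rmin_l.
  assert (He2 : e * (2 * K) <= eps).
  { apply Rle_trans with (eps / (2 * K) * (2 * K)).
    - apply Rmult_le_compat_r; [lra|apply Rmin_r].
    - right. field. lra. }
  destruct (Hf e H0) as [d1 [Hd1 H1]].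
  destruct (Hg e H0) as [d2 [Hd2 H2]].
  exists (Rmin d1 d2). split; [apply Rmin_pos; auto|]. intros u Hu.
  assert (Hu1 := H1 u (Rlt_le_trans _ _ _ Hu (Rmin_l _ _))).
  assert (Hu2 := H2 u (Rlt_le_trans _ _ _ Hu (Rmin_r _ _))).
  replace (f u * g u - f z * g z)%C
    with (((f u - f z) * (g u - g z) + f z * (g u - g z)) + (f u - f z) * g z)%C by ring.
  eapply Rle_lt_trans; [apply Cmod_triangle|].
  eapply Rle_lt_trans; [apply Rplus_le_compat_r, Cmod_triangle|].
  rewrite !Cmod_mult.
  assert (Q1 := Cmod_ge_0 (f u - f z)). assert (Q2 := Cmod_ge_0 (g u - g z)).
  assert (Cmod (f u - f z) * Cmod (g u - g z) <= e * 1) by (apply Rmult_le_compat; lra).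
  assert (Cmod (f z) * Cmod (g u - g z) <= Cmod (f z) * e) by (apply Rmult_le_compat_l; lra).
  assert (Cmod (f u - f z) * Cmod (g z) <= e * Cmod (g z)) by (apply Rmult_le_compat_r; lra).
  assert (e * K = e * Cmod (f z) + e * Cmod (g z) + e) by (unfold K; ring).
  assert (0 < e * K) by (apply Rmult_lt_0_compat; lra).
  lra.
Qed.

Lemma ccont_opp (f : C -> C) (z : C) : ccont f z -> ccont (fun u => (- f u)%C) z.
Proof.
  intros Hf eps He. destruct (Hf eps He) as [d [Hd H]]. exists d. split; auto.
  intros u Hu. replace (- f u - - f z)%C with (- (f u - f z))%C by ring.
  rewrite Cmod_opp. auto.
Qed.

Lemma ccont_minus (f g : C -> C) (z : C) :
  ccont f z -> ccont g z -> ccont (fun u => (f u - g u)%C) z.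
Proof. intros Hf Hg. apply ccont_plus; [exact Hf|apply ccont_opp; exact Hg]. Qed.

Lemma ccont_comp (f g : C -> C) (z : C) :
  ccont g z -> ccont f (g z) -> ccont (fun u => f (g u)) z.
Proof.
  intros Hg Hf eps He. destruct (Hf eps He) as [d [Hd H]].
  destruct (Hg d Hd) as [d' [Hd' H']]. exists d'. split; auto.
Qed.

Lemma ccont_inv (f : C -> C) (z : C) : ccont f z -> f z <> 0 -> ccont (fun u => (/ f u)%C) z.
Proof.
  intros Hf Hz eps He.
  assert (Hp := proj1 (Cmod_gt_0 _) Hz). set (m := Cmod (f z)) in *.
  destruct (Hf (Rmin (m / 2) (eps * (m * m / 2)))) as [d [Hd H]].
  { apply Rmin_pos; [lra|]. apply Rmult_lt_0_compat; [lra|]. nra. }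
  exists d. split; auto. intros u Hu. specialize (H u Hu).
  assert (Ha := Rlt_le_trans _ _ _ H (Rmin_l _ _)).
  assert (Hb := Rlt_le_trans _ _ _ H (Rmin_r _ _)).
  assert (Hm : m / 2 < Cmod (f u)).
  { assert (HH := Cmod_sub_le (f z) (f u)). rewrite Cmod_minus_sym in HH.
    fold m in HH. lra. }
  assert (Hn : f u <> 0) by (apply Cmod_gt_0; lra).
  replace (/ f u - / f z)%C with (- (f u - f z) * / (f u * f z))%C by (field; auto).
  rewrite Cmod_mult, Cmod_opp, Cmod_inv, Cmod_mult.
  2:{ apply Cmult_neq_0; auto. }
  fold m. apply Rmult_lt_reg_r with (Cmod (f u) * m); [nra|].
  rewrite Rmult_assoc, Rinv_l, Rmult_1_r by nra.
  eapply Rlt_le_trans; [exact Hb|]. apply Rmult_le_compat_l; nra.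
Qed.

Lemma ccont_ext_loc (f g : C -> C) (z : C) (d : R) : 0 < d ->
  (forall u, Cmod (u - z) < d -> f u = g u) -> ccont f z -> ccont g z.
Proof.
  intros Hd Hfg Hf eps He. destruct (Hf eps He) as [d' [Hd' H]].
  exists (Rmin d d'). split; [apply Rmin_pos; auto|]. intros u Hu.
  rewrite <- !Hfg.
  - apply H. eapply Rlt_le_trans; [exact Hu|apply Rmin_r].
  - rewrite Cmod_self. exact Hd.
  - eapply Rlt_le_trans; [exact Hu|apply Rmin_l].
Qed.

Lemma cdiff_ccont (f : C -> C) (z l : C) : cdiff f z l -> ccont f z.
Proof.
  intros [g [Hg [_ H]]].
  assert (K : ccont (fun u => (f z + (u - z) * g u)%C) z).
  { apply ccont_plus; [apply ccont_const|]. apply ccont_mult; auto.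
    apply ccont_minus; [apply ccont_id|apply ccont_const]. }
  apply (ccont_ext_loc (fun u => (f z + (u - z) * g u)%C) f z 1); auto with real.
Qed.

Lemma cdiff_const (c z : C) : cdiff (fun _ => c) z 0.
Proof.
  exists (fun _ => RtoC 0). split; [apply ccont_const|]. split; auto. intros; ring.
Qed.

Lemma cdiff_id (z : C) : cdiff (fun u => u) z 1.
Proof.
  exists (fun _ => RtoC 1). split; [apply ccont_const|]. split; auto. intros; ring.
Qed.

Lemma cdiff_plus (f g : C -> C) (z l m : C) :
  cdiff f z l -> cdiff g z m -> cdiff (fun u => (f u + g u)%C) z (l + m).
Proof.
  intros [a [Ha [Ea Fa]]] [b [Hb [Eb Fb]]].
  exists (fun u => (a u + b u)%C). split; [apply ccont_plus; auto|].
  split; [congruence|]. intros u. rewrite (Fa u), (Fb u). ring.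
Qed.

Lemma cdiff_mult (f g : C -> C) (z l m : C) :
  cdiff f z l -> cdiff g z m -> cdiff (fun u => (f u * g u)%C) z (l * g z + f z * m).
Proof.
  intros Hf Hg. assert (Cg := cdiff_ccont _ _ _ Hg).
  destruct Hf as [a [Ha [Ea Fa]]]. destruct Hg as [b [Hb [Eb Fb]]].
  exists (fun u => (a u * g u + f z * b u)%C). split.
  { apply ccont_plus; apply ccont_mult; auto. apply ccont_const. }
  split; [congruence|]. intros u. rewrite (Fa u). rewrite (Fb u) at 1 2. ring.
Qed.

Lemma cdiff_opp (f : C -> C) (z l : C) : cdiff f z l -> cdiff (fun u => (- f u)%C) z (- l).
Proof.
  intros [a [Ha [Ea Fa]]]. exists (fun u => (- a u)%C).
  split; [apply ccont_opp; auto|]. split; [congruence|]. intros u. rewrite (Fa u). ring.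
Qed.

Lemma cdiff_minus (f g : C -> C) (z l m : C) :
  cdiff f z l -> cdiff g z m -> cdiff (fun u => (f u - g u)%C) z (l - m).
Proof. intros Hf Hg. apply cdiff_plus; [exact Hf|apply cdiff_opp; exact Hg]. Qed.

Lemma cdiff_comp (f g : C -> C) (z l m : C) :
  cdiff g z m -> cdiff f (g z) l -> cdiff (fun u => f (g u)) z (l * m).
Proof.
  intros Hg Hf. assert (Cg := cdiff_ccont _ _ _ Hg).
  destruct Hf as [a [Ha [Ea Fa]]]. destruct Hg as [b [Hb [Eb Fb]]].
  exists (fun u => (a (g u) * b u)%C). split.
  { apply ccont_mult; auto. apply ccont_comp; auto. }
  split; [congruence|]. intros u. rewrite (Fa (g u)). rewrite (Fb u) at 1. ring.
Qed.

(** The factorization in [cdiff] is demanded at every point of the plane. The factor is therefore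
    kept on the disc of radius [d] and replaced outside by the plain difference quotient, whose
    denominator cannot vanish there; [cdiff_inv] uses the same device. *)
Lemma cdiff_ext_loc (f g : C -> C) (z l : C) (d : R) : 0 < d ->
  (forall u, Cmod (u - z) < d -> f u = g u) -> cdiff f z l -> cdiff g z l.
Proof.
  intros Hd Hfg [a [Ha [Ea Fa]]].
  assert (Hz : f z = g z).
  { apply Hfg. rewrite Cmod_self. exact Hd. }
  set (b := fun u => if Rlt_dec (Cmod (u - z)) d then a u else ((g u - g z) / (u - z))%C).
  exists b. split; [|split].
  - apply (ccont_ext_loc a b z d Hd); auto. intros u Hu. unfold b.
    destruct (Rlt_dec _ _); [auto|lra].
  - unfold b. destruct (Rlt_dec _ _) as [|n]; [auto|]. exfalso. apply n.
    rewrite Cmod_self. exact Hd.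
  - intros u. unfold b. destruct (Rlt_dec _ _) as [h|n].
    + rewrite <- Hfg, Fa, Hz by auto. reflexivity.
    + field. intros E. apply n. rewrite E, Cmod_0. exact Hd.
Qed.

Lemma cdiff_inv (f : C -> C) (z l : C) :
  cdiff f z l -> f z <> 0 -> cdiff (fun u => (/ f u)%C) z (- l / (f z * f z)).
Proof.
  intros Hf Hz. assert (Cf := cdiff_ccont _ _ _ Hf).
  destruct (Cf (Cmod (f z))) as [d [Hd H]]; [apply Cmod_gt_0; auto|].
  assert (Hnz : forall u, Cmod (u - z) < d -> f u <> 0).
  { intros u Hu E. specialize (H u Hu). rewrite E in H.
    replace (0 - f z)%C with (- f z)%C in H by ring. rewrite Cmod_opp in H. lra. }
  destruct Hf as [a [Ha [Ea Fa]]].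
  set (b := fun u => if Rlt_dec (Cmod (u - z)) d then (- a u * (/ f u * / f z))%C
                      else ((/ f u - / f z) / (u - z))%C).
  exists b. split; [|split].
  - apply (ccont_ext_loc (fun u => (- a u * (/ f u * / f z))%C) b z d Hd).
    + intros u Hu. unfold b. destruct (Rlt_dec _ _); [auto|lra].
    + apply ccont_mult; [apply ccont_opp; auto|].
      apply ccont_mult; [apply ccont_inv; auto|apply ccont_const].
  - unfold b. destruct (Rlt_dec _ _) as [|n].
    + rewrite Ea. field. auto.
    + exfalso. apply n. rewrite Cmod_self. exact Hd.
  - intros u. unfold b. destruct (Rlt_dec _ _) as [h|n].
    + assert (Hu := Hnz u h). rewrite <- (Cmult_1_l (/ f u)) at 1.
      replace ((u - z) * (- a u * (/ f u * / f z)))%C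
        with (- ((u - z) * a u) * (/ f u * / f z))%C by ring.
      replace ((u - z) * a u)%C with (f u - f z)%C by (rewrite (Fa u); ring).
      field. auto.
    + assert (Hs : (u - z <> 0)%C) by (intros E; apply n; rewrite E, Cmod_0; exact Hd).
      set (p := (/ f u)%C). set (q := (/ f z)%C). field. exact Hs.
Qed.

Lemma cdiff_div (f g : C -> C) (z l m : C) :
  cdiff f z l -> cdiff g z m -> g z <> 0 ->
  cdiff (fun u => (f u / g u)%C) z ((l * g z - f z * m) / (g z * g z)).
Proof.
  intros Hf Hg Hz.
  replace ((l * g z - f z * m) / (g z * g z))%C
    with (l * (/ g z) + f z * (- m / (g z * g z)))%C by (field; auto).
  apply (cdiff_mult f (fun u => (/ g u)%C)); auto. apply cdiff_inv; auto.
Qed.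

Lemma cdiff_of_eps (f : C -> C) (z l : C) :
  (forall eps, 0 < eps -> exists d, 0 < d /\ forall u, Cmod (u - z) < d ->
    Cmod (f u - f z - (u - z) * l) <= eps * Cmod (u - z)) -> cdiff f z l.
Proof.
  intros H.
  set (g := fun u => if Ceq_dec u z then l else ((f u - f z) / (u - z))%C).
  assert (Hs : forall u, u <> z -> (u - z <> 0)%C).
  { intros u n E. apply n. replace u with ((u - z) + z)%C by ring. rewrite E. ring. }
  exists g. split; [|split].
  - intros eps He. destruct (H (eps / 2)) as [d [Hd H']]; [lra|].
    exists d. split; auto. intros u Hu. specialize (H' u Hu).
    unfold g. destruct (Ceq_dec z z) as [_|n]; [|congruence].
    destruct (Ceq_dec u z) as [E|n].
    + rewrite Cmod_self. exact He.
    + specialize (Hs u n). assert (Hp := proj1 (Cmod_gt_0 _) Hs).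
      replace ((f u - f z) / (u - z) - l)%C
        with (((f u - f z) - (u - z) * l) / (u - z))%C by (field; auto).
      rewrite Cmod_div by auto.
      apply Rle_lt_trans with (eps / 2); [|lra].
      apply Rmult_le_reg_r with (Cmod (u - z)); auto.
      unfold Rdiv at 1. rewrite Rmult_assoc, Rinv_l, Rmult_1_r; lra.
  - unfold g. destruct (Ceq_dec z z); congruence.
  - intros u. unfold g. destruct (Ceq_dec u z) as [E|n].
    + rewrite E. ring.
    + field. auto.
Qed.

(** Bridge from the hypotheses of the theorem, which speak of [is_derive] over [C_AbsRing], to the
    calculus of [cdiff]. *)
Lemma is_derive_cdiff (f : C -> C) (z l : C) :
  is_derive (K := C_AbsRing) (V := C_NormedModule) f z l -> cdiff f z l.
Proof.
  intros [_ H]. apply cdiff_of_eps. intros eps He.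
  specialize (H z (fun P HP => HP) (mkposreal _ He)).
  apply (locally_le_locally_norm (K := C_AbsRing) (V := AbsRing_NormedModule C_AbsRing)) in H.
  destruct H as [d Hd]. exists d. split; [apply cond_pos|]. intros u Hu. exact (Hd u Hu).
Qed.

Lemma cdiff_eps (f : C -> C) (z l : C) : cdiff f z l ->
  forall eps, 0 < eps -> exists d, 0 < d /\ forall u, Cmod (u - z) < d ->
    Cmod (f u - f z - (u - z) * l) <= eps * Cmod (u - z).
Proof.
  intros [g [Hg [Eg Fg]]] eps He. destruct (Hg eps He) as [d [Hd H]].
  exists d. split; auto. intros u Hu. rewrite (Fg u).
  replace (f z + (u - z) * g u - f z - (u - z) * l)%C with ((g u - l) * (u - z))%C by ring.
  rewrite Cmod_mult. apply Rmult_le_compat_r; [apply Cmod_ge_0|].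
  rewrite <- Eg. left. auto.
Qed.

Lemma cdiff_unique (f : C -> C) (z l m : C) : cdiff f z l -> cdiff f z m -> l = m.
Proof.
  intros Hl Hm. destruct (Ceq_dec l m) as [|n]; auto. exfalso.
  assert (Hnz : (l - m <> 0)%C).
  { intros E. apply n. replace l with ((l - m) + m)%C by ring. rewrite E. ring. }
  assert (Hp := proj1 (Cmod_gt_0 _) Hnz). set (e := Cmod (l - m)) in *.
  destruct (cdiff_eps _ _ _ Hl (e / 4)) as [d1 [Hd1 H1]]; [lra|].
  destruct (cdiff_eps _ _ _ Hm (e / 4)) as [d2 [Hd2 H2]]; [lra|].
  set (h := Rmin d1 d2 / 2). assert (Hh : 0 < Rmin d1 d2) by (apply Rmin_pos; auto).
  assert (Hl1 := Rmin_l d1 d2). assert (Hl2 := Rmin_r d1 d2).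
  assert (Em : Cmod (z + h - z) = h).
  { replace (z + h - z)%C with (RtoC h) by ring. rewrite Cmod_R. apply Rabs_pos_eq. unfold h; lra. }
  specialize (H1 (z + h)%C). specialize (H2 (z + h)%C). rewrite Em in H1, H2.
  assert (K1 := H1 ltac:(unfold h; lra)). assert (K2 := H2 ltac:(unfold h; lra)).
  assert (K : h * e <= e / 4 * h + e / 4 * h).
  { replace (h * e) with (Cmod ((z + h - z) * (l - m))) by (rewrite Cmod_mult, Em; reflexivity).
    replace ((z + h - z) * (l - m))%C
      with ((f (z + h) - f z - (z + h - z) * m) - (f (z + h) - f z - (z + h - z) * l))%C by ring.
    eapply Rle_trans; [apply Cmod_triangle|]. rewrite Cmod_opp. lra. }
  assert (0 < h) by (unfold h; lra). nra.
Qed.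

(** * The complex exponential *)

Lemma Cexp_plus (z w : C) : Cexp (z + w) = (Cexp z * Cexp w)%C.
Proof.
  unfold Cexp, Cplus, Cmult; simpl. rewrite exp_plus, cos_plus, sin_plus.
  apply injective_projections; simpl; ring.
Qed.

Lemma Cexp_0 : Cexp 0 = 1.
Proof.
  unfold Cexp, RtoC; simpl. rewrite exp_0, cos_0, sin_0.
  apply injective_projections; simpl; ring.
Qed.

Lemma Cmod_Cexp (z : C) : Cmod (Cexp z) = exp (fst z).
Proof.
  unfold Cexp, Cmod; simpl.
  replace (exp (fst z) * cos (snd z) * (exp (fst z) * cos (snd z) * 1) +
           exp (fst z) * sin (snd z) * (exp (fst z) * sin (snd z) * 1))
    with (exp (fst z) * exp (fst z) * (Rsqr (sin (snd z)) + Rsqr (cos (snd z))))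
    by (unfold Rsqr; ring).
  rewrite sin2_cos2, Rmult_1_r. apply sqrt_square. left. apply exp_pos.
Qed.

Lemma Cexp_neq_0 (z : C) : Cexp z <> 0.
Proof. apply Cmod_gt_0. rewrite Cmod_Cexp. apply exp_pos. Qed.

Lemma Cmod_le_sum (z : C) : Cmod z <= Rabs (fst z) + Rabs (snd z).
Proof.
  replace z with ((fst z, 0) + Ci * (snd z, 0))%C at 1.
  - eapply Rle_trans; [apply Cmod_triangle|]. rewrite Cmod_mult, Cmod_Ci.
    change (fst z, 0) with (RtoC (fst z)). change (snd z, 0) with (RtoC (snd z)).
    rewrite !Cmod_R. lra.
  - apply injective_projections; simpl; ring.
Qed.

Lemma Rabs_fst_le (z : C) : Rabs (fst z) <= Cmod z.
Proof. eapply Rle_trans; [|apply Rmax_Cmod]. apply Rmax_l. Qed.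

Lemma Rabs_snd_le (z : C) : Rabs (snd z) <= Cmod z.
Proof. eapply Rle_trans; [|apply Rmax_Cmod]. apply Rmax_r. Qed.

Lemma derivable_pt_lim_eps (f : R -> R) (x l : R) : derivable_pt_lim f x l ->
  forall eps, 0 < eps -> exists d, 0 < d /\ forall h, Rabs h < d ->
    Rabs (f (x + h) - f x - l * h) <= eps * Rabs h.
Proof.
  intros H eps He. destruct (H eps He) as [d Hd]. exists d. split; [apply cond_pos|].
  intros h Hh. destruct (Req_dec h 0) as [E|n].
  - subst h. rewrite Rplus_0_r, Rmult_0_r, Rminus_0_r, Rminus_diag, Rabs_R0. lra.
  - specialize (Hd h n Hh).
    replace (f (x + h) - f x - l * h) with (((f (x + h) - f x) / h - l) * h) by (field; auto).
    rewrite Rabs_mult. apply Rmult_le_compat_r; [apply Rabs_pos|lra].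
Qed.

Lemma cdiff_Cexp_0 : cdiff Cexp 0 1.
Proof.
  apply cdiff_of_eps. intros eps He.
  (* The error expands into four terms in the real part and five in the imaginary part, each at most
     eps/12 times |u|, so nine twelfths of the allowance are spent. *)
  set (e := Rmin 1 (eps / 12)).
  assert (H0 : 0 < e) by (apply Rmin_pos; lra).
  assert (H1 : e <= 1) by apply Rmin_l. assert (H2 : e <= eps / 12) by apply Rmin_r.
  destruct (derivable_pt_lim_eps exp 0 1) with (eps := e) as [d1 [Hd1 E1]]; auto.
  { rewrite <- exp_0. apply derivable_pt_lim_exp. }
  destruct (derivable_pt_lim_eps cos 0 0) with (eps := e) as [d2 [Hd2 E2]]; auto.
  { replace 0 with (- sin 0) at 2 by (rewrite sin_0; ring). apply derivable_pt_lim_cos. }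
  destruct (derivable_pt_lim_eps sin 0 1) with (eps := e) as [d3 [Hd3 E3]]; auto.
  { rewrite <- cos_0. apply derivable_pt_lim_sin. }
  set (d := Rmin 1 (Rmin (eps / 12) (Rmin d1 (Rmin d2 d3)))).
  exists d. split.
  { unfold d. repeat apply Rmin_pos; lra. }
  intros [a b] Hu. rewrite Cexp_0.
  replace ((a, b) - 0)%C with ((a, b) : C) in * by (apply injective_projections; simpl; ring).
  set (m := Cmod (a, b)) in *.
  assert (Ma : Rabs a <= m) by apply (Rabs_fst_le (a, b)).
  assert (Mb : Rabs b <= m) by apply (Rabs_snd_le (a, b)).
  assert (D0 : d <= 1) by apply Rmin_l.
  assert (D1 : d <= eps / 12) by (unfold d; eapply Rle_trans; [apply Rmin_r|apply Rmin_l]).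
  assert (D2 : d <= d1) by (unfold d; eapply Rle_trans; [apply Rmin_r|]; eapply Rle_trans; [apply Rmin_r|apply Rmin_l]).
  assert (D3 : d <= d2) by (unfold d; do 3 (eapply Rle_trans; [apply Rmin_r|]); apply Rmin_l).
  assert (D4 : d <= d3) by (unfold d; do 3 (eapply Rle_trans; [apply Rmin_r|]); apply Rmin_r).
  specialize (E1 a ltac:(lra)). specialize (E2 b ltac:(lra)). specialize (E3 b ltac:(lra)).
  rewrite Rplus_0_l, ?exp_0, ?cos_0, ?sin_0 in *.
  rewrite Rmult_1_l in *. rewrite Rmult_0_l, Rminus_0_r in E2. rewrite Rminus_0_r in E3.
  set (x := exp a - 1 - a) in *. set (y := cos b - 1) in *. set (w := sin b - b) in *.
  assert (P := Rabs_pos a). assert (P' := Rabs_pos b).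
  assert (Xb : Rabs x <= e * m) by (eapply Rle_trans; [exact E1|apply Rmult_le_compat_l; lra]).
  assert (Yb : Rabs y <= e * m) by (eapply Rle_trans; [exact E2|apply Rmult_le_compat_l; lra]).
  assert (Wb : Rabs w <= e * m) by (eapply Rle_trans; [exact E3|apply Rmult_le_compat_l; lra]).
  assert (Hm : 0 <= m) by apply Cmod_ge_0.
  assert (Hm1 : m <= 1) by lra. assert (Hme : m <= eps / 12) by lra.
  assert (Q : e * m <= eps / 12 * m) by (apply Rmult_le_compat_r; lra).
  assert (Q' : e * m <= 1) by nra.
  eapply Rle_trans; [apply Cmod_le_sum|]. unfold Cexp; cbn [fst snd Cplus Cminus Copp Cmult RtoC].
  replace (exp a * cos b + - (1) + - (a * 1 - b * 0)) with (x * y + x + a * y + y) by (unfold x, y; ring).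
  replace (exp a * sin b + - 0 + - (a * 0 + b * 1)) with (x * w + x * b + a * w + a * b + w)
    by (unfold x, w; ring).
  assert (T1 : Rabs (x * y + x + a * y + y) <= eps / 12 * m * 4).
  { repeat (eapply Rle_trans; [apply Rabs_triang|]). 
    assert (Rabs (x * y) <= eps / 12 * m).
    { rewrite Rabs_mult. assert (A := Rabs_pos x). assert (A' := Rabs_pos y). nra. }
    assert (Rabs (a * y) <= eps / 12 * m).
    { rewrite Rabs_mult. assert (A' := Rabs_pos y). nra. }
    assert (Z1 := Rabs_triang (x * y + x) (a * y)). assert (Z2 := Rabs_triang (x * y) x). lra. }
  assert (T2 : Rabs (x * w + x * b + a * w + a * b + w) <= eps / 12 * m * 5).
  { repeat (eapply Rle_trans; [apply Rabs_triang|]).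
    assert (A := Rabs_pos x). assert (A' := Rabs_pos w).
    assert (Rabs (x * w) <= eps / 12 * m) by (rewrite Rabs_mult; nra).
    assert (Rabs (x * b) <= eps / 12 * m) by (rewrite Rabs_mult; nra).
    assert (Rabs (a * w) <= eps / 12 * m) by (rewrite Rabs_mult; nra).
    assert (Rabs (a * b) <= eps / 12 * m) by (rewrite Rabs_mult; nra).
    assert (Z1 := Rabs_triang (x * w + x * b + a * w) (a * b)).
    assert (Z2 := Rabs_triang (x * w + x * b) (a * w)). assert (Z3 := Rabs_triang (x * w) (x * b)). lra. }
  nra.
Qed.

Lemma cdiff_Cexp (z : C) : cdiff Cexp z (Cexp z).
Proof.
  apply (cdiff_ext_loc (fun u => (Cexp z * Cexp (u - z))%C) Cexp z (Cexp z) 1); [lra| |].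
  - intros u _. rewrite <- Cexp_plus. f_equal. ring.
  - apply (cdiff_eq _ _ (0 * Cexp (z - z) + Cexp z * (1 * (1 - 0)))%C); [|ring].
    apply (cdiff_mult (fun _ => Cexp z) (fun u => Cexp (u - z))%C); [apply cdiff_const|].
    apply (cdiff_comp Cexp (fun u => (u - z)%C)).
    + apply (cdiff_minus (fun u => u) (fun _ => z)); [apply cdiff_id|apply cdiff_const].
    + replace (z - z)%C with (RtoC 0) by ring. apply cdiff_Cexp_0.
Qed.

(** * Integrals along segments *)

Definition rcont (h : R -> C) (s : R) : Prop :=
  forall eps, 0 < eps -> exists d, 0 < d /\
    forall u, Rabs (u - s) < d -> Cmod (h u - h s) < eps.

Definition CInt (h : R -> C) (a b : R) : C := RInt (V := C_R_CompleteNormedModule) h a b.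

Lemma rcont_continuous (h : R -> C) (s : R) :
  rcont h s -> continuous (T := R_UniformSpace) (U := C_UniformSpace) h s.
Proof.
  intros H. apply filterlim_locally. intros [e He]. destruct (H e He) as [d [Hd K]].
  exists (mkposreal d Hd). intros u Hu. specialize (K u Hu).
  split; simpl.
  - eapply Rle_lt_trans; [apply (Rabs_fst_le (h u - h s))|exact K].
  - eapply Rle_lt_trans; [apply (Rabs_snd_le (h u - h s))|exact K].
Qed.

Lemma norm_C_R (x : C) : norm (V := C_R_NormedModule) x = Cmod x.
Proof.
  destruct x as [a b]. unfold norm, Cmod; simpl. unfold prod_norm; simpl.
  unfold norm; simpl. unfold abs; simpl.
  replace (Rabs a * (Rabs a * 1)) with (a * (a * 1)); [|rewrite !Rmult_1_r; apply Rsqr_abs].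
  replace (Rabs b * (Rabs b * 1)) with (b * (b * 1)); [|rewrite !Rmult_1_r; apply Rsqr_abs].
  reflexivity.
Qed.

Lemma rcont_ex_RInt (h : R -> C) (a b : R) : a <= b -> (forall s, a <= s <= b -> rcont h s) ->
  ex_RInt (V := C_R_CompleteNormedModule) h a b.
Proof.
  intros Hab H. apply ex_RInt_continuous. intros s. rewrite Rmin_left, Rmax_right by auto.
  intros Hs. apply rcont_continuous. auto.
Qed.

Lemma is_RInt_CInt (h : R -> C) (a b : R) : a <= b -> (forall s, a <= s <= b -> rcont h s) ->
  is_RInt (V := C_R_NormedModule) h a b (CInt h a b).
Proof. intros Hab H. apply (RInt_correct (V := C_R_CompleteNormedModule)). apply rcont_ex_RInt; auto. Qed.

Lemma is_RInt_CInt_unique (h : R -> C) (a b : R) (l : C) :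
  is_RInt (V := C_R_NormedModule) h a b l -> CInt h a b = l.
Proof. apply (is_RInt_unique (V := C_R_CompleteNormedModule)). Qed.

Lemma CInt_bound (h : R -> C) (a b M : R) : a <= b -> (forall s, a <= s <= b -> rcont h s) ->
  (forall s, a <= s <= b -> Cmod (h s) <= M) -> Cmod (CInt h a b) <= (b - a) * M.
Proof.
  intros Hab Hc HM. rewrite <- norm_C_R.
  apply (norm_RInt_le_const (V := C_R_NormedModule) h a b); auto.
  - intros s Hs. rewrite norm_C_R. auto.
  - apply is_RInt_CInt; auto.
Qed.

Lemma CInt_ext (f g : R -> C) (a b : R) : a <= b -> (forall s, a <= s <= b -> f s = g s) ->
  CInt f a b = CInt g a b.
Proof.
  intros Hab H. apply (RInt_ext (V := C_R_CompleteNormedModule)). intros s. rewrite Rmin_left, Rmax_right by auto.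
  intros Hs. apply H. lra.
Qed.

Lemma CInt_plus (f g : R -> C) (a b : R) : a <= b ->
  (forall s, a <= s <= b -> rcont f s) -> (forall s, a <= s <= b -> rcont g s) ->
  CInt (fun s => (f s + g s)%C) a b = (CInt f a b + CInt g a b)%C.
Proof.
  intros Hab Hf Hg. apply is_RInt_CInt_unique.
  apply (is_RInt_plus (V := C_R_NormedModule)); apply is_RInt_CInt; auto.
Qed.

(** A complex [c] is not a scalar of the real module in which [CInt] is taken, so the product is
    integrated coordinate by coordinate. *)
Lemma CInt_scal (c : C) (f : R -> C) (a b : R) : a <= b ->
  (forall s, a <= s <= b -> rcont f s) ->
  CInt (fun s => (c * f s)%C) a b = (c * CInt f a b)%C.
Proof.
  intros Hab Hf. apply is_RInt_CInt_unique.
  assert (H := is_RInt_CInt f a b Hab Hf).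
  assert (H1 := is_RInt_fct_extend_fst (U := R_NormedModule) (V := R_NormedModule) _ _ _ _ H).
  assert (H2 := is_RInt_fct_extend_snd (U := R_NormedModule) (V := R_NormedModule) _ _ _ _ H).
  apply (is_RInt_fct_extend_pair (U := R_NormedModule) (V := R_NormedModule)).
  - apply (is_RInt_minus (V := R_NormedModule)); apply (is_RInt_scal (V := R_NormedModule)); assumption.
  - apply (is_RInt_plus (V := R_NormedModule)); apply (is_RInt_scal (V := R_NormedModule)); assumption.
Qed.

Lemma CInt_const (c : C) (a b : R) : CInt (fun _ => c) a b = (RtoC (b - a) * c)%C.
Proof.
  apply is_RInt_CInt_unique.
  replace (RtoC (b - a) * c)%C with (scal (V := C_R_NormedModule) (b - a) c).
  - apply (is_RInt_const (V := C_R_NormedModule)).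
  - apply injective_projections; simpl; unfold scal; simpl; unfold mult; simpl; ring.
Qed.

Lemma rcont_line (f : C -> C) (p v : C) (s : R) :
  ccont f (p + s * v)%C -> rcont (fun u => f (p + u * v)%C) s.
Proof.
  intros H eps He. destruct (H eps He) as [d [Hd K]].
  assert (Hv : 0 <= Cmod v) by apply Cmod_ge_0.
  exists (d / (Cmod v + 1)). split; [apply Rdiv_lt_0_compat; lra|].
  intros u Hu. apply K. replace (p + u * v - (p + s * v))%C with (RtoC (u - s) * v)%C
    by (rewrite RtoC_minus; ring).
  rewrite Cmod_mult, Cmod_R.
  apply Rmult_lt_compat_r with (r := Cmod v + 1) in Hu; [|lra].
  unfold Rdiv in Hu. rewrite Rmult_assoc, Rinv_l, Rmult_1_r in Hu by lra.
  assert (P := Rabs_pos (u - s)). nra.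
Qed.

Lemma rcont_scal (c : C) (f : R -> C) (s : R) : rcont f s -> rcont (fun u => (c * f u)%C) s.
Proof.
  intros H eps He. assert (P := Cmod_ge_0 c).
  destruct (H (eps / (Cmod c + 1))) as [d [Hd K]]; [apply Rdiv_lt_0_compat; lra|].
  exists d. split; auto. intros u Hu. specialize (K u Hu).
  replace (c * f u - c * f s)%C with (c * (f u - f s))%C by ring. rewrite Cmod_mult.
  apply Rmult_lt_compat_r with (r := Cmod c + 1) in K; [|lra].
  unfold Rdiv in K. rewrite Rmult_assoc, Rinv_l, Rmult_1_r in K by lra.
  assert (Q := Cmod_ge_0 (f u - f s)). nra.
Qed.

(** Caratheodory's form again, now for curves with a real parameter; it makes the product and chain
    rules along rays algebraic. *)
Definition rdiff (h : R -> C) (s : R) (l : C) : Prop :=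
  exists g, rcont g s /\ g s = l /\ forall u, h u = (h s + RtoC (u - s) * g u)%C.

Lemma rcont_const (c : C) (s : R) : rcont (fun _ => c) s.
Proof.
  intros eps He. exists 1. split; [lra|]. intros u _.
  rewrite Cmod_self. exact He.
Qed.

Lemma rcont_comp (f : C -> C) (h : R -> C) (s : R) :
  rcont h s -> ccont f (h s) -> rcont (fun u => f (h u)) s.
Proof.
  intros Hh Hf eps He. destruct (Hf eps He) as [d [Hd H]].
  destruct (Hh d Hd) as [d' [Hd' H']]. exists d'. split; auto.
Qed.

Lemma rcont_plus (f g : R -> C) (s : R) : rcont f s -> rcont g s -> rcont (fun u => (f u + g u)%C) s.
Proof.
  intros Hf Hg eps He.
  destruct (Hf (eps / 2)) as [d1 [Hd1 H1]]; [lra|].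
  destruct (Hg (eps / 2)) as [d2 [Hd2 H2]]; [lra|].
  exists (Rmin d1 d2). split; [apply Rmin_pos; auto|]. intros u Hu.
  assert (Hu1 := H1 u (Rlt_le_trans _ _ _ Hu (Rmin_l _ _))).
  assert (Hu2 := H2 u (Rlt_le_trans _ _ _ Hu (Rmin_r _ _))).
  replace (f u + g u - (f s + g s))%C with ((f u - f s) + (g u - g s))%C by ring.
  eapply Rle_lt_trans; [apply Cmod_triangle|]. lra.
Qed.

(* Polarization reduces products to squares, hence to composition with a continuous map. *)
Lemma rcont_mult (f g : R -> C) (s : R) : rcont f s -> rcont g s -> rcont (fun u => (f u * g u)%C) s.
Proof.
  intros Hf Hg.
  assert (Sq : forall h, rcont h s -> rcont (fun u => (h u * h u)%C) s).
  { intros h Hh. apply (rcont_comp (fun x => (x * x)%C) h s Hh).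
    apply ccont_mult; apply ccont_id. }
  assert (A := rcont_plus _ _ _ (rcont_scal (/ 4) _ _ (Sq _ (rcont_plus _ _ _ Hf Hg)))
    (rcont_scal (- (/ 4)) _ _ (Sq _ (rcont_plus _ _ _ Hf (rcont_scal (- (1)) _ _ Hg))))).
  intros eps He. destruct (A eps He) as [d [Hd K]]. exists d. split; auto.
  intros u Hu. specialize (K u Hu). cbv beta in K.
  replace (f u * g u - f s * g s)%C with (/ 4 * ((f u + g u) * (f u + g u)) +
     - (/ 4) * ((f u + - (1) * g u) * (f u + - (1) * g u)) -
     (/ 4 * ((f s + g s) * (f s + g s)) +
      - (/ 4) * ((f s + - (1) * g s) * (f s + - (1) * g s))))%C by field.
  exact K.
Qed.

Lemma rdiff_rcont (h : R -> C) (s : R) (l : C) : rdiff h s l -> rcont h s.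
Proof.
  intros [g [Hg [_ H]]].
  assert (X : rcont (fun u => (h s + (- RtoC s + RtoC u) * g u)%C) s).
  { apply rcont_plus; [apply rcont_const|]. apply rcont_mult; auto.
    apply rcont_plus; [apply rcont_const|].
    intros eps He. exists eps. split; auto. intros u Hu. rewrite <- RtoC_minus, Cmod_R. exact Hu. }
  intros eps He. destruct (X eps He) as [d [Hd K]]. exists d. split; auto.
  intros u Hu. specialize (K u Hu). rewrite (H u), RtoC_minus.
  replace (h s + (u - s) * g u - h s)%C with (h s + (- s + u) * g u - (h s + (- s + s) * g s))%C by ring.
  exact K.
Qed.

Lemma rdiff_mult (f g : R -> C) (s : R) (l m : C) :
  rdiff f s l -> rdiff g s m -> rdiff (fun u => (f u * g u)%C) s (l * g s + f s * m).
Proof.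
  intros Hf Hg. assert (Cg := rdiff_rcont _ _ _ Hg).
  destruct Hf as [a [Ha [Ea Fa]]]. destruct Hg as [b [Hb [Eb Fb]]].
  exists (fun u => (a u * g u + f s * b u)%C). split.
  { apply rcont_plus; apply rcont_mult; auto. apply rcont_const. }
  split; [congruence|]. intros u. rewrite (Fa u). rewrite (Fb u) at 1 2. ring.
Qed.

Lemma rdiff_comp (f : C -> C) (h : R -> C) (s : R) (l m : C) :
  rdiff h s m -> cdiff f (h s) l -> rdiff (fun u => f (h u)) s (l * m).
Proof.
  intros Hg Hf. assert (Cg := rdiff_rcont _ _ _ Hg).
  destruct Hf as [a [Ha [Ea Fa]]]. destruct Hg as [b [Hb [Eb Fb]]].
  exists (fun u => (a (h u) * b u)%C). split.
  { apply rcont_mult; auto. apply rcont_comp; auto. }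
  split; [congruence|]. intros u. rewrite (Fa (h u)). rewrite (Fb u) at 1. ring.
Qed.

Lemma rdiff_line (p v : C) (s : R) : rdiff (fun u => (p + u * v)%C) s v.
Proof.
  exists (fun _ => v). split; [apply rcont_const|]. split; auto.
  intros u. rewrite RtoC_minus. ring.
Qed.

Lemma is_derive_C_R_eps (h : R -> C) (s : R) (l : C) :
  is_derive (K := R_AbsRing) (V := C_R_NormedModule) h s l <->
  forall eps, 0 < eps -> exists d, 0 < d /\ forall u, Rabs (u - s) < d ->
    Cmod (h u - h s - RtoC (u - s) * l) <= eps * Rabs (u - s).
Proof.
  assert (X : forall u, minus (G := C_R_NormedModule) (minus (G := C_R_NormedModule) (h u) (h s))
      (scal (V := C_R_NormedModule) (minus u s) l) = (h u - h s - RtoC (u - s) * l)%C).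
  { intros u. apply injective_projections; simpl; unfold minus, plus, opp, scal; simpl;
      unfold mult, plus, opp; simpl; ring. }
  split.
  - intros [_ H] eps He.
    destruct (H s (fun P HP => HP) (mkposreal _ He)) as [d Hd].
    exists d. split; [apply cond_pos|]. intros u Hu. specialize (Hd u Hu).
    rewrite norm_C_R, X in Hd. exact Hd.
  - intros H. split.
    { apply (is_linear_scal_l (K := R_AbsRing) (V := C_R_NormedModule)). }
    intros x Hx. apply (is_filter_lim_locally_unique (K := R_AbsRing) (V := R_NormedModule)) in Hx.
    subst x. intros [e He]. destruct (H e He) as [d [Hd K]].
    exists (mkposreal d Hd). intros u Hu. rewrite norm_C_R, X. apply K. exact Hu.
Qed.

Lemma is_derive_rdiff (h : R -> C) (s : R) (l : C) :
  is_derive (K := R_AbsRing) (V := C_R_NormedModule) h s l <-> rdiff h s l.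
Proof.
  rewrite is_derive_C_R_eps. split.
  - intros H.
    set (g := fun u => if Req_EM_T u s then l else ((h u - h s) / RtoC (u - s))%C).
    assert (Hs : forall u, u <> s -> RtoC (u - s) <> 0).
    { intros u n E. apply RtoC_inj in E. lra. }
    exists g. split; [|split].
    + intros eps He. destruct (H (eps / 2)) as [d [Hd H']]; [lra|].
      exists d. split; auto. intros u Hu. specialize (H' u Hu).
      unfold g. destruct (Req_EM_T s s) as [_|n]; [|congruence].
      destruct (Req_EM_T u s) as [E|n].
      * rewrite Cmod_self. exact He.
      * specialize (Hs u n). assert (Hp := proj1 (Cmod_gt_0 _) Hs).
        replace ((h u - h s) / RtoC (u - s) - l)%C
          with (((h u - h s) - RtoC (u - s) * l) / RtoC (u - s))%C by (field; auto).
        rewrite Cmod_div by auto. rewrite Cmod_R in *.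
        apply Rle_lt_trans with (eps / 2); [|lra].
        apply Rmult_le_reg_r with (Rabs (u - s)); auto.
        unfold Rdiv at 1. rewrite Rmult_assoc, Rinv_l, Rmult_1_r; lra.
    + unfold g. destruct (Req_EM_T s s); congruence.
    + intros u. unfold g. destruct (Req_EM_T u s) as [E|n].
      * rewrite E, Rminus_diag. ring.
      * field. auto.
  - intros [g [Hg [Eg Fg]]] eps He. destruct (Hg eps He) as [d [Hd H]].
    exists d. split; auto. intros u Hu. rewrite (Fg u).
    replace (h s + RtoC (u - s) * g u - h s - RtoC (u - s) * l)%C with ((g u - l) * RtoC (u - s))%C by ring.
    rewrite Cmod_mult, Cmod_R. apply Rmult_le_compat_r; [apply Rabs_pos|].
    rewrite <- Eg. left. auto.
Qed.

Lemma is_derive_line (G : C -> C) (p v l : C) (s : R) : cdiff G (p + s * v)%C l ->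
  is_derive (K := R_AbsRing) (V := C_R_NormedModule) (fun u => G (p + RtoC u * v)%C) s (v * l)%C.
Proof.
  intros H. apply is_derive_rdiff. replace (v * l)%C with (l * v)%C by ring.
  apply (rdiff_comp G (fun u => (p + RtoC u * v)%C)); [apply rdiff_line|exact H].
Qed.

(** The free factor [c] gives access to every real-linear functional on C; real one-variable
    theorems are then applied to [Re (c * h u)] with a suitable [c]. *)
Lemma is_derive_Re (h : R -> C) (s : R) (l c : C) :
  is_derive (K := R_AbsRing) (V := C_R_NormedModule) h s l ->
  is_derive (fun u => Re (c * h u)) s (Re (c * l)).
Proof.
  intros H. assert (Hc := Cmod_ge_0 c).
  assert (L : is_linear (K := R_AbsRing) (U := C_R_NormedModule) (V := R_NormedModule) (fun x : C => Re (c * x))).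
  { split.
    - intros x y. unfold Re; simpl; unfold plus; simpl. ring.
    - intros k x. unfold Re; simpl; unfold scal; simpl; unfold mult; simpl. ring.
    - exists (Cmod c + 1). split; [lra|]. intros x. rewrite norm_C_R.
      eapply Rle_trans; [apply (Rabs_fst_le (c * x)%C)|]. rewrite Cmod_mult.
      apply Rmult_le_compat_r; [apply Cmod_ge_0|lra]. }
  eapply filterdiff_ext_lin.
  - apply (filterdiff_comp' (K := R_AbsRing) (V := C_R_NormedModule) (W := R_NormedModule) h
      (fun x : C => Re (c * x)) s _ (fun x : C => Re (c * x)) H). apply filterdiff_linear. exact L.
  - intros y. unfold Re; simpl; unfold scal; simpl; unfold mult; simpl. ring.
Qed.

(** The mean value theorem is a statement on real functions, so it is applied to Re(conj(w) f) along
    the segment, where w is the increment of f itself: the increment of this real function is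
    exactly |w|^2. *)
Lemma mean_value_bound (f df : C -> C) (p v : C) (M : R) :
  (forall s, 0 <= s <= 1 -> cdiff f (p + s * v)%C (df (p + s * v)%C)) ->
  (forall s, 0 <= s <= 1 -> Cmod (df (p + s * v)%C) <= M) ->
  Cmod (f (p + v) - f p)%C <= M * Cmod v.
Proof.
  intros Hd HM. set (w := (f (p + v) - f p)%C).
  destruct (Ceq_dec w 0) as [E|n].
  { rewrite E, Cmod_0. apply Rmult_le_pos; [|apply Cmod_ge_0].
    eapply Rle_trans; [apply Cmod_ge_0|apply (HM 0)]. lra. }
  assert (Hp := proj1 (Cmod_gt_0 _) n).
  set (k := fun u => Re (Cconj w * f (p + RtoC u * v))%C).
  set (dk := fun u => Re (Cconj w * (v * df (p + RtoC u * v)))%C).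
  assert (Dk : forall s, 0 <= s <= 1 -> is_derive k s (dk s)).
  { intros s Hs. apply is_derive_Re. apply is_derive_line. auto. }
  destruct (MVT_gen k 0 1 dk) as [c [Hc E]].
  - rewrite Rmin_left, Rmax_right by lra. intros s Hs. apply Dk. lra.
  - rewrite Rmin_left, Rmax_right by lra. intros s Hs.
    apply continuity_pt_filterlim. apply (ex_derive_continuous (K := R_AbsRing) (V := R_NormedModule)).
    exists (dk s). apply Dk; auto.
  - rewrite Rmin_left, Rmax_right in Hc by lra.
    assert (E1 : k 1 - k 0 = Cmod w ^ 2).
    { unfold k. rewrite Cmod2_alt.
      replace (p + 1 * v)%C with (p + v)%C by ring. replace (p + 0 * v)%C with p by ring.
      unfold w, Re, Im; simpl; ring. }
    assert (E2 : dk c <= Cmod w * (Cmod v * M)).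
    { eapply Rle_trans; [apply Rle_abs|]. eapply Rle_trans; [apply Rabs_fst_le|].
      rewrite Cmod_mult, Cmod_conj. apply Rmult_le_compat_l; [lra|].
      rewrite Cmod_mult. apply Rmult_le_compat_l; [apply Cmod_ge_0|]. apply HM; auto. }
    apply Rmult_le_reg_l with (Cmod w); auto. rewrite E1 in E. nra.
Qed.

Lemma rdiff_zero_const (h : R -> C) : (forall s, 0 <= s <= 1 -> rdiff h s 0) -> h 1 = h 0.
Proof.
  intros H.
  assert (X : forall c, Re (c * h 1)%C = Re (c * h 0)%C).
  { intros c.
    assert (D : forall s, 0 <= s <= 1 -> is_derive (fun u => Re (c * h u)) s 0).
    { intros s Hs. replace 0 with (Re (c * 0)) by (unfold Re; simpl; ring).
      apply is_derive_Re. apply is_derive_rdiff. auto. }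
    destruct (MVT_gen (fun u => Re (c * h u)) 0 1 (fun _ => 0)) as [y [_ E]].
    - rewrite Rmin_left, Rmax_right by lra. intros s Hs. apply D. lra.
    - rewrite Rmin_left, Rmax_right by lra. intros s Hs.
      apply continuity_pt_filterlim. apply (ex_derive_continuous (K := R_AbsRing) (V := R_NormedModule)).
      exists 0. apply D; auto.
    - cbv beta in E. lra. }
  assert (A := X 1). assert (B := X Ci). unfold Re in A, B; simpl in A, B.
  apply injective_projections; lra.
Qed.

(** * Integrals over segments and boundaries of parallelograms *)

Definition seg (F : C -> C) (p v : C) : C := (v * CInt (fun s => F (p + RtoC s * v)%C) 0 1)%C.

(** The boundary is traversed through p, p + v, p + v + w, p + w and back to p, so the last two
    sides enter with a minus sign. *)
Definition par_bd (F : C -> C) (p v w : C) : C :=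
  (seg F p v + seg F (p + v) w - seg F (p + w) v - seg F p w)%C.

Lemma seg_primitive (F G : C -> C) (p v : C) :
  (forall s, 0 <= s <= 1 -> ccont F (p + s * v)%C) ->
  (forall s, 0 <= s <= 1 -> cdiff G (p + s * v)%C (F (p + s * v)%C)) ->
  seg F p v = (G (p + v) - G p)%C.
Proof.
  intros Hc Hd. unfold seg. rewrite <- CInt_scal; [|lra|].
  2:{ intros s Hs. apply rcont_line. auto. }
  apply is_RInt_CInt_unique.
  replace (G (p + v) - G p)%C with (minus (G := C_R_NormedModule) (G (p + 1 * v)%C) (G (p + 0 * v)%C)).
  - apply (is_RInt_derive (V := C_R_CompleteNormedModule) (fun s => G (p + RtoC s * v)%C)).
    + rewrite Rmin_left, Rmax_right by lra. intros s Hs. apply is_derive_line. auto.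
    + rewrite Rmin_left, Rmax_right by lra. intros s Hs. apply rcont_continuous.
      apply rcont_scal, rcont_line. auto.
  - replace (p + 1 * v)%C with (p + v)%C by ring. replace (p + 0 * v)%C with p by ring. reflexivity.
Qed.

Lemma seg_split (F : C -> C) (p v : C) :
  (forall s, 0 <= s <= 1 -> ccont F (p + s * v)%C) ->
  seg F p v = (seg F p (v / 2) + seg F (p + v / 2) (v / 2))%C.
Proof.
  intros Hc. set (k := fun u => F (p + RtoC u * v)%C).
  assert (X : forall a b, 0 <= a -> a <= b -> b <= 1 ->
    is_RInt (V := C_R_NormedModule) k a b (CInt k a b)).
  { intros a b Ha Hab Hb. apply is_RInt_CInt; auto. intros s Hs. apply rcont_line, Hc. lra. }
  assert (A : forall c, 0 <= c <= / 2 ->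
    CInt (fun s => F (p + RtoC c * v + RtoC s * (v / 2))%C) 0 1 = (2 * CInt k c (c + / 2))%C).
  { intros c Hc2. apply is_RInt_CInt_unique.
    assert (Y : is_RInt (V := C_R_NormedModule) k (/2 * 0 + c) (/2 * 1 + c) (CInt k c (c + / 2))).
    { replace (/2 * 0 + c) with c by ring. replace (/2 * 1 + c) with (c + /2) by ring. apply X; lra. }
    assert (B := is_RInt_scal (V := C_R_NormedModule) _ _ _ 2 _
      (is_RInt_comp_lin (V := C_R_NormedModule) k (/2) c 0 1 _ Y)).
    replace (2 * CInt k c (c + / 2))%C with (scal (V := C_R_NormedModule) 2 (CInt k c (c + / 2))).
    2:{ apply injective_projections; simpl; unfold scal; simpl; unfold mult; simpl; ring. }
    eapply is_RInt_ext; [|exact B]. intros s _. cbv beta.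
    rewrite scal_assoc. replace (mult 2 (/ 2)) with 1 by (unfold mult; simpl; field).
    rewrite (scal_one (V := C_R_NormedModule)). unfold k.
    f_equal. rewrite RtoC_plus, RtoC_mult, RtoC_inv by lra. field. }
  assert (A1 := A 0 ltac:(lra)). assert (A2 := A (/2) ltac:(lra)).
  replace (p + RtoC 0 * v)%C with p in A1 by ring.
  replace (p + RtoC (/ 2) * v)%C with (p + v / 2)%C in A2 by (rewrite RtoC_inv by lra; field).
  replace (0 + / 2) with (/2) in A1 by ring. replace (/ 2 + / 2) with 1 in A2 by field.
  unfold seg. rewrite A1, A2. fold k.
  assert (D := is_RInt_CInt_unique _ _ _ _ (is_RInt_Chasles (V := C_R_NormedModule) _ _ _ _ _ _
     (X 0 (/2) ltac:(lra) ltac:(lra) ltac:(lra)) (X (/2) 1 ltac:(lra) ltac:(lra) ltac:(lra)))).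
  rewrite D. change (v * (CInt k 0 (/ 2) + CInt k (/ 2) 1)
    = v / 2 * (2 * CInt k 0 (/ 2)) + v / 2 * (2 * CInt k (/ 2) 1))%C. field.
Qed.

(** * Goursat's theorem *)

(** Compactness in a form that avoids finite subcovers: [P] may be any property of a center and a
    radius, and every point of the rectangle lies near some center whose radius stays above a common
    [d]. The radii are first made into a total function by choice. *)
Lemma lebesgue_number_2d (a b a' b' : R) (P : R -> R -> R -> Prop) :
  (forall x y, a <= x <= b -> a' <= y <= b' -> exists d, 0 < d /\ P x y d) ->
  exists d, 0 < d /\ forall x y, a <= x <= b -> a' <= y <= b' ->
    exists u v e, a <= u <= b /\ a' <= v <= b' /\ Rabs (x - u) < e /\ Rabs (y - v) < e /\
      d <= e /\ P u v e.
Proof.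
  intros H.
  assert (X : forall x y, exists d : posreal, a <= x <= b -> a' <= y <= b' -> P x y d).
  { intros x y. destruct (classic (a <= x <= b /\ a' <= y <= b')) as [[h1 h2]|n].
    - destruct (H x y h1 h2) as [d [Hd K]]. exists (mkposreal d Hd). auto.
    - exists (mkposreal 1 Rlt_0_1). intros h1 h2. tauto. }
  set (delta := fun x y => proj1_sig (constructive_indefinite_description _ (X x y))).
  assert (HD : forall x y, a <= x <= b -> a' <= y <= b' -> P x y (delta x y)).
  { intros x y. unfold delta. apply (proj2_sig (constructive_indefinite_description _ (X x y))). }
  destruct (compactness_value_2d a b a' b' delta) as [d Hd].
  exists d. split; [apply cond_pos|]. intros x y Hx Hy.
  destruct (NNPP _ (Hd x y Hx Hy)) as [u [v [Hu [Hv [H1 [H2 H3]]]]]].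
  exists u, v, (delta u v). repeat split; auto; lra.
Qed.

Lemma lebesgue_number_1d (a b : R) (P : R -> R -> Prop) :
  (forall x, a <= x <= b -> exists d, 0 < d /\ P x d) ->
  exists d, 0 < d /\ forall x, a <= x <= b ->
    exists u e, a <= u <= b /\ Rabs (x - u) < e /\ d <= e /\ P u e.
Proof.
  intros H. destruct (lebesgue_number_2d a b 0 0 (fun x _ d => P x d)) as [d [Hd K]].
  { intros x y Hx _. auto. }
  exists d. split; auto. intros x Hx. destruct (K x 0 Hx ltac:(lra)) as [u [_ [e [H1 [_ [H2 [_ [H3 H4]]]]]]]].
  exists u, e. auto.
Qed.

Lemma seg_ext (F G : C -> C) (p v : C) :
  (forall s, 0 <= s <= 1 -> F (p + s * v)%C = G (p + s * v)%C) -> seg F p v = seg G p v.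
Proof. intros H. unfold seg. f_equal. apply CInt_ext; auto. lra. Qed.

Lemma seg_plus (F G : C -> C) (p v : C) :
  (forall s, 0 <= s <= 1 -> ccont F (p + s * v)%C) ->
  (forall s, 0 <= s <= 1 -> ccont G (p + s * v)%C) ->
  seg (fun z => (F z + G z)%C) p v = (seg F p v + seg G p v)%C.
Proof.
  intros HF HG. unfold seg. rewrite CInt_plus; [ring|lra| |].
  - intros s Hs. apply rcont_line. auto.
  - intros s Hs. apply rcont_line. auto.
Qed.

Lemma seg_bound (F : C -> C) (p v : C) (M : R) :
  (forall s, 0 <= s <= 1 -> ccont F (p + s * v)%C) ->
  (forall s, 0 <= s <= 1 -> Cmod (F (p + s * v)%C) <= M) ->
  Cmod (seg F p v) <= Cmod v * M.
Proof.
  intros HF HM. unfold seg. rewrite Cmod_mult. apply Rmult_le_compat_l; [apply Cmod_ge_0|].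
  replace M with ((1 - 0) * M) by ring. apply CInt_bound; auto; [lra|].
  intros s Hs. apply rcont_line. auto.
Qed.

Lemma par_bd_split (F : C -> C) (p v w : C) :
  (forall s t, 0 <= s <= 1 -> 0 <= t <= 1 -> ccont F (p + s * v + t * w)%C) ->
  par_bd F p v w =
   (par_bd F p (v / 2) (w / 2) + par_bd F (p + v / 2) (v / 2) (w / 2)
    + par_bd F (p + w / 2) (v / 2) (w / 2) + par_bd F (p + v / 2 + w / 2) (v / 2) (w / 2))%C.
Proof.
  intros H. unfold par_bd.
  rewrite (seg_split F p v).
  2:{ intros s Hs. specialize (H s 0 Hs ltac:(lra)).
      replace (p + s * v + 0 * w)%C with (p + s * v)%C in H by ring. exact H. }
  rewrite (seg_split F (p + v) w).
  2:{ intros s Hs. specialize (H 1 s ltac:(lra) Hs).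
      replace (p + 1 * v + s * w)%C with (p + v + s * w)%C in H by ring. exact H. }
  rewrite (seg_split F (p + w) v).
  2:{ intros s Hs. specialize (H s 1 Hs ltac:(lra)).
      replace (p + s * v + 1 * w)%C with (p + w + s * v)%C in H by ring. exact H. }
  rewrite (seg_split F p w).
  2:{ intros s Hs. specialize (H 0 s ltac:(lra) Hs).
      replace (p + 0 * v + s * w)%C with (p + s * w)%C in H by ring. exact H. }
  replace (p + v / 2 + v / 2)%C with (p + v)%C by field.
  replace (p + w / 2 + w / 2)%C with (p + w)%C by field.
  replace (p + v / 2 + w / 2 + v / 2)%C with (p + v + w / 2)%C by field.
  replace (p + v / 2 + w / 2 + w / 2)%C with (p + w + v / 2)%C by field.
  replace (p + w / 2 + v / 2)%C with (p + v / 2 + w / 2)%C by ring.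
  ring.
Qed.

(** The affine part of F at z has the primitive [G], whose increments cancel around the boundary.
    What remains is at most eps D on sides of total length 2(|v| + |w|). *)
Lemma goursat_local (F : C -> C) (z l : C) (eps : R) : cdiff F z l -> 0 < eps ->
  exists d, 0 < d /\ forall p v w,
    (forall s t, 0 <= s <= 1 -> 0 <= t <= 1 ->
       ccont F (p + s * v + t * w)%C /\ Cmod (p + s * v + t * w - z) < d) ->
    forall D, (forall s t, 0 <= s <= 1 -> 0 <= t <= 1 -> Cmod (p + s * v + t * w - z) <= D) ->
    Cmod (par_bd F p v w) <= 2 * (Cmod v + Cmod w) * (eps * D).
Proof.
  intros HF He. destruct (cdiff_eps _ _ _ HF eps He) as [d [Hd K]].
  exists d. split; auto. intros p v w H D HD.
  set (A := fun u => (F z + (u - z) * l)%C).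
  set (B := fun u => (F u - A u)%C).
  set (G := fun u => (u * F z + ((u - z) * (u - z)) * (l / 2))%C).
  assert (GA : forall u, cdiff G u (A u)).
  { intros u. eapply cdiff_eq.
    - apply (cdiff_plus (fun u => (u * F z)%C) (fun u => ((u - z) * (u - z) * (l / 2))%C)).
      + apply (cdiff_mult (fun u => u) (fun _ => F z)); [apply cdiff_id|apply cdiff_const].
      + apply (cdiff_mult (fun u => (u - z) * (u - z))%C (fun _ => (l / 2)%C)); [|apply cdiff_const].
        apply (cdiff_mult (fun u => (u - z)%C) (fun u => (u - z)%C));
        apply (cdiff_minus (fun u => u) (fun _ => z)); try apply cdiff_id; apply cdiff_const.
    - unfold A. field. }
  assert (CA : forall u, ccont A u).
  { intros u. apply ccont_plus; [apply ccont_const|]. apply ccont_mult; [|apply ccont_const].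
    apply ccont_minus; [apply ccont_id|apply ccont_const]. }
  assert (SA : forall q x, seg A q x = (G (q + x) - G q)%C).
  { intros q x. apply seg_primitive; auto. }
  assert (Side : forall q x, (forall s, 0 <= s <= 1 ->
      ccont F (q + s * x)%C /\ Cmod (q + s * x - z) < d /\ Cmod (q + s * x - z) <= D) ->
      exists e, seg F q x = (G (q + x) - G q + e)%C /\ Cmod e <= Cmod x * (eps * D)).
  { intros q x Hq. exists (seg B q x). split.
    - rewrite <- SA, <- seg_plus.
      + apply seg_ext. intros s Hs. unfold B. ring.
      + intros; apply CA.
      + intros s Hs. apply ccont_minus; [apply Hq; auto|apply CA].
    - apply seg_bound.
      + intros s Hs. apply ccont_minus; [apply Hq; auto|apply CA].
      + intros s Hs. destruct (Hq s Hs) as [_ [H1 H2]]. unfold B, A.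
        replace (F (q + s * x) - (F z + (q + s * x - z) * l))%C
          with (F (q + s * x) - F z - (q + s * x - z) * l)%C by ring.
        eapply Rle_trans; [apply K; auto|]. apply Rmult_le_compat_l; lra. }
  destruct (Side p v) as [e1 [E1 B1]].
  { intros s Hs. destruct (H s 0 Hs ltac:(lra)) as [h1 h2]. assert (h3 := HD s 0 Hs ltac:(lra)).
    replace (p + s * v + 0 * w)%C with (p + s * v)%C in h1, h2, h3 by ring. auto. }
  destruct (Side (p + v)%C w) as [e2 [E2 B2]].
  { intros s Hs. destruct (H 1 s ltac:(lra) Hs) as [h1 h2]. assert (h3 := HD 1 s ltac:(lra) Hs).
    replace (p + 1 * v + s * w)%C with (p + v + s * w)%C in h1, h2, h3 by ring. auto. }
  destruct (Side (p + w)%C v) as [e3 [E3 B3]].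
  { intros s Hs. destruct (H s 1 Hs ltac:(lra)) as [h1 h2]. assert (h3 := HD s 1 Hs ltac:(lra)).
    replace (p + s * v + 1 * w)%C with (p + w + s * v)%C in h1, h2, h3 by ring. auto. }
  destruct (Side p w) as [e4 [E4 B4]].
  { intros s Hs. destruct (H 0 s ltac:(lra) Hs) as [h1 h2]. assert (h3 := HD 0 s ltac:(lra) Hs).
    replace (p + 0 * v + s * w)%C with (p + s * w)%C in h1, h2, h3 by ring. auto. }
  unfold par_bd. rewrite E1, E2, E3, E4.
  replace (p + w + v)%C with (p + v + w)%C by ring.
  match goal with |- Cmod ?x <= _ => replace x with ((e1 + e2) + (- e3 + - e4))%C by ring end.
  eapply Rle_trans; [apply Cmod_triangle|].
  assert (T1 := Cmod_triangle e1 e2). assert (T2 := Cmod_triangle (- e3) (- e4)).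
  rewrite !Cmod_opp in T2. nra.
Qed.

Lemma nested_limit (a : nat -> R) :
  (forall n, a n <= a (S n)) -> (forall n, a (S n) + (/2) ^ (S n) <= a n + (/2) ^ n) ->
  exists x, forall n, a n <= x <= a n + (/2) ^ n.
Proof.
  intros H1 H2.
  assert (P : forall n, 0 < (/2) ^ n) by (intros n; apply pow_lt; lra).
  assert (M1 : forall n k, a n <= a (n + k)%nat).
  { intros n k. induction k as [|k IH]; [rewrite Nat.add_0_r; lra|].
    rewrite Nat.add_succ_r. eapply Rle_trans; [exact IH|apply H1]. }
  assert (M2 : forall n k, a (n + k)%nat + (/2) ^ (n + k) <= a n + (/2) ^ n).
  { intros n k. induction k as [|k IH]; [rewrite Nat.add_0_r; lra|].
    rewrite Nat.add_succ_r. eapply Rle_trans; [apply H2|exact IH]. }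
  assert (M : forall n m, a n <= a m + (/2) ^ m).
  { intros n m. destruct (Nat.le_ge_cases n m) as [h|h].
    - specialize (M1 n (m - n)%nat). replace (n + (m - n))%nat with m in M1 by lia.
      specialize (P m). lra.
    - specialize (M2 m (n - m)%nat). replace (m + (n - m))%nat with n in M2 by lia.
      specialize (P n). lra. }
  destruct (completeness (fun x => exists n, x = a n)) as [x [U L]].
  - exists (a O + (/2) ^ 0). intros y [n E]. subst y. apply M.
  - exists (a O). exists O. reflexivity.
  - exists x. intros n. split.
    + apply U. exists n. reflexivity.
    + apply L. intros y [m E]. subst y. apply M.
Qed.

(** Cousin's lemma by bisection: a bad square has a bad quarter, the nested bad quarters shrink to a
    point, and near that point all small squares are good. *)
Lemma cousin_square (Good : R -> R -> R -> Prop) :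
  (forall a b r, 0 < r -> Good a b (r / 2) -> Good (a + r / 2) b (r / 2) ->
     Good a (b + r / 2) (r / 2) -> Good (a + r / 2) (b + r / 2) (r / 2) -> Good a b r) ->
  (forall x y, exists d, 0 < d /\ forall a b r, 0 < r < d ->
     a <= x <= a + r -> b <= y <= b + r -> Good a b r) ->
  Good 0 0 1.
Proof.
  intros Hsplit Hloc. apply NNPP. intros N.
  set (step := fun (a b r : R) =>
    if excluded_middle_informative (~ Good a b (r / 2)) then (a, b) else
    if excluded_middle_informative (~ Good (a + r / 2) b (r / 2)) then (a + r / 2, b) else
    if excluded_middle_informative (~ Good a (b + r / 2) (r / 2)) then (a, b + r / 2) else
    (a + r / 2, b + r / 2)).
  set (sq := fix sq (n : nat) : R * R := match n with O => (0, 0)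
     | S m => step (fst (sq m)) (snd (sq m)) ((/2) ^ m) end).
  assert (P : forall n, 0 < (/2) ^ n) by (intros n; apply pow_lt; lra).
  assert (Half : forall n, (/2) ^ (S n) = (/2) ^ n / 2) by (intros n; simpl; field).
  assert (St : forall a b r, 0 < r -> ~ Good a b r ->
    ~ Good (fst (step a b r)) (snd (step a b r)) (r / 2)
    /\ (fst (step a b r) = a \/ fst (step a b r) = a + r / 2)
    /\ (snd (step a b r) = b \/ snd (step a b r) = b + r / 2)).
  { intros a b r Hr Hn. unfold step.
    destruct (excluded_middle_informative _) as [h1|h1]; [simpl; auto|].
    destruct (excluded_middle_informative _) as [h2|h2]; [simpl; auto|].
    destruct (excluded_middle_informative _) as [h3|h3]; [simpl; auto|].
    simpl. split; [|auto]. intros h4. apply Hn. apply Hsplit; auto; apply NNPP; auto. }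
  assert (Bad : forall n, ~ Good (fst (sq n)) (snd (sq n)) ((/2) ^ n)).
  { induction n as [|n IH]; [exact N|]. rewrite Half. simpl. apply St; auto. }
  assert (Fst : forall n, fst (sq (S n)) = fst (sq n) \/ fst (sq (S n)) = fst (sq n) + (/2) ^ n / 2).
  { intros n. simpl. apply St; auto. }
  assert (Snd : forall n, snd (sq (S n)) = snd (sq n) \/ snd (sq (S n)) = snd (sq n) + (/2) ^ n / 2).
  { intros n. simpl. apply St; auto. }
  destruct (nested_limit (fun n => fst (sq n))) as [x Hx].
  { intros n. specialize (P n). destruct (Fst n); lra. }
  { intros n. rewrite Half. specialize (P n). destruct (Fst n); lra. }
  destruct (nested_limit (fun n => snd (sq n))) as [y Hy].
  { intros n. specialize (P n). destruct (Snd n); lra. }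
  { intros n. rewrite Half. specialize (P n). destruct (Snd n); lra. }
  destruct (Hloc x y) as [d [Hd K]].
  destruct (pow_lt_1_zero (/2)) with (y := d) as [n Hn]; [rewrite Rabs_pos_eq; lra|exact Hd|].
  apply (Bad n). apply K; auto. split; auto.
  specialize (Hn n (le_n n)). rewrite Rabs_pos_eq in Hn; auto. left. auto.
Qed.

Theorem goursat (F : C -> C) (p v w : C) :
  (forall s t, 0 <= s <= 1 -> 0 <= t <= 1 -> exists l, cdiff F (p + s * v + t * w)%C l) ->
  par_bd F p v w = 0.
Proof.
  intros H.
  assert (Hc : forall s t, 0 <= s <= 1 -> 0 <= t <= 1 -> ccont F (p + s * v + t * w)%C).
  { intros s t Hs Ht. destruct (H s t Hs Ht) as [l Hl]. apply (cdiff_ccont _ _ _ Hl). }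
  set (K := Cmod v + Cmod w).
  assert (Kv := Cmod_ge_0 v). assert (Kw := Cmod_ge_0 w).
  assert (HK : 0 <= K) by (unfold K; lra).
  assert (Main : forall eps, 0 < eps -> Cmod (par_bd F p v w) <= 2 * K * (eps * K)).
  (* The bound in [Good] is proportional to the area r^2, so that the bounds of four quarters add up
     exactly to that of the whole. *)
  { intros eps He. set (c := 2 * K * (eps * K)).
    set (Good := fun a b r : R => 0 <= a -> a + r <= 1 -> 0 <= b -> b + r <= 1 ->
      Cmod (par_bd F (p + a * v + b * w) (RtoC r * v) (RtoC r * w)) <= c * r * r).
    assert (G : Good 0 0 1).
    { apply cousin_square.
      - intros a b r Hr G1 G2 G3 G4 Ha Ha' Hb Hb'.
        rewrite par_bd_split.
        2:{ intros s t Hs Ht.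
            replace (p + a * v + b * w + s * (r * v) + t * (r * w))%C
              with (p + RtoC (a + s * r) * v + RtoC (b + t * r) * w)%C
              by (rewrite !RtoC_plus, !RtoC_mult; ring).
            apply Hc; nra. }
        assert (Ev : (r * v / 2)%C = (RtoC (r / 2) * v)%C) by (rewrite RtoC_div by lra; field).
        assert (Ew : (r * w / 2)%C = (RtoC (r / 2) * w)%C) by (rewrite RtoC_div by lra; field).
        rewrite Ev, Ew.
        replace (p + a * v + b * w + RtoC (r / 2) * v)%C with (p + RtoC (a + r / 2) * v + b * w)%C
          by (rewrite RtoC_plus; ring).
        replace (p + a * v + b * w + RtoC (r / 2) * w)%C with (p + a * v + RtoC (b + r / 2) * w)%C
          by (rewrite RtoC_plus; ring).
        replace (p + RtoC (a + r / 2) * v + b * w + RtoC (r / 2) * w)%C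
          with (p + RtoC (a + r / 2) * v + RtoC (b + r / 2) * w)%C
          by (rewrite (RtoC_plus b); ring).
        specialize (G1 ltac:(lra) ltac:(lra) ltac:(lra) ltac:(lra)).
        specialize (G2 ltac:(lra) ltac:(lra) ltac:(lra) ltac:(lra)).
        specialize (G3 ltac:(lra) ltac:(lra) ltac:(lra) ltac:(lra)).
        specialize (G4 ltac:(lra) ltac:(lra) ltac:(lra) ltac:(lra)).
        eapply Rle_trans; [apply Cmod_triangle|].
        eapply Rle_trans; [apply Rplus_le_compat_r, Cmod_triangle|].
        eapply Rle_trans; [apply Rplus_le_compat_r, Rplus_le_compat_r, Cmod_triangle|].
        lra.
      - intros x y.
        destruct (classic (0 <= x <= 1 /\ 0 <= y <= 1)) as [[Hx Hy]|n].
        + destruct (H x y Hx Hy) as [l Hl].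
          destruct (goursat_local F _ l eps Hl He) as [d [Hd L]].
          exists (d / (K + 1)). split; [apply Rdiv_lt_0_compat; lra|].
          intros a b r [Hr Hrd] Hax Hby Ha Ha' Hb Hb'.
          assert (rK : r * K < d).
          { apply Rmult_lt_compat_r with (r := K + 1) in Hrd; [|lra].
            unfold Rdiv in Hrd. rewrite Rmult_assoc, Rinv_l, Rmult_1_r in Hrd by lra. nra. }
          assert (Q : forall s t, 0 <= s <= 1 -> 0 <= t <= 1 ->
            (p + a * v + b * w + s * (r * v) + t * (r * w))%C
              = (p + RtoC (a + s * r) * v + RtoC (b + t * r) * w)%C).
          { intros s t _ _. rewrite !RtoC_plus, !RtoC_mult. ring. }
          assert (Dist : forall s t, 0 <= s <= 1 -> 0 <= t <= 1 ->
            Cmod (p + a * v + b * w + s * (r * v) + t * (r * w) - (p + x * v + y * w)) <= r * K).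
          { intros s t Hs Ht. rewrite Q by auto.
            replace (p + RtoC (a + s * r) * v + RtoC (b + t * r) * w - (p + x * v + y * w))%C
              with (RtoC (a + s * r - x) * v + RtoC (b + t * r - y) * w)%C
              by (rewrite !RtoC_minus; ring).
            eapply Rle_trans; [apply Cmod_triangle|]. rewrite !Cmod_mult, !Cmod_R.
            assert (Rabs (a + s * r - x) <= r) by (apply Rabs_le; nra).
            assert (Rabs (b + t * r - y) <= r) by (apply Rabs_le; nra).
            unfold K. nra. }
          eapply Rle_trans.
          * apply (L (p + a * v + b * w)%C (RtoC r * v)%C (RtoC r * w)%C) with (D := r * K); auto.
            intros s t Hs Ht. split.
            -- rewrite Q by auto. apply Hc; nra.
            -- eapply Rle_lt_trans; [apply Dist; auto|exact rK].
          * rewrite !Cmod_mult, Cmod_R, Rabs_pos_eq by lra. unfold c. right. fold K.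
            unfold K. ring.
        (* Points outside the unit square lie in none of its subsquares, and [Good] only speaks of
           those. *)
        + exists 1. split; [lra|]. intros a b r Hr Hax Hby Ha Ha' Hb Hb'. exfalso. apply n. lra. }
    unfold Good in G. replace (p + 0 * v + 0 * w)%C with p in G by ring.
    rewrite !Cmult_1_l, !Rmult_1_r in G. apply G; lra. }
  apply Cmod_eq_0. assert (X := Cmod_ge_0 (par_bd F p v w)).
  destruct (Req_dec K 0) as [E|n].
  - specialize (Main 1 ltac:(lra)). rewrite E in Main. lra.
  - apply Rle_antisym; auto.
    apply Rnot_lt_le. intros L.
    assert (0 < 4 * K * K) by nra.
    specialize (Main (Cmod (par_bd F p v w) / (4 * K * K)) ltac:(apply Rdiv_lt_0_compat; auto)).
    replace (2 * K * (Cmod (par_bd F p v w) / (4 * K * K) * K)) with (Cmod (par_bd F p v w) / 2) in Main by (field; auto).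
    lra.
Qed.

(** * Cauchy's formula on circles *)

Definition c2pi : C := (0, 2 * PI).

Definition cis (s : R) : C := Cexp (RtoC s * c2pi).

Lemma Cmod_cis (s : R) : Cmod (cis s) = 1.
Proof. unfold cis. rewrite Cmod_Cexp. simpl. replace (s * 0 - 0 * (2 * PI)) with 0 by ring. apply exp_0. Qed.

Lemma cis_neq_0 (s : R) : cis s <> 0.
Proof. apply Cexp_neq_0. Qed.

Lemma Cexp_period (z : C) : Cexp (z + c2pi) = Cexp z.
Proof.
  rewrite Cexp_plus. assert (E : Cexp c2pi = 1).
  { unfold Cexp, c2pi; simpl. rewrite exp_0, cos_2PI, sin_2PI. apply injective_projections; simpl; ring. }
  rewrite E. ring.
Qed.

Lemma rcont_cis (f : C -> C) (z : C) (r s : R) :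
  ccont f (z + r * cis s)%C -> rcont (fun u => f (z + r * cis u)%C) s.
Proof.
  intros H.
  assert (X : ccont (fun x => f (z + r * Cexp x)%C) (0 + s * c2pi)%C).
  { apply (ccont_comp f (fun x => (z + r * Cexp x)%C)).
    - apply ccont_plus; [apply ccont_const|]. apply ccont_mult; [apply ccont_const|].
      apply (cdiff_ccont _ _ _ (cdiff_Cexp _)).
    - replace (0 + s * c2pi)%C with (s * c2pi)%C by ring. exact H. }
  apply rcont_line in X. intros eps He. destruct (X eps He) as [d [Hd K]].
  exists d. split; auto. intros u Hu. specialize (K u Hu). unfold cis.
  replace (0 + u * c2pi)%C with (u * c2pi)%C in K by ring.
  replace (0 + s * c2pi)%C with (s * c2pi)%C in K by ring. exact K.
Qed.

(** With zeta = z + r exp(2 pi i s) this is the integral of f(zeta)/(zeta - z) over the circle,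
    divided by 2 pi i. *)
Definition circle_mean (f : C -> C) (z : C) (r : R) : C := CInt (fun s => f (z + r * cis s)%C) 0 1.

Lemma Cmod_circle (z : C) (r s : R) : 0 <= r -> Cmod (z + r * cis s - z) = r.
Proof.
  intros Hr. replace (z + r * cis s - z)%C with (r * cis s)%C by ring.
  rewrite Cmod_mult, Cmod_cis, Cmod_R, Rabs_pos_eq; lra.
Qed.

(* Goursat on a rectangle for f (z + exp x): the horizontal sides cancel by periodicity. *)
Lemma circle_mean_radius (f : C -> C) (z : C) (r0 r1 r2 : R) :
  (forall u, 0 < Cmod (u - z) < r0 -> exists l, cdiff f u l) ->
  0 < r1 <= r2 -> r2 < r0 -> circle_mean f z r1 = circle_mean f z r2.
Proof.
  intros H Hr HR.
  assert (H2 : 0 < r2) by lra.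
  set (F := fun x => f (z + Cexp x)%C).
  set (p := (ln r1, 0) : C). set (v := (ln r2 - ln r1, 0) : C). set (w := c2pi).
  assert (Hln : ln r1 <= ln r2).
  { destruct (Req_dec r1 r2) as [E|n]; [rewrite E; lra|]. left. apply ln_increasing; lra. }
  assert (G : par_bd F p v w = 0).
  { apply goursat. intros s t Hs Ht.
    destruct (H (z + Cexp (p + s * v + t * w))%C) as [l Hl].
    - replace (z + Cexp (p + s * v + t * w) - z)%C with (Cexp (p + s * v + t * w)) by ring.
      rewrite Cmod_Cexp. unfold p, v, w, c2pi; simpl.
      split; [apply exp_pos|].
      replace (ln r1 + (s * (ln r2 - ln r1) - 0 * 0) + (t * 0 - 0 * (2 * PI)))
        with (ln r1 + s * (ln r2 - ln r1)) by ring.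
      apply Rle_lt_trans with (exp (ln r2)); [|rewrite exp_ln; lra].
      apply Rnot_lt_le. intros L. apply exp_lt_inv in L. nra.
    - exists (l * (0 + Cexp (p + s * v + t * w)))%C. unfold F.
      apply (cdiff_comp f (fun x => (z + Cexp x)%C)); auto.
      apply (cdiff_plus (fun _ => z)); [apply cdiff_const|apply cdiff_Cexp]. }
  unfold par_bd in G.
  assert (E1 : seg F (p + w) v = seg F p v).
  { unfold seg. f_equal. apply CInt_ext; [lra|]. intros s _. unfold F.
    replace (p + w + s * v)%C with (p + s * v + w)%C by ring.
    unfold w. rewrite Cexp_period. reflexivity. }
  rewrite E1 in G.
  assert (X : forall r q, 0 < r -> q = (ln r, 0) :> C -> seg F q w = (w * circle_mean f z r)%C).
  { intros r q H0 E. unfold seg, circle_mean. f_equal. apply CInt_ext; [lra|]. intros s _.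
    unfold F, cis. rewrite Cexp_plus. f_equal. f_equal. rewrite E. f_equal.
    unfold Cexp; simpl. rewrite cos_0, sin_0, exp_ln by auto.
    apply injective_projections; simpl; ring. }
  rewrite (X r1 p) in G by (auto; lra). rewrite (X r2 (p + v)%C) in G.
  2: auto. 2:{ unfold p, v. apply injective_projections; simpl; ring. }
  assert (Hw : w <> 0).
  { unfold w, c2pi. intros E. apply (f_equal snd) in E. simpl in E. assert (P := PI_RGT_0). lra. }
  assert (G' : (w * (circle_mean f z r2 - circle_mean f z r1) = 0)%C).
  { rewrite <- G. ring. }
  destruct (Ceq_dec (circle_mean f z r2 - circle_mean f z r1) 0) as [E|n].
  2:{ exfalso. apply (Cmult_neq_0 _ _ Hw n G'). }
  clear G'. rename E into G'.
  replace (circle_mean f z r2) with (circle_mean f z r2 - circle_mean f z r1 + circle_mean f z r1)%C by ring.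
  rewrite G'. ring.
Qed.

(** The mean does not depend on the radius, which can thus be shrunk to zero. Only the limit of f at
    z enters, not differentiability there, so the lemma applies to difference quotients. *)
Lemma circle_mean_limit (f : C -> C) (z l : C) (r0 r : R) :
  (forall u, 0 < Cmod (u - z) < r0 -> exists l, cdiff f u l) ->
  (forall eps, 0 < eps -> exists d, 0 < d /\ forall u, 0 < Cmod (u - z) < d -> Cmod (f u - l) < eps) ->
  0 < r < r0 -> circle_mean f z r = l.
Proof.
  intros H Hl Hr.
  assert (Main : forall eps, 0 < eps -> Cmod (circle_mean f z r - l) <= eps).
  { intros eps He. destruct (Hl eps He) as [d [Hd K]].
    set (q := Rmin r (d / 2)).
    assert (Hq : 0 < q) by (apply Rmin_pos; lra).
    assert (Hq1 : q <= r) by apply Rmin_l. assert (Hq2 : q <= d / 2) by apply Rmin_r.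
    rewrite <- (circle_mean_radius f z r0 q r) by (auto; lra).
    assert (Cc : forall s, 0 <= s <= 1 -> rcont (fun u => f (z + q * cis u)%C) s).
    { intros s Hs. apply rcont_cis. destruct (H (z + q * cis s)%C) as [m Hm].
      - rewrite Cmod_circle; lra.
      - apply (cdiff_ccont _ _ _ Hm). }
    assert (Cl : forall s, 0 <= s <= 1 -> rcont (fun _ : R => (- l)%C) s).
    { intros s Hs e0 He0. exists 1. split; [lra|]. intros u _.
      replace (- l - - l)%C with (RtoC 0) by ring. rewrite Cmod_0. auto. }
    replace (circle_mean f z q - l)%C with (CInt (fun s => (f (z + q * cis s) + - l)%C) 0 1).
    2:{ rewrite CInt_plus; auto; [|lra]. rewrite CInt_const. unfold circle_mean.
        rewrite Rminus_0_r. ring. }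
    replace eps with ((1 - 0) * eps) by ring. apply CInt_bound; [lra| |].
    - intros s Hs. 
      assert (X : ccont (fun u => (f u + - l)%C) (z + q * cis s)%C).
      { apply ccont_plus; [|apply ccont_const]. destruct (H (z + q * cis s)%C) as [m Hm].
        - rewrite Cmod_circle; lra.
        - apply (cdiff_ccont _ _ _ Hm). }
      apply (rcont_cis (fun u => (f u + - l)%C)). exact X.
    - intros s Hs. left. apply K. rewrite Cmod_circle; lra. }
  assert (E : (circle_mean f z r - l = 0)%C).
  { apply Cmod_eq_0. apply Rle_antisym; [|apply Cmod_ge_0]. apply Rnot_lt_le. intros L.
    specialize (Main (Cmod (circle_mean f z r - l) / 2)). lra. }
  replace (circle_mean f z r) with (circle_mean f z r - l + l)%C by ring. rewrite E. ring.
Qed.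

Lemma Cminus_neq_0 (u z : C) : u <> z -> (u - z <> 0)%C.
Proof. intros n E. apply n. replace u with ((u - z) + z)%C by ring. rewrite E. ring. Qed.

(** The difference quotient (f u - f z)/(u - z) is holomorphic off z and tends to f'(z), so its mean
    over any circle is f'(z). *)
Lemma cauchy_derivative (f : C -> C) (z l : C) (r0 r : R) :
  (forall u, Cmod (u - z) < r0 -> exists l, cdiff f u l) -> cdiff f z l -> 0 < r < r0 ->
  l = CInt (fun s => ((f (z + r * cis s) - f z) / (r * cis s))%C) 0 1.
Proof.
  intros H Hl Hr.
  rewrite <- (circle_mean_limit (fun u => ((f u - f z) / (u - z))%C) z l r0 r); auto.
  - unfold circle_mean. apply CInt_ext; [lra|]. intros s _.
    replace (z + r * cis s - z)%C with (r * cis s)%C by ring. reflexivity.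
  - intros u Hu. destruct (H u) as [m Hm]; [lra|].
    exists (((m - 0) * (u - z) - (f u - f z) * (1 - 0)) / ((u - z) * (u - z)))%C.
    apply (cdiff_div (fun u => (f u - f z)%C) (fun u => (u - z)%C)).
    + apply (cdiff_minus f (fun _ => f z)); [auto|apply cdiff_const].
    + apply (cdiff_minus (fun u => u) (fun _ => z)); [apply cdiff_id|apply cdiff_const].
    + apply Cmod_gt_0. lra.
  - intros eps He. destruct Hl as [g [Hg [Eg Fg]]]. destruct (Hg eps He) as [d [Hd K]].
    exists d. split; auto. intros u Hu. rewrite (Fg u), <- Eg.
    replace ((f z + (u - z) * g u - f z) / (u - z))%C with (g u).
    + apply K. lra.
    + field. apply Cmod_gt_0. lra.
Qed.

Lemma cauchy_estimate (f : C -> C) (z l : C) (r0 r M : R) :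
  (forall u, Cmod (u - z) < r0 -> exists l, cdiff f u l) -> cdiff f z l -> 0 < r < r0 ->
  (forall u, Cmod (u - z) = r -> Cmod (f u - f z) <= M) -> Cmod l <= M / r.
Proof.
  intros H Hl Hr HM. rewrite (cauchy_derivative f z l r0 r) by auto.
  assert (Hrr : RtoC r <> 0) by (intros E; apply RtoC_inj in E; lra).
  replace (M / r) with ((1 - 0) * (M / r)) by ring. apply CInt_bound; [lra| |].
  - intros s Hs. destruct (H (z + r * cis s)%C) as [m Hm]; [rewrite Cmod_circle; lra|].
    assert (X : ccont (fun u => ((f u - f z) * / (u - z))%C) (z + r * cis s)%C).
    { apply ccont_mult.
      - apply ccont_minus; [apply (cdiff_ccont _ _ _ Hm)|apply ccont_const].
      - apply (ccont_inv (fun u => (u - z)%C)).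
        + apply ccont_minus; [apply ccont_id|apply ccont_const].
        + replace (z + r * cis s - z)%C with (r * cis s)%C by ring.
          apply Cmult_neq_0; auto. apply cis_neq_0. }
    apply rcont_cis in X. intros eps He. destruct (X eps He) as [d [Hd K]].
    exists d. split; auto. intros u Hu. specialize (K u Hu).
    replace (z + r * cis u - z)%C with (r * cis u)%C in K by ring.
    replace (z + r * cis s - z)%C with (r * cis s)%C in K by ring. exact K.
  - intros s Hs. rewrite Cmod_div by (apply Cmult_neq_0; auto; apply cis_neq_0).
    rewrite Cmod_mult, Cmod_cis, Cmod_R, Rmult_1_r, Rabs_pos_eq by lra.
    apply Rmult_le_compat_r; [left; apply Rinv_0_lt_compat; lra|].
    apply HM. apply Cmod_circle. lra.
Qed.

Lemma max_modulus_center (f : C -> C) (z : C) (r0 r M : R) :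
  (forall u, Cmod (u - z) < r0 -> exists l, cdiff f u l) -> 0 < r < r0 ->
  (forall u, Cmod (u - z) = r -> Cmod (f u) <= M) -> Cmod (f z) <= M.
Proof.
  intros H Hr HM.
  rewrite <- (circle_mean_limit f z (f z) r0 r); auto.
  - replace M with ((1 - 0) * M) by ring. apply CInt_bound; [lra| |].
    + intros s Hs. apply rcont_cis. destruct (H (z + r * cis s)%C) as [m Hm]; [rewrite Cmod_circle; lra|].
      apply (cdiff_ccont _ _ _ Hm).
    + intros s Hs. apply HM. apply Cmod_circle. lra.
  - intros u Hu. apply H. lra.
  - destruct (H z) as [m Hm].
    { rewrite Cmod_self. lra. }
    intros eps He. destruct (cdiff_ccont _ _ _ Hm eps He) as [d [Hd K]].
    exists d. split; auto. intros u Hu. apply K. lra.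
Qed.

(** Joint continuity at each (z, s) is made uniform in s by compactness of [0, 1]. *)
Lemma CInt_param_continuous (I : C -> R -> C) (z : C) (d : R) : 0 < d ->
  (forall u s, Cmod (u - z) < d -> 0 <= s <= 1 -> rcont (I u) s) ->
  (forall s, 0 <= s <= 1 -> forall eps, 0 < eps -> exists d, 0 < d /\
     forall u x, Cmod (u - z) < d -> Rabs (x - s) < d -> Cmod (I u x - I z s) < eps) ->
  ccont (fun u => CInt (I u) 0 1) z.
Proof.
  intros Hd Hc HJ eps He.
  destruct (lebesgue_number_1d 0 1 (fun s e => forall u x, Cmod (u - z) < e -> Rabs (x - s) < e ->
     Cmod (I u x - I z s) < eps / 4)) as [e [He' K]].
  { intros s Hs. apply HJ; auto. lra. }
  exists (Rmin d e). split; [apply Rmin_pos; auto|]. intros u Hu.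
  assert (Hu1 := Rlt_le_trans _ _ _ Hu (Rmin_l _ _)).
  assert (Hu2 := Rlt_le_trans _ _ _ Hu (Rmin_r _ _)).
  assert (Hz : Cmod (z - z) < d).
  { rewrite Cmod_self. exact Hd. }
  assert (Hz' : Cmod (z - z) < e).
  { rewrite Cmod_self. exact He'. }
  replace (CInt (I u) 0 1 - CInt (I z) 0 1)%C with (CInt (fun s => (I u s + (- (1)) * I z s)%C) 0 1).
  2:{ rewrite CInt_plus, CInt_scal; auto; try lra; [ring|]. intros s Hs. apply rcont_scal. auto. }
  apply Rle_lt_trans with ((1 - 0) * (eps / 2)); [|lra].
  apply CInt_bound; [lra| |].
  - intros s Hs eps' He''.
    destruct (Hc u s Hu1 Hs (eps' / 2)) as [d1 [Hd1 K1]]; [lra|].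
    destruct (Hc z s Hz Hs (eps' / 2)) as [d2 [Hd2 K2]]; [lra|].
    exists (Rmin d1 d2). split; [apply Rmin_pos; auto|]. intros x Hx.
    specialize (K1 x (Rlt_le_trans _ _ _ Hx (Rmin_l _ _))).
    specialize (K2 x (Rlt_le_trans _ _ _ Hx (Rmin_r _ _))).
    replace (I u x + - (1) * I z x - (I u s + - (1) * I z s))%C
      with ((I u x - I u s) + - (I z x - I z s))%C by ring.
    eapply Rle_lt_trans; [apply Cmod_triangle|]. rewrite Cmod_opp. lra.
  - intros s Hs. destruct (K s Hs) as [x [e1 [Hx [H1 [H2 H3]]]]].
    assert (A := H3 u s ltac:(lra) H1). assert (B := H3 z s ltac:(lra) H1).
    replace (I u s + - (1) * I z s)%C with ((I u s - I z x) + - (I z s - I z x))%C by ring.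
    eapply Rle_trans; [apply Cmod_triangle|]. rewrite Cmod_opp. lra.
Qed.

(* Cauchy's estimate, applied first to f and then to f (w + h) - f w, makes f' locally Lipschitz. *)
Lemma derivative_continuous (f df : C -> C) (z : C) (r0 : R) : 0 < r0 ->
  (forall u, Cmod (u - z) < r0 -> cdiff f u (df u)) -> ccont df z.
Proof.
  intros HR H.
  assert (Cf : ccont f z) by (apply (cdiff_ccont _ _ (df z)), H; rewrite Cmod_self; exact HR).
  destruct (Cf 1 Rlt_0_1) as [d1 [Hd1 K1]].
  set (d := Rmin d1 r0). assert (Hd : 0 < d) by (apply Rmin_pos; auto).
  assert (L1 : d <= d1) by apply Rmin_l. assert (L2 : d <= r0) by apply Rmin_r.
  assert (B : forall w, Cmod (w - z) < d / 2 -> Cmod (df w) <= 2 / (d / 4)).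
  { intros w Hw. apply (cauchy_estimate f w (df w) (d / 2) (d / 4)); [|apply H; lra|lra|].
    - intros u Hu. exists (df u). apply H. assert (T := Cmod_triangle_sub u w z). lra.
    - intros u Hu. assert (T := Cmod_triangle_sub u w z).
      assert (T' := Cmod_triangle_sub (f u) (f z) (f w)). rewrite (Cmod_minus_sym (f z)) in T'.
      assert (T1 := K1 u ltac:(lra)). assert (T2 := K1 w ltac:(lra)). lra. }
  intros eps He. exists (Rmin (d / 4) (eps * (d * d) / 256)).
  assert (Hdd : 0 < eps * (d * d)) by (apply Rmult_lt_0_compat; nra).
  split; [apply Rmin_pos; lra|]. intros u Hu.
  assert (Hu1 := Rlt_le_trans _ _ _ Hu (Rmin_l _ _)).
  assert (Hu2 := Rlt_le_trans _ _ _ Hu (Rmin_r _ _)).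
  set (h := (u - z)%C) in *. set (F := fun w => (f (w + h) - f w)%C).
  assert (Dw : forall w, Cmod (w - z) < d / 4 -> cdiff F w (df (w + h) - df w)%C).
  { intros w Hw. apply (cdiff_minus (fun w => f (w + h)%C) f); [|apply H; lra].
    apply (cdiff_eq _ _ (df (w + h) * (1 + 0))%C); [|ring].
    apply (cdiff_comp f (fun w => (w + h)%C)).
    - apply (cdiff_plus (fun w => w) (fun _ => h)); [apply cdiff_id|apply cdiff_const].
    - apply H. replace (w + h - z)%C with ((w - z) + h)%C by ring.
      assert (T := Cmod_triangle (w - z) h). lra. }
  assert (BF : forall w, Cmod (w - z) < d / 4 -> Cmod (F w) <= 2 / (d / 4) * Cmod h).
  { intros w Hw.
    assert (In : forall s, 0 <= s <= 1 -> Cmod (w + s * h - z) < d / 2).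
    { intros s Hs. replace (w + s * h - z)%C with ((w - z) + s * h)%C by ring.
      eapply Rle_lt_trans; [apply Cmod_triangle|]. rewrite Cmod_mult, Cmod_R, Rabs_pos_eq by lra.
      assert (P := Cmod_ge_0 h). nra. }
    apply (mean_value_bound f df); intros s Hs; [apply H; specialize (In s Hs); lra|auto]. }
  assert (E : Cmod (df (z + h) - df z)%C <= 2 * (2 / (d / 4) * Cmod h) / (d / 8)).
  { apply (cauchy_estimate F z _ (d / 4) (d / 8)); [|apply Dw; rewrite Cmod_self; lra|lra|].
    - intros w Hw. eexists. apply Dw, Hw.
    - intros w Hw. assert (B1 := BF w ltac:(lra)). assert (B2 := BF z ltac:(rewrite Cmod_self; lra)).
      assert (T := Cmod_triangle (F w) (- F z)). rewrite Cmod_opp in T. unfold Cminus. lra. }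
  replace (z + h)%C with u in E by (unfold h; ring).
  eapply Rle_lt_trans; [exact E|]. apply Rmult_lt_reg_r with (d * d); [nra|].
  replace (2 * (2 / (d / 4) * Cmod h) / (d / 8) * (d * d)) with (128 * Cmod h) by (field; lra). lra.
Qed.

(** * Square roots on a disc *)

(** Both 0 and s are interior to the interval of continuity, so that the derivative of the primitive
    is two-sided. *)
Lemma rdiff_primitive (k : R -> C) (a b s : R) : a < 0 -> 0 < b -> a < s < b ->
  (forall x, a <= x <= b -> rcont k x) -> rdiff (fun x => CInt k 0 x) s (k s).
Proof.
  intros Ha Hb0 Hs Hk. apply is_derive_rdiff.
  assert (Hb : forall x, a < x < b ->
     is_RInt (V := C_R_NormedModule) k 0 x (CInt k 0 x)).
  { intros x Hx. apply (RInt_correct (V := C_R_CompleteNormedModule)).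
    apply (ex_RInt_continuous (V := C_R_CompleteNormedModule)). intros y Hy.
    apply rcont_continuous, Hk.
    unfold Rmin, Rmax in Hy. destruct (Rle_dec 0 x); lra. }
  apply (is_derive_RInt (V := C_R_NormedModule) k (fun x => CInt k 0 x) 0 s).
  - assert (Hd : 0 < Rmin (s - a) (b - s)) by (apply Rmin_pos; lra).
    exists (mkposreal _ Hd). intros x Hx. apply Hb.
    change (Rabs (x - s) < Rmin (s - a) (b - s)) in Hx.
    assert (H1 := Rmin_l (s - a) (b - s)). assert (H2 := Rmin_r (s - a) (b - s)).
    apply Rabs_def2 in Hx. lra.
  - apply rcont_continuous. apply Hk. lra.
Qed.

(* The branch of the square root is obtained from the primitive of F'/F along rays. *)
Lemma disc_sqrt (F dF : C -> C) (z0 g0 : C) (rho : R) : 0 < rho ->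
  (forall u, Cmod (u - z0) < rho -> cdiff F u (dF u)) ->
  (forall u, Cmod (u - z0) < rho -> F u <> 0) -> (g0 * g0 = F z0)%C ->
  exists g, g z0 = g0 /\ (forall u, Cmod (u - z0) < rho -> (g u * g u = F u)%C) /\
    forall u, Cmod (u - z0) < rho -> exists l, cdiff g u l.
Proof.
  intros Hrho HF Hnz Hg0.
  set (q := fun u => (dF u * / F u)%C).
  assert (Hq : forall u, Cmod (u - z0) < rho -> ccont q u).
  { intros u Hu. apply ccont_mult.
    - apply (derivative_continuous F dF u (rho - Cmod (u - z0))); [lra|].
      intros w Hw. apply HF. assert (T := Cmod_triangle_sub w u z0). lra.
    - apply ccont_inv; [apply (cdiff_ccont _ _ _ (HF u Hu))|apply Hnz; auto]. }
  assert (Ray : forall u s, Cmod (u - z0) < rho -> 0 <= s <= 1 -> Cmod (z0 + s * (u - z0) - z0) < rho).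
  { intros u s Hu Hs. replace (z0 + s * (u - z0) - z0)%C with (s * (u - z0))%C by ring.
    rewrite Cmod_mult, Cmod_R, Rabs_pos_eq by lra. assert (P := Cmod_ge_0 (u - z0)). nra. }
  (* [L] is the branch of log(F/F(z0)) on the disc that vanishes at z0, as [EL] confirms. *)
  set (L := fun u => ((u - z0) * CInt (fun s => q (z0 + s * (u - z0))%C) 0 1)%C).
  assert (HL : forall u, Cmod (u - z0) < rho -> ccont L u).
  { intros z Hz. apply ccont_mult.
    { apply ccont_minus; [apply ccont_id|apply ccont_const]. }
    apply (CInt_param_continuous (fun u s => q (z0 + s * (u - z0))%C) z (rho - Cmod (z - z0))); [lra| |].
    - intros u s Hu Hs. apply rcont_line. apply Hq. apply Ray; auto.
      assert (T := Cmod_triangle_sub u z z0). lra.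
    - intros s Hs eps He.
      destruct (Hq _ (Ray z s Hz Hs) eps He) as [d [Hd K]].
      assert (Pz := Cmod_ge_0 (z - z0)).
      set (e := Rmin 1 (d / (3 + Cmod (z - z0)))).
      assert (He0 : 0 < e) by (apply Rmin_pos; [lra|apply Rdiv_lt_0_compat; lra]).
      assert (He1 : e <= 1) by apply Rmin_l.
      assert (He2 : e * (3 + Cmod (z - z0)) <= d).
      { apply Rle_trans with (d / (3 + Cmod (z - z0)) * (3 + Cmod (z - z0))).
        - apply Rmult_le_compat_r; [lra|apply Rmin_r].
        - right. field. lra. }
      exists e. split; auto. intros u x Hu Hx. apply K.
      replace (z0 + x * (u - z0) - (z0 + s * (z - z0)))%C
        with (x * (u - z) + RtoC (x - s) * (z - z0))%C by (rewrite RtoC_minus; ring).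
      eapply Rle_lt_trans; [apply Cmod_triangle|]. rewrite !Cmod_mult, !Cmod_R.
      assert (Rabs x <= 2). { apply Rabs_le. apply Rabs_def2 in Hx. lra. }
      assert (Q := Cmod_ge_0 (u - z)). assert (Q' := Rabs_pos x).
      assert (Rabs x * Cmod (u - z) <= 2 * e) by (apply Rmult_le_compat; lra).
      assert (Rabs (x - s) * Cmod (z - z0) <= e * Cmod (z - z0)) by (apply Rmult_le_compat_r; lra).
      lra. }
  assert (EL : forall u, Cmod (u - z0) < rho -> (F z0 * Cexp (L u) = F u)%C).
  { intros u Hu. set (v := (u - z0)%C).
    assert (Pv := Cmod_ge_0 v). fold v in Hu.
    (* The ray is prolonged by e beyond both ends, which makes the derivatives at the parameters 0
       and 1 two-sided; along it F exp(-L) has derivative zero. *)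
    assert (He : exists e, 0 < e /\ (1 + e) * Cmod v < rho).
    { exists ((rho - Cmod v) / (2 * (Cmod v + 1))). split; [apply Rdiv_lt_0_compat; lra|].
      assert ((rho - Cmod v) / (2 * (Cmod v + 1)) * Cmod v <= (rho - Cmod v) / 2).
      { apply Rmult_le_reg_r with (2 * (Cmod v + 1)); [lra|]. field_simplify; [nra|lra]. }
      nra. }
    destruct He as [e [He0 He]].
    set (k := fun s => (v * q (z0 + RtoC s * v))%C).
    assert (In : forall x, - e <= x <= 1 + e -> Cmod (z0 + x * v - z0) < rho).
    { intros x Hx. replace (z0 + x * v - z0)%C with (x * v)%C by ring.
      rewrite Cmod_mult, Cmod_R. assert (Rabs x <= 1 + e) by (apply Rabs_le; lra). nra. }
    assert (Hk : forall x, - e <= x <= 1 + e -> rcont k x).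
    { intros x Hx. apply rcont_scal. apply rcont_line. apply Hq. auto. }
    set (h := fun s => (F (z0 + RtoC s * v) * Cexp (- CInt k 0 s))%C).
    assert (Hh : h 1 = h 0).
    { apply rdiff_zero_const. intros s Hs.
      assert (D1 : rdiff (fun s => F (z0 + RtoC s * v)%C) s (dF (z0 + s * v) * v)%C).
      { apply (rdiff_comp F); [apply rdiff_line|]. apply HF, In. lra. }
      assert (D2 : rdiff (fun s => Cexp (- CInt k 0 s)) s (Cexp (- CInt k 0 s) * (- (1)) * k s)%C).
      { apply (rdiff_comp (fun x => Cexp (- x)) (fun s => CInt k 0 s)).
        - apply (rdiff_primitive k (- e) (1 + e)); auto; lra.
        - apply (cdiff_comp Cexp (fun x => (- x)%C)); [|apply cdiff_Cexp].
          apply (cdiff_opp (fun x => x)). apply cdiff_id. }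
      assert (D := rdiff_mult _ _ _ _ _ D1 D2).
      replace (RtoC 0) with (dF (z0 + s * v) * v * Cexp (- CInt k 0 s) +
         F (z0 + s * v) * (Cexp (- CInt k 0 s) * - (1) * k s))%C; [exact D|].
      unfold k, q. field. apply Hnz, In. lra. }
    unfold h in Hh.
    assert (E0 : CInt k 0 0 = 0).
    { apply is_RInt_CInt_unique. apply (is_RInt_point (V := C_R_NormedModule)). }
    assert (E1 : CInt k 0 1 = L u).
    { unfold k, L. rewrite CInt_scal; [reflexivity|lra|].
      intros s Hs. apply rcont_line. apply Hq, In. lra. }
    rewrite E0, E1 in Hh.
    replace (z0 + 1 * v)%C with u in Hh by (unfold v; ring).
    replace (z0 + 0 * v)%C with z0 in Hh by ring.
    replace (- 0)%C with (RtoC 0) in Hh by ring. rewrite Cexp_0, Cmult_1_r in Hh.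
    rewrite <- Hh, <- Cmult_assoc, <- Cexp_plus.
    replace (- L u + L u)%C with (RtoC 0) by ring. rewrite Cexp_0. ring. }
  set (g := fun u => (g0 * Cexp (L u * / 2))%C).
  assert (Eg : forall u, Cmod (u - z0) < rho -> (g u * g u = F u)%C).
  { intros u Hu. unfold g. rewrite <- (EL u Hu), <- Hg0.
    replace (L u) with (L u * / 2 + L u * / 2)%C at 3 by field.
    rewrite Cexp_plus. ring. }
  assert (Cg : forall u, Cmod (u - z0) < rho -> ccont g u).
  { intros u Hu. apply ccont_mult; [apply ccont_const|].
    apply (ccont_comp Cexp (fun u => (L u * / 2)%C)).
    - apply ccont_mult; [apply HL; auto|apply ccont_const].
    - apply (cdiff_ccont _ _ _ (cdiff_Cexp _)). }
  exists g. split; [|split]; auto.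
  - unfold g, L. replace (z0 - z0)%C with (RtoC 0) by ring. rewrite !Cmult_0_l, Cexp_0. ring.
  - intros z Hz.
    assert (Gz : g z <> 0).
    { intros E. apply (Hnz z Hz). rewrite <- (Eg z Hz), E. ring. }
    destruct (HF z Hz) as [a [Ha [Ea Fa]]].
    assert (Cs : ccont (fun u => (g u + g z)%C) z) by (apply ccont_plus; [apply Cg; auto|apply ccont_const]).
    assert (Sz : (g z + g z <> 0)%C).
    { replace (g z + g z)%C with (2 * g z)%C by ring. apply Cmult_neq_0; auto.
      intros E. apply RtoC_inj in E. lra. }
    destruct (Cs (Cmod (g z + g z))) as [d [Hd K]]; [apply Cmod_gt_0; auto|].
    (* Only continuity of [g] is known so far. Differentiability comes from g^2 = F, since g(u) -
       g(z) = (F(u) - F(z))/(g(u) + g(z)) with a denominator that is nonzero near z. *)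
    exists (a z * / (g z + g z))%C.
    set (d' := Rmin d (rho - Cmod (z - z0))).
    assert (Hd' : 0 < d') by (apply Rmin_pos; lra).
    apply (cdiff_ext_loc (fun u => (g z + (u - z) * (a u * / (g u + g z)))%C) g z _ d'); auto.
    + intros u Hu.
      assert (Hu1 := Rlt_le_trans _ _ _ Hu (Rmin_l _ _)).
      assert (Hu2 := Rlt_le_trans _ _ _ Hu (Rmin_r _ _)).
      assert (T := Cmod_triangle_sub u z z0).
      assert (Hn : (g u + g z <> 0)%C).
      { intros E. specialize (K u Hu1). cbv beta in K. rewrite E in K.
        replace (0 - (g z + g z))%C with (- (g z + g z))%C in K by ring. rewrite Cmod_opp in K. lra. }
      replace (g z + (u - z) * (a u * / (g u + g z)))%C
        with (g z + (F u - F z) * / (g u + g z))%C.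
      * rewrite <- (Eg u) by lra. rewrite <- (Eg z) by lra. field. auto.
      * rewrite (Fa u). ring.
    + exists (fun u => (a u * / (g u + g z))%C). split.
      { apply ccont_mult; auto. apply (ccont_inv (fun u => (g u + g z)%C)); auto. }
      split; auto. intros u. ring.
Qed.

(** * Distortion of univalent functions *)

Lemma Cexp_surjective (w : C) : w <> 0 -> exists x, Cexp x = w /\ fst x = ln (Cmod w).
Proof.
  intros Hw. assert (Hp := proj1 (Cmod_gt_0 _) Hw). set (m := Cmod w) in *.
  destruct w as [a b].
  assert (E : m * m = a * a + b * b).
  { unfold m, Cmod; simpl. rewrite sqrt_sqrt; nra. }
  assert (Ha : -1 <= a / m <= 1).
  { assert (- m <= a <= m) by nra.
    split; apply Rmult_le_reg_r with m; auto; field_simplify; lra. }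
  assert (S2 : sqrt (1 - (a / m)²) = Rabs b / m).
  { replace (1 - (a / m)²) with ((b / m)²).
    - rewrite sqrt_Rsqr_abs. unfold Rdiv. rewrite Rabs_mult, (Rabs_pos_eq (/ m)); auto.
      left. apply Rinv_0_lt_compat; auto.
    - unfold Rsqr. apply Rmult_eq_reg_r with (m * m); [field_simplify; [nra|lra|lra]|nra]. }
  destruct (Rle_dec 0 b) as [hb|hb].
  - exists (ln m, acos (a / m)). split; [|reflexivity]. unfold Cexp; cbn [fst snd].
    rewrite exp_ln, cos_acos, sin_acos, S2, Rabs_pos_eq by auto.
    apply injective_projections; cbn [fst snd]; field; lra.
  - exists (ln m, - acos (a / m)). split; [|reflexivity]. unfold Cexp; cbn [fst snd].
    rewrite exp_ln, cos_neg, sin_neg, cos_acos, sin_acos, S2, Rabs_left by (auto; lra).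
    apply injective_projections; cbn [fst snd]; field; lra.
Qed.

Lemma Csqrt_exists (w : C) : w <> 0 -> exists g, (g * g = w)%C.
Proof.
  intros Hw. destruct (Cexp_surjective w Hw) as [x [Hx _]].
  exists (Cexp (x * / 2)). rewrite <- Cexp_plus, <- Hx. f_equal. field.
Qed.

Lemma Cmult_eq_half (g : C) : g <> 0 -> (g * / (g + g) = / 2)%C.
Proof. intros H. replace (g + g)%C with (2 * g)%C by ring. field. auto. Qed.

(* Doubling the radius repeatedly must fail, since the point c is omitted. *)
Lemma inscribed_ball (U : C -> Prop) (w0 c : C) (r0 : R) : 0 < r0 ->
  (forall w, Cmod (w - w0) < r0 -> U w) -> ~ U c ->
  exists r, 0 < r /\ r <= Cmod (c - w0) /\ (forall w, Cmod (w - w0) < r -> U w) /\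
    exists a, ~ U a /\ Cmod (a - w0) < 2 * r.
Proof.
  intros Hr0 HU Hc. apply NNPP. intros N.
  assert (X : forall n, forall w, Cmod (w - w0) < 2 ^ n * r0 -> U w).
  { induction n as [|n IH].
    - intros w Hw. apply HU. simpl in Hw. lra.
    - intros w Hw. apply NNPP. intros Hn. apply N. exists (2 ^ n * r0).
      assert (0 < 2 ^ n) by (apply pow_lt; lra).
      split; [nra|]. split; [|split; auto].
      + apply Rnot_lt_le. intros L. apply Hc, IH, L.
      + exists w. split; auto. simpl in Hw. lra. }
  destruct (Pow_x_infinity 2) with (b := Cmod (c - w0) / r0 + 1) as [n Hn].
  { rewrite Rabs_pos_eq; lra. }
  apply Hc, (X n). specialize (Hn n (le_n n)). rewrite Rabs_pos_eq in Hn by (apply pow_le; lra).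
  apply Rge_le in Hn. apply Rmult_le_compat_r with (r := r0) in Hn; [|lra].
  replace ((Cmod (c - w0) / r0 + 1) * r0) with (Cmod (c - w0) + r0) in Hn by (field; lra). lra.
Qed.

(* The branch g of sqrt (f - a) has g/g(z0) in the right half-plane above the small disc of radius r, while
   f takes values there whenever g is close to - g(z0). Hence g omits a neighbourhood of - g(z0), and Cauchy's
   estimate applies to the bounded function g(z0)/(g + g(z0)). The constant 7000 exceeds
   2 * 2 * (11/3) * (64 * 64/9). *)
Lemma univalent_derivative_bounds (f df psi : C -> C) (z0 a : C) (rho r : R) : 0 < rho -> 0 < r ->
  (forall z, Cmod (z - z0) < rho -> cdiff f z (df z)) ->
  (forall z, Cmod (z - z0) < rho -> psi (f z) = z) ->
  (forall w, Cmod (w - f z0) < r -> Cmod (psi w - z0) < rho /\ f (psi w) = w /\ exists l, cdiff psi w l) ->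
  (forall z, Cmod (z - z0) < rho -> f z <> a) -> Cmod (a - f z0) < 2 * r ->
  r <= rho * Cmod (df z0) /\
  forall z, Cmod (z - z0) <= rho / 512 -> Cmod (df z) <= 7000 * r / rho.
Proof.
  intros Hrho Hr Hf Hpsif Hpsi Ha Har.
  assert (Z0 : Cmod (z0 - z0) < rho).
  { rewrite Cmod_self. exact Hrho. }
  set (w0 := f z0) in *.
  assert (W0 : Cmod (w0 - w0) < r).
  { rewrite Cmod_self. exact Hr. }
  assert (Hra : r <= Cmod (a - w0)).
  { apply Rnot_lt_le. intros L. destruct (Hpsi a L) as [h1 [h2 _]]. apply (Ha _ h1 h2). }
  split.
  { apply Rnot_lt_le. intros L.
    destruct (Hpsi w0 W0) as [_ [_ [m Hm]]].
    (* If r exceeded rho |f'(z0)|, a radius r' strictly between them would give |psi'(w0)| <= rho/r'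
       by Cauchy's estimate for the inverse, contradicting psi' f' = 1. *)
    set (r' := (r + rho * Cmod (df z0)) / 2).
    assert (Pd := Cmod_ge_0 (df z0)). assert (0 <= rho * Cmod (df z0)) by (apply Rmult_le_pos; lra).
    assert (Hr' : rho * Cmod (df z0) < r' < r) by (unfold r'; lra).
    assert (B : Cmod m <= rho / r').
    { apply (cauchy_estimate psi w0 m r r'); auto.
      - intros u Hu. apply Hpsi. auto.
      - lra.
      - intros u Hu. left. replace (psi w0) with z0 by (symmetry; apply Hpsif; auto).
        apply Hpsi. lra. }
    assert (E : (m * df z0)%C = 1).
    { apply (cdiff_unique (fun z => psi (f z)) z0).
      - apply (cdiff_comp psi f); [apply Hf; auto|exact Hm].
      - apply (cdiff_ext_loc (fun z => z) (fun z => psi (f z)) z0 1 rho); auto.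
        + intros u Hu. symmetry. apply Hpsif. auto.
        + apply cdiff_id. }
    apply (f_equal Cmod) in E. rewrite Cmod_mult, Cmod_1 in E.
    assert (1 <= rho / r' * Cmod (df z0)) by (rewrite <- E; apply Rmult_le_compat_r; lra).
    assert (rho / r' * Cmod (df z0) < 1).
    { apply Rmult_lt_reg_r with r'; [lra|].
      replace (rho / r' * Cmod (df z0) * r') with (rho * Cmod (df z0)) by (field; lra). lra. }
    lra. }
  assert (Hn0 : (w0 - a <> 0)%C) by (apply Cminus_neq_0; apply Ha; auto).
  destruct (Csqrt_exists _ Hn0) as [g0 Hg0].
  destruct (disc_sqrt (fun z => (f z - a)%C) df z0 g0 rho) as [g [Eg0 [Eg Dg]]]; auto.
  { intros u Hu. apply (cdiff_eq _ _ (df u - 0)%C); [|ring].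
    apply (cdiff_minus f (fun _ => a)); [auto|apply cdiff_const]. }
  { intros u Hu. apply Cminus_neq_0. auto. }
  assert (G0 : g0 <> 0). { intros E. apply Hn0. rewrite <- Hg0, E. ring. }
  assert (Pg0 := proj1 (Cmod_gt_0 _) G0).
  assert (Mg0 : Cmod g0 * Cmod g0 = Cmod (a - w0)).
  { rewrite <- Cmod_mult, Hg0. apply Cmod_minus_sym. }
  (* The quotient X = g(psi w)/g0 satisfies X^2 = 1 + (w - w0)/(w0 - a), which has positive real
     part because |w - w0| < r <= |a - w0|. Hence X never meets the imaginary axis, and it starts
     from 1 at w0. *)
  assert (RePos : forall w, Cmod (w - w0) < r -> 0 <= Re (g (psi w) * / g0)%C).
  { intros w Hw. apply Rnot_lt_le. intros Lneg.
    assert (InB : forall s, 0 <= s <= 1 -> Cmod (w0 + s * (w - w0) - w0) < r).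
    { intros s Hs. replace (w0 + s * (w - w0) - w0)%C with (s * (w - w0))%C by ring.
      rewrite Cmod_mult, Cmod_R, Rabs_pos_eq by lra. assert (P := Cmod_ge_0 (w - w0)). nra. }
    destruct (IVT_interv (fun s => - Re (g (psi (w0 + RtoC s * (w - w0))) * / g0)%C) 0 1) as [s [Hs Es]].
    - intros s Hs. apply continuity_pt_opp. apply continuity_pt_filterlim.
      assert (X : rcont (fun s => (g (psi (w0 + RtoC s * (w - w0))) * / g0)%C) s).
      { apply rcont_mult; [|apply rcont_const].
        apply (rcont_line (fun u => g (psi u))). apply (ccont_comp g psi).
        - destruct (Hpsi _ (InB s Hs)) as [_ [_ [m Hm]]]. apply (cdiff_ccont _ _ _ Hm).
        - destruct (Dg (psi (w0 + s * (w - w0)))%C) as [m Hm]; [apply Hpsi; auto|].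
          apply (cdiff_ccont _ _ _ Hm). }
      apply rcont_continuous in X.
      apply (continuous_comp (U := R_UniformSpace) (V := C_UniformSpace) (W := R_UniformSpace) _ fst) in X.
      + exact X.
      + apply continuous_fst.
    - lra.
    - replace (w0 + 0 * (w - w0))%C with w0 by ring.
      replace (psi w0) with z0 by (symmetry; apply Hpsif; auto). rewrite Eg0.
      replace (g0 * / g0)%C with (RtoC 1) by (field; auto). simpl. lra.
    - replace (w0 + 1 * (w - w0))%C with w by ring. lra.
    - set (ws := (w0 + s * (w - w0))%C) in *.
      set (X := (g (psi ws) * / g0)%C) in *.
      assert (EX : (X * X = 1 + (ws - w0) * / (w0 - a))%C).
      { unfold X. destruct (Hpsi ws (InB s Hs)) as [h1 [h2 _]].
        assert (Q := Eg (psi ws) h1). rewrite h2 in Q.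
        replace (g (psi ws) * / g0 * (g (psi ws) * / g0))%C
          with (g (psi ws) * g (psi ws) * / (g0 * g0))%C by (field; auto).
        rewrite Q, Hg0. field. auto. }
      assert (Re0 : Re X = 0) by lra.
      assert (Neg : Re (X * X)%C <= 0).
      { clearbody X. destruct X as [x1 x2]. unfold Re in *. simpl in *. rewrite Re0. nra. }
      rewrite EX in Neg.
      assert (Small : Cmod ((ws - w0) * / (w0 - a)) < 1).
      { rewrite Cmod_mult, Cmod_inv by auto. rewrite (Cmod_minus_sym w0 a).
        apply Rmult_lt_reg_r with (Cmod (a - w0)); [lra|].
        rewrite Rmult_assoc, Rinv_l, Rmult_1_r, Rmult_1_l by lra.
        eapply Rlt_le_trans; [apply InB; auto|exact Hra]. }
      assert (Q := Rabs_fst_le ((ws - w0) * / (w0 - a))%C).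
      unfold Re in Neg. simpl in Neg. simpl in Q. 
      match type of Q with Rabs ?y <= _ => set (yy := y) in * end.
      assert (Rabs yy < 1) by lra. apply Rabs_def2 in H. lra. }
  (* With G = g(z)/g0 one has f(z) - w0 = g0^2 (G + 1)(G - 1). If |G + 1| < 1/8 this is at most 3/8
     of |a - w0| < 2r, so f(z) falls in the small disc and [RePos] forces Re G >= 0, which is
     absurd. *)
  assert (Far : forall z, Cmod (z - z0) < rho -> Cmod g0 / 8 <= Cmod (g z + g0)).
  { intros z Hz. apply Rnot_lt_le. intros L.
    set (G := (g z * / g0)%C).
    assert (LG : Cmod (G + 1) < / 8).
    { unfold G. replace (g z * / g0 + 1)%C with ((g z + g0) * / g0)%C by (field; auto).
      rewrite Cmod_mult, Cmod_inv by auto. apply Rmult_lt_reg_r with (Cmod g0); auto.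
      rewrite Rmult_assoc, Rinv_l, Rmult_1_r by lra. lra. }
    assert (LG2 : Cmod (G - 1) <= 3).
    { replace (G - 1)%C with ((G + 1) + - (2))%C by ring.
      eapply Rle_trans; [apply Cmod_triangle|]. rewrite Cmod_opp, Cmod_R, Rabs_pos_eq; lra. }
    assert (Hw : Cmod (f z - w0) < r).
    { replace (f z - w0)%C with (g0 * g0 * ((G + 1) * (G - 1)))%C.
      - rewrite !Cmod_mult, Mg0. assert (P := Cmod_ge_0 (G + 1)). assert (P' := Cmod_ge_0 (G - 1)).
        assert (Cmod (G + 1) * Cmod (G - 1) <= / 8 * 3) by (apply Rmult_le_compat; lra).
        apply Rle_lt_trans with (Cmod (a - w0) * (/ 8 * 3)); [apply Rmult_le_compat_l|]; lra.
      - unfold G. replace (f z - w0)%C with ((f z - a) - (w0 - a))%C by ring.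
        rewrite <- (Eg z Hz), <- Hg0. field. auto. }
    assert (Q := RePos (f z) Hw). rewrite (Hpsif z Hz) in Q. fold G in Q.
    assert (Q' := Rabs_fst_le (G + 1)%C). unfold Re in Q.
    change (fst (G + 1)%C) with (fst G + 1) in Q'.
    assert (Q2 : Rabs (fst G + 1) < 1) by lra. apply Rabs_def2 in Q2. lra. }
  set (H := fun z => (g0 * / (g z + g0))%C).
  assert (Nz : forall z, Cmod (z - z0) < rho -> (g z + g0 <> 0)%C).
  { intros z Hz. apply Cmod_gt_0. assert (Q := Far z Hz). lra. }
  assert (HB : forall z, Cmod (z - z0) < rho -> Cmod (H z) <= 8).
  { intros z Hz. unfold H. rewrite Cmod_mult, Cmod_inv by auto.
    assert (Q := Far z Hz). apply Rmult_le_reg_r with (Cmod (g z + g0)); [lra|].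
    rewrite Rmult_assoc, Rinv_l, Rmult_1_r by lra. lra. }
  assert (HD : forall z, Cmod (z - z0) < rho -> exists l, cdiff H z l).
  { intros z Hz. destruct (Dg z Hz) as [m Hm]. eexists.
    apply (cdiff_mult (fun _ => g0) (fun z => (/ (g z + g0))%C)); [apply cdiff_const|].
    apply cdiff_inv; auto. apply (cdiff_plus g (fun _ => g0)); [exact Hm|apply cdiff_const]. }
  (* |H| <= 8 bounds the oscillation by 16, and the circle of radius rho/4 around z stays in the
     disc: 16/(rho/4) = 64/rho. *)
  assert (HE : forall z l, Cmod (z - z0) <= rho / 512 -> cdiff H z l -> Cmod l <= 64 / rho).
  { intros z l Hz Hl. replace (64 / rho) with (16 / (rho / 4)) by (field; lra).
    apply (cauchy_estimate H z l (rho / 2) (rho / 4)); auto.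
    - intros u Hu. apply HD. assert (T := Cmod_triangle_sub u z z0). lra.
    - lra.
    - intros u Hu. assert (T := Cmod_triangle_sub u z z0).
      replace (H u - H z)%C with (H u + - H z)%C by ring.
      eapply Rle_trans; [apply Cmod_triangle|]. rewrite Cmod_opp.
      assert (B1 := HB u ltac:(lra)). assert (B2 := HB z ltac:(lra)). lra. }
  intros z Hz.
  assert (Hz' : Cmod (z - z0) < rho) by lra.
  (* The radius rho/512 is chosen for this step: (64/rho)(rho/512) = 1/8. So |H| stays above 3/8 and
     g + g0 is bounded by 8/3 of |g0|. *)
  assert (Hnear : Cmod (H z - / 2) <= / 8).
  { assert (E : H z0 = (/ 2)%C :> C).
    { unfold H. rewrite Eg0. apply Cmult_eq_half. auto. }
    rewrite <- E.
    set (dH := fun u => epsilon (inhabits (RtoC 0)) (fun l => cdiff H u l)).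
    assert (HdH : forall u, Cmod (u - z0) < rho -> cdiff H u (dH u)).
    { intros u Hu. apply epsilon_spec. auto. }
    replace z with (z0 + (z - z0))%C at 1 by ring.
    assert (In : forall s, 0 <= s <= 1 -> Cmod (z0 + s * (z - z0) - z0) <= rho / 512).
    { intros s Hs. replace (z0 + s * (z - z0) - z0)%C with (s * (z - z0))%C by ring.
      rewrite Cmod_mult, Cmod_R, Rabs_pos_eq by lra. assert (P := Cmod_ge_0 (z - z0)). nra. }
    eapply Rle_trans.
    - apply (mean_value_bound H dH z0 (z - z0) (64 / rho)).
      + intros s Hs. apply HdH. specialize (In s Hs). lra.
      + intros s Hs. specialize (In s Hs). apply (HE _ _ In). apply HdH. lra.
    - apply Rle_trans with (64 / rho * (rho / 512)).
      + apply Rmult_le_compat_l; auto. left. apply Rdiv_lt_0_compat; lra.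
      + right. field. lra. }
  assert (Hlow : 3 / 8 <= Cmod (H z)).
  { assert (T := Cmod_sub_le (/ 2)%C (H z)). rewrite Cmod_minus_sym in T.
    assert (E2 : Cmod (/ 2) = / 2).
    { rewrite Cmod_inv, Cmod_R, Rabs_pos_eq; [reflexivity|lra|].
      intros E. apply RtoC_inj in E. lra. }
    rewrite E2 in T. lra. }
  destruct (Dg z Hz') as [dg Hdg]. set (S := (g z + g0)%C).
  assert (NS : S <> 0) by (apply Nz; auto). assert (PS := proj1 (Cmod_gt_0 _) NS).
  assert (BS : Cmod S <= 8 / 3 * Cmod g0).
  { unfold H in Hlow. fold S in Hlow. rewrite Cmod_mult, Cmod_inv in Hlow by auto.
    apply Rmult_le_compat_r with (r := Cmod S) in Hlow; [|lra].
    rewrite Rmult_assoc, Rinv_l in Hlow by lra. lra. }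
  (* The bound on H' = -g0 g'/(g + g0)^2 is converted into one on g'; 64/9 is the square of 8/3. *)
  assert (Bdg : Cmod dg <= 64 / rho * (64 / 9) * Cmod g0).
  { assert (BH : Cmod (- (g0 * dg) / (S * S)) <= 64 / rho).
    { apply (HE z); auto. apply (cdiff_eq _ _ (0 * / S + g0 * (- (dg + 0) / (S * S)))%C); [|field; auto].
      apply (cdiff_mult (fun _ => g0) (fun u => (/ (g u + g0))%C)); [apply cdiff_const|].
      apply (cdiff_inv (fun u => (g u + g0)%C)); auto.
      apply (cdiff_plus g (fun _ => g0)); [exact Hdg|apply cdiff_const]. }
    rewrite Cmod_div, Cmod_opp, !Cmod_mult in BH by (apply Cmult_neq_0; auto).
    assert (P64 : 0 < 64 / rho) by (apply Rdiv_lt_0_compat; lra).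
    apply Rmult_le_compat_r with (r := Cmod S * Cmod S) in BH; [|nra].
    unfold Rdiv at 1 in BH. rewrite Rmult_assoc, Rinv_l, Rmult_1_r in BH by nra.
    apply Rmult_le_reg_l with (Cmod g0); auto. eapply Rle_trans; [exact BH|].
    replace (Cmod g0 * (64 / rho * (64 / 9) * Cmod g0)) with (64 / rho * ((8 / 3 * Cmod g0) * (8 / 3 * Cmod g0))) by (field; lra).
    apply Rmult_le_compat_l; [lra|]. apply Rmult_le_compat; lra. }
  assert (Bg : Cmod (g z) <= 11 / 3 * Cmod g0).
  { replace (g z) with (S + - g0)%C by (unfold S; ring).
    eapply Rle_trans; [apply Cmod_triangle|]. rewrite Cmod_opp. lra. }
  assert (Edf : df z = (2 * (g z * dg))%C).
  { apply (cdiff_unique f z); [apply Hf; auto|].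
    apply (cdiff_ext_loc (fun u => (g u * g u + a)%C) f z _ (rho - Cmod (z - z0))); [lra| |].
    - intros u Hu. assert (T := Cmod_triangle_sub u z z0). rewrite Eg by lra. ring.
    - apply (cdiff_eq _ _ (dg * g z + g z * dg + 0)%C); [|ring].
      apply (cdiff_plus (fun u => (g u * g u)%C) (fun _ => a)); [|apply cdiff_const].
      apply cdiff_mult; auto. }
  rewrite Edf, !Cmod_mult, Cmod_R, Rabs_pos_eq by lra.
  apply Rle_trans with (2 * ((11 / 3 * Cmod g0) * (64 / rho * (64 / 9) * Cmod g0))).
  { apply Rmult_le_compat_l; [lra|]. apply Rmult_le_compat; auto; apply Cmod_ge_0. }
  replace (2 * (11 / 3 * Cmod g0 * (64 / rho * (64 / 9) * Cmod g0)))
    with (2 * (11 / 3 * (64 * 64 / 9)) * (Cmod g0 * Cmod g0) / rho) by (field; lra).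
  rewrite Mg0. apply Rmult_le_compat_r; [left; apply Rinv_0_lt_compat; lra|]. lra.
Qed.

(** * Conformal tracts *)

(** What both cases of class D provide for a single tract, written with [cdiff]. *)
Definition tract (Om : C -> Prop) (tau phi dphi : C -> C) : Prop :=
  (forall xi, 0 < fst xi -> Om (phi xi) /\ tau (phi xi) = xi) /\
  (forall z, Om z -> 0 < fst (tau z) /\ phi (tau z) = z) /\
  (forall z, Om z -> exists l, cdiff tau z l) /\
  openC Om /\
  (forall z, Om z -> 1 < Cmod z) /\
  (forall xi, 0 < fst xi -> cdiff phi xi (dphi xi)).

(** The modulus of phi'/phi. Multiplying phi by a constant leaves it unchanged, and its reciprocal
    at tau(z) is |f'(z)|_1. *)
Definition logder (phi dphi : C -> C) (xi : C) : R := Cmod (dphi xi) / Cmod (phi xi).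

(** The univalent bounds are applied to [phi] on the disc around xi that touches the imaginary axis.
    Its image omits 0, so the inscribed radius r is at most |phi(xi)|; then |phi'| x <= 7000 r gives
    the second claim, and r <= x |phi'(xi)| gives the third. *)
Lemma tract_bounds (Om : C -> Prop) (tau phi dphi : C -> C) (xi : C) :
  tract Om tau phi dphi -> 0 < fst xi ->
  0 < Cmod (dphi xi) /\
  Cmod (dphi xi) * fst xi <= 7000 * Cmod (phi xi) /\
  forall xi', Cmod (xi' - xi) <= fst xi / 512 -> Cmod (dphi xi') <= 7000 * Cmod (dphi xi).
Proof.
  intros [T1 [T2 [T3 [T4 [T5 T6]]]]] Hxi. set (x := fst xi) in *.
  assert (InH : forall u, Cmod (u - xi) < x -> 0 < fst u).
  { intros u Hu. assert (P := Rabs_fst_le (u - xi)%C).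
    change (fst (u - xi)%C) with (fst u + - x) in P.
    assert (Q : Rabs (fst u + - x) < x) by lra. apply Rabs_def2 in Q. lra. }
  destruct (T1 xi Hxi) as [Oxi Etau].
  destruct (T3 _ Oxi) as [m Hm].
  destruct (cdiff_ccont _ _ _ Hm x Hxi) as [d [Hd Kd]].
  destruct (T4 _ Oxi) as [e [He Ke]].
  (* [U] is the image of that disc under [phi], described through [tau] so that membership of a ball
     can be checked pointwise. *)
  set (U := fun w => Om w /\ Cmod (tau w - xi) < x).
  destruct (inscribed_ball U (phi xi) 0 (Rmin d e)) as [r [Hr [Hr0 [HU [a [Ha Har]]]]]].
  { apply Rmin_pos; auto. }
  { intros w Hw. split.
    - apply Ke. eapply Rlt_le_trans; [exact Hw|apply Rmin_r].
    - rewrite <- Etau at 1. apply Kd. eapply Rlt_le_trans; [exact Hw|apply Rmin_l]. }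
  { intros [h _]. apply T5 in h. rewrite Cmod_0 in h. lra. }
  replace (0 - phi xi)%C with (- phi xi)%C in Hr0 by ring. rewrite Cmod_opp in Hr0.
  destruct (univalent_derivative_bounds phi dphi tau xi a x r) as [B1 B2]; auto.
  { intros z Hz. apply T1. auto. }
  { intros w Hw. destruct (HU w Hw) as [h1 h2]. split; auto. split; auto. apply T2; auto. }
  { intros z Hz E. apply Ha. rewrite <- E. destruct (T1 z (InH z Hz)) as [h1 h2].
    split; auto. rewrite h2. exact Hz. }
  assert (Pos : 0 < Cmod (dphi xi)).
  { apply Rnot_le_lt. intros L. assert (Z := Cmod_ge_0 (dphi xi)).
    assert (Cmod (dphi xi) = 0) by lra. rewrite H, Rmult_0_r in B1. lra. }
  split; [exact Pos|]. split.
  - assert (B3 := B2 xi). rewrite Cmod_self in B3.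
    specialize (B3 ltac:(lra)).
    apply Rmult_le_compat_r with (r := x) in B3; [|lra].
    replace (7000 * r / x * x) with (7000 * r) in B3 by (field; lra). lra.
  - intros xi' Hxi'. eapply Rle_trans; [apply B2; exact Hxi'|].
    apply Rmult_le_reg_r with x; auto. replace (7000 * r / x * x) with (7000 * r) by (field; lra). lra.
Qed.

Lemma tract_phi_gt_1 (Om : C -> Prop) (tau phi dphi : C -> C) (xi : C) :
  tract Om tau phi dphi -> 0 < fst xi -> 1 < Cmod (phi xi).
Proof. intros [T1 [_ [_ [_ [T5 _]]]]] H. apply T5, T1, H. Qed.

Lemma logder_pos (Om : C -> Prop) (tau phi dphi : C -> C) (xi : C) :
  tract Om tau phi dphi -> 0 < fst xi -> 0 < logder phi dphi xi.
Proof.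
  intros T H. assert (P := tract_phi_gt_1 _ _ _ _ _ T H).
  apply Rdiv_lt_0_compat; [apply (tract_bounds _ _ _ _ _ T H)|lra].
Qed.

Lemma logder_le (Om : C -> Prop) (tau phi dphi : C -> C) (xi : C) :
  tract Om tau phi dphi -> 0 < fst xi -> logder phi dphi xi <= 7000 / fst xi.
Proof.
  intros T H. assert (P := tract_phi_gt_1 _ _ _ _ _ T H).
  destruct (tract_bounds _ _ _ _ _ T H) as [_ [B _]]. unfold logder.
  apply Rmult_le_reg_r with (Cmod (phi xi) * fst xi); [nra|].
  replace (Cmod (dphi xi) / Cmod (phi xi) * (Cmod (phi xi) * fst xi)) with (Cmod (dphi xi) * fst xi) by (field; lra).
  replace (7000 / fst xi * (Cmod (phi xi) * fst xi)) with (7000 * Cmod (phi xi)) by (field; lra).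
  exact B.
Qed.

(** The radius x/10^8 keeps phi within half of its modulus, since 7000 * 7000/10^8 = 0.49. The
    denominator then loses at most a factor 2 and the numerator gains at most 7000. *)
Lemma logder_local (Om : C -> Prop) (tau phi dphi : C -> C) (xi xi' : C) :
  tract Om tau phi dphi -> 0 < fst xi -> Cmod (xi' - xi) <= fst xi / 10 ^ 8 ->
  logder phi dphi xi' <= 14000 * logder phi dphi xi.
Proof.
  intros T H Hd. assert (P := tract_phi_gt_1 _ _ _ _ _ T H).
  destruct (tract_bounds _ _ _ _ _ T H) as [B0 [B1 B2]].
  assert (Hd' : Cmod (xi' - xi) <= fst xi / 512) by lra.
  assert (D : Cmod (phi xi' - phi xi) <= Cmod (phi xi) / 2).
  { replace xi' with (xi + (xi' - xi))%C at 1 by ring.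
    assert (In : forall s, 0 <= s <= 1 -> Cmod (xi + s * (xi' - xi) - xi) <= Cmod (xi' - xi)).
    { intros s Hs. replace (xi + s * (xi' - xi) - xi)%C with (s * (xi' - xi))%C by ring.
      rewrite Cmod_mult, Cmod_R, Rabs_pos_eq by lra. assert (Z := Cmod_ge_0 (xi' - xi)). nra. }
    eapply Rle_trans.
    - apply (mean_value_bound phi dphi xi (xi' - xi) (7000 * Cmod (dphi xi))).
      + intros s Hs. apply T. specialize (In s Hs).
        assert (Z := Rabs_fst_le (xi + s * (xi' - xi) - xi)%C).
        change (fst (xi + s * (xi' - xi) - xi)%C) with (fst (xi + s * (xi' - xi))%C + - fst xi) in Z.
        assert (Q : Rabs (fst (xi + s * (xi' - xi))%C + - fst xi) < fst xi) by lra.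
        apply Rabs_def2 in Q. lra.
      + intros s Hs. apply B2. specialize (In s Hs). lra.
    - apply Rle_trans with (7000 * Cmod (dphi xi) * (fst xi / 10 ^ 8)).
      + apply Rmult_le_compat_l; lra.
      + lra. }
  assert (P' : Cmod (phi xi) / 2 <= Cmod (phi xi')).
  { assert (Z := Cmod_sub_le (phi xi) (phi xi')). rewrite Cmod_minus_sym in Z. lra. }
  specialize (B2 xi' Hd'). unfold logder.
  apply Rmult_le_reg_r with (Cmod (phi xi')); [lra|].
  replace (Cmod (dphi xi') / Cmod (phi xi') * Cmod (phi xi')) with (Cmod (dphi xi')) by (field; lra).
  apply Rle_trans with (14000 * (Cmod (dphi xi) / Cmod (phi xi)) * (Cmod (phi xi) / 2)).
  - replace (14000 * (Cmod (dphi xi) / Cmod (phi xi)) * (Cmod (phi xi) / 2))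
      with (7000 * Cmod (dphi xi)) by (field; lra). exact B2.
  - apply Rmult_le_compat_l; auto. apply Rmult_le_pos; [lra|]. left. apply Rdiv_lt_0_compat; lra.
Qed.

Lemma Cminus_eq_0 (u z : C) : (u - z = 0)%C -> u = z.
Proof. intros E. replace u with ((u - z) + z)%C by ring. rewrite E. ring. Qed.

(** The segment from xi to xi' stays in Re >= a by convexity and is cut into steps of length at most
    a/10^8. Their number depends on a and L alone, hence so does K. *)
Lemma logder_harnack (Om : C -> Prop) (tau phi dphi : C -> C) (a L : R) :
  tract Om tau phi dphi -> 0 < a ->
  exists K, 1 <= K /\ forall xi xi', a <= fst xi -> a <= fst xi' -> Cmod (xi' - xi) <= L ->
    logder phi dphi xi' <= K * logder phi dphi xi.
Proof.
  intros T Ha.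
  assert (Chain : forall n xi xi', a <= fst xi -> a <= fst xi' ->
     Cmod (xi' - xi) <= INR n * (a / 10 ^ 8) -> logder phi dphi xi' <= 14000 ^ n * logder phi dphi xi).
  { induction n as [|n IH]; intros xi xi' H1 H2 H3.
    - simpl in H3. rewrite Rmult_0_l in H3. assert (Z := Cmod_ge_0 (xi' - xi)).
      assert (E : (xi' - xi = 0)%C) by (apply Cmod_eq_0; lra).
      apply Cminus_eq_0 in E. rewrite E. simpl. lra.
    - rewrite S_INR in H3. assert (Hn := pos_INR n).
      set (t := / (INR n + 1)). assert (Ht : 0 < t) by (apply Rinv_0_lt_compat; lra).
      assert (Et : t * (INR n + 1) = 1) by (unfold t; field; lra).
      assert (Ht1 : t <= 1) by nra.
      set (eta := (xi + t * (xi' - xi))%C).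
      assert (Heta : a <= fst eta).
      { unfold eta. simpl. nra. }
      assert (D1 : Cmod (eta - xi) <= fst xi / 10 ^ 8).
      { unfold eta. replace (xi + t * (xi' - xi) - xi)%C with (t * (xi' - xi))%C by ring.
        rewrite Cmod_mult, Cmod_R, Rabs_pos_eq by lra.
        apply Rle_trans with (t * ((INR n + 1) * (a / 10 ^ 8))).
        - apply Rmult_le_compat_l; lra.
        - rewrite <- Rmult_assoc, Et. lra. }
      assert (D2 : Cmod (xi' - eta) <= INR n * (a / 10 ^ 8)).
      { unfold eta. replace (xi' - (xi + t * (xi' - xi)))%C with (RtoC (1 - t) * (xi' - xi))%C
          by (rewrite RtoC_minus; ring).
        rewrite Cmod_mult, Cmod_R, Rabs_pos_eq by lra.
        apply Rle_trans with ((1 - t) * ((INR n + 1) * (a / 10 ^ 8))).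
        - apply Rmult_le_compat_l; lra.
        - replace ((1 - t) * ((INR n + 1) * (a / 10 ^ 8)))
            with ((INR n + 1 - t * (INR n + 1)) * (a / 10 ^ 8)) by ring. rewrite Et. right. ring. }
      eapply Rle_trans; [apply (IH eta); auto|].
      simpl. rewrite (Rmult_comm 14000), Rmult_assoc.
      apply Rmult_le_compat_l; [apply pow_le; lra|].
      apply (logder_local Om tau); auto. lra. }
  destruct (INR_unbounded (L / (a / 10 ^ 8))) as [n Hn].
  exists (14000 ^ n). split; [apply pow_R1_Rle; lra|].
  intros xi xi' H1 H2 H3. apply Chain; auto. eapply Rle_trans; [exact H3|].
  assert (Hp : 0 < a / 10 ^ 8) by (apply Rdiv_lt_0_compat; lra).
  apply Rgt_lt in Hn. apply Rmult_lt_compat_r with (r := a / 10 ^ 8) in Hn; auto.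
  unfold Rdiv at 1 in Hn. rewrite Rmult_assoc, Rinv_l, Rmult_1_r in Hn; lra.
Qed.

(** * Real powers and continuity on vertical lines *)

Lemma Rpower_pos (a t : R) : 0 < Rpower a t.
Proof. apply exp_pos. Qed.

Lemma Rpower_le_base (a b t : R) : 0 < a -> a <= b -> 0 <= t -> Rpower a t <= Rpower b t.
Proof. intros Ha Hab Ht. apply Rle_Rpower_l; auto. Qed.

Lemma continuous_mult_const (c : R) (f : R -> R) (x : R) :
  continuous f x -> continuous (fun y => c * f y) x.
Proof. apply (continuous_scal_r (K := R_AbsRing) (V := R_NormedModule) c f). Qed.

Lemma continuous_scale_arg (c : R) (f : R -> R) (x : R) :
  continuous f (c * x) -> continuous (fun y => f (c * y)) x.
Proof.
  intros H. apply (continuous_comp (fun y => c * y) f); [|exact H].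
  apply (continuous_mult_const c (fun y => y)). apply continuous_id.
Qed.

Lemma Rpower_continuous (f : R -> R) (t s : R) : 0 < f s -> continuous f s ->
  continuous (fun u => Rpower (f u) t) s.
Proof.
  intros Hf Hc. unfold Rpower.
  apply (continuous_comp (fun u => t * ln (f u)) exp).
  - apply (continuous_mult_const t (fun u => ln (f u))).
    apply (continuous_comp f ln); auto. apply continuous_ln; auto.
  - apply continuous_exp.
Qed.

Lemma vertical_line (x y : R) : (x, y) = ((x, 0) + RtoC y * (0, 1))%C :> C.
Proof. apply injective_projections; simpl; ring. Qed.

Lemma Rabs_Cmod_sub (a b : C) : Rabs (Cmod a - Cmod b) <= Cmod (a - b).
Proof.
  apply Rabs_le. assert (A := Cmod_sub_le a b).
  assert (B := Cmod_sub_le b a). rewrite Cmod_minus_sym in B. lra.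
Qed.

Lemma continuous_Cmod_vertical (f : C -> C) (x y : R) : ccont f (x, y) ->
  continuous (fun s => Cmod (f (x, s))) y.
Proof.
  intros H. apply filterlim_locally. intros [e He]. rewrite vertical_line in H.
  destruct (rcont_line _ _ _ _ H e He) as [d [Hd K]].
  exists (mkposreal d Hd). intros u Hu. specialize (K u Hu). rewrite <- !vertical_line in K.
  change (Rabs (Cmod (f (x, u)) - Cmod (f (x, y))) < e).
  exact (Rle_lt_trans _ _ _ (Rabs_Cmod_sub _ _) K).
Qed.

Lemma dphi_continuous (Om : C -> Prop) (tau phi dphi : C -> C) (xi : C) :
  tract Om tau phi dphi -> 0 < fst xi -> ccont dphi xi.
Proof.
  intros T H. apply (derivative_continuous phi dphi xi (fst xi)); auto.
  intros u Hu. apply T. assert (P := Rabs_fst_le (u - xi)%C).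
  change (fst (u - xi)%C) with (fst u + - fst xi) in P.
  assert (Q : Rabs (fst u + - fst xi) < fst xi) by lra. apply Rabs_def2 in Q. lra.
Qed.

Lemma logder_continuous (Om : C -> Prop) (tau phi dphi : C -> C) (x y : R) :
  tract Om tau phi dphi -> 0 < x -> continuous (fun s => logder phi dphi (x, s)) y.
Proof.
  intros T H. unfold logder.
  assert (P : 1 < Cmod (phi (x, y))) by (apply (tract_phi_gt_1 Om tau phi dphi); auto).
  apply (continuous_mult (K := R_AbsRing) (fun s => Cmod (dphi (x, s))) (fun s => / Cmod (phi (x, s)))).
  - apply continuous_Cmod_vertical. apply (dphi_continuous Om tau phi); auto.
  - apply continuous_comp with (f := fun s => Cmod (phi (x, s))) (g := Rinv).
    + apply continuous_Cmod_vertical. apply (cdiff_ccont _ _ (dphi (x, y))). apply T. auto.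
    + apply continuous_Rinv. lra.
Qed.

(** * Phragmen-Lindelof and power sums *)

(* The half-plane is mapped to the unit disk; the factor (1 + z)/(1 + z + k (1 - z)) damps the
   boundary point -1 corresponding to infinity. *)
Lemma phragmen_lindelof (Q : C -> C) (A B c : R) : 0 < c -> 0 < B ->
  (forall xi, 1 < fst xi -> exists l, cdiff Q xi l) ->
  (forall xi, 1 < fst xi -> Cmod (Q xi) <= A) ->
  (forall xi, 1 < fst xi < 1 + c -> Cmod (Q xi) <= B) ->
  forall xi, 1 < fst xi -> Cmod (Q xi) <= B.
Proof.
  intros Hc HB HQ HA HBd xi Hxi.
  assert (A0 : 0 <= A) by (eapply Rle_trans; [apply Cmod_ge_0|apply (HA xi Hxi)]).
  set (a := fst xi - 1). set (p := (1, snd xi) : C).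
  assert (Ha : 0 < a) by (unfold a; lra).
  (* This Moebius map sends the unit disc into Re > 1, the point 0 to xi and the boundary point -1
     to infinity. *)
  set (M := fun z => (p + a * ((1 - z) * / (1 + z)))%C).
  assert (N1 : forall z, Cmod z < 1 -> (1 + z <> 0)%C).
  { intros z Hz E. assert (Z : z = (- (1))%C) by (replace z with ((1 + z) - 1)%C by ring; rewrite E; ring).
    rewrite Z, Cmod_opp, Cmod_1 in Hz. lra. }
  assert (Sq : forall z, Cmod z * Cmod z = fst z * fst z + snd z * snd z).
  { intros z. unfold Cmod. rewrite sqrt_sqrt; [ring|]. nra. }
  assert (MRe : forall z, Cmod z < 1 ->
     fst (M z) - 1 = a * (1 - Cmod z * Cmod z) / (Cmod (1 + z) * Cmod (1 + z))).
  { intros z Hz. assert (P := proj1 (Cmod_gt_0 _) (N1 z Hz)).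
    rewrite (Sq (1 + z)%C) in *.
    assert (P2 : 0 < Cmod (1 + z) * Cmod (1 + z)) by nra. rewrite (Sq (1 + z)%C) in P2.
    rewrite (Sq z). destruct z as [u v]. unfold M, p; simpl in *. field_simplify; nra. }
  assert (MH : forall z, Cmod z < 1 -> 1 < fst (M z)).
  { intros z Hz. assert (P := proj1 (Cmod_gt_0 _) (N1 z Hz)). assert (P' := Cmod_ge_0 z).
    assert (0 < fst (M z) - 1); [|lra]. rewrite MRe by auto.
    apply Rdiv_lt_0_compat; [apply Rmult_lt_0_compat; nra|nra]. }
  assert (Main : forall k, 0 < k -> Cmod (Q xi) <= B * (1 + k)).
  { intros k Hk.
    (* The square of the denominator is |1 + z|^2 + k^2 |1 - z|^2 + 2k(1 - |z|^2), so either of the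
       first two terms is a lower bound. *)
    assert (Den : forall z, Cmod z < 1 -> Cmod (1 + z) <= Cmod (1 + z + k * (1 - z)) /\
        k * Cmod (1 - z) <= Cmod (1 + z + k * (1 - z))).
    { intros z Hz. assert (S1 := Sq z). assert (S2 := Sq (1 + z)%C). assert (S3 := Sq (1 - z)%C).
      assert (S4 := Sq (1 + z + k * (1 - z))%C). destruct z as [u v]. simpl in S1, S2, S3, S4.
      set (x1 := Cmod (u, v)) in *. set (x2 := Cmod (1 + (u, v))) in *.
      set (x3 := Cmod (1 - (u, v))) in *. set (x4 := Cmod (1 + (u, v) + k * (1 - (u, v)))) in *.
      assert (P1 : 0 <= x1) by apply Cmod_ge_0. assert (P2 : 0 <= x2) by apply Cmod_ge_0.
      assert (P3 : 0 <= x3) by apply Cmod_ge_0. assert (P4 : 0 <= x4) by apply Cmod_ge_0.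
      assert (E4 : x4 * x4 = x2 * x2 + k * k * (x3 * x3) + 2 * k * (1 - x1 * x1)).
      { rewrite S4, S2, S3, S1. ring. }
      assert (G : 0 <= 2 * k * (1 - x1 * x1)) by (apply Rmult_le_pos; nra).
      assert (G2 : 0 <= k * k * (x3 * x3)) by (apply Rmult_le_pos; nra).
      split.
      - apply Rsqr_incr_0_var; auto. unfold Rsqr. lra.
      - apply Rsqr_incr_0_var; auto. unfold Rsqr. nra. }
    assert (DenN : forall z, Cmod z < 1 -> (1 + z + k * (1 - z) <> 0)%C).
    { intros z Hz. apply Cmod_gt_0. assert (P := proj1 (Cmod_gt_0 _) (N1 z Hz)).
      destruct (Den z Hz). lra. }
    set (W := fun z => (Q (M z) * ((1 + z) * / (1 + z + k * (1 - z))))%C).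
    assert (E0 : Q xi = (W 0 * (1 + k))%C).
    { unfold W. replace (M 0) with xi.
      - field. intros E. apply (f_equal fst) in E. simpl in E. lra.
      - unfold M, p, a. destruct xi as [x y]. replace ((1 - 0) * / (1 + 0))%C with (RtoC 1) by field.
        apply injective_projections; simpl; ring. }
    assert (BW : Cmod (W 0) <= B).
    (* On the circle |z| = 1 - e: where |1 + z| <= eta the damping makes the crude bound [A] at most
       A eta/k <= B; elsewhere Re(M z) - 1 <= 2ae/eta^2 < c, so the bound of the strip applies. *)
    { set (eta := Rmin 1 (k * B / (A + 1))).
      assert (He : 0 < eta).
      { apply Rmin_pos; [lra|]. apply Rdiv_lt_0_compat; nra. }
      assert (He1 : eta <= 1) by apply Rmin_l.
      assert (He2 : eta * A <= k * B).
      { assert (X : eta <= k * B / (A + 1)) by apply Rmin_r.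
        apply Rmult_le_compat_r with (r := A + 1) in X; [|lra].
        replace (k * B / (A + 1) * (A + 1)) with (k * B) in X by (field; lra). nra. }
      set (e := Rmin (/ 2) (c * (eta * eta) / (4 * a))).
      assert (Hep : 0 < e).
      { apply Rmin_pos; [lra|]. apply Rdiv_lt_0_compat; [|lra]. apply Rmult_lt_0_compat; nra. }
      assert (Hep1 : e <= / 2) by apply Rmin_l.
      assert (Hep2 : 2 * a * e < c * (eta * eta)).
      { assert (X : e <= c * (eta * eta) / (4 * a)) by apply Rmin_r.
        apply Rmult_le_compat_r with (r := 4 * a) in X; [|lra].
        replace (c * (eta * eta) / (4 * a) * (4 * a)) with (c * (eta * eta)) in X by (field; lra).
        assert (0 < c * (eta * eta)) by (apply Rmult_lt_0_compat; nra). nra. }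
      apply (max_modulus_center W 0 1 (1 - e) B).
      - intros z Hz. replace (z - 0)%C with z in Hz by ring.
        destruct (HQ (M z) (MH z Hz)) as [l Hl]. 
        assert (D1 : forall y, cdiff (fun z => (1 + z)%C) y (0 + 1)).
        { intros y. apply (cdiff_plus (fun _ => RtoC 1)); [apply cdiff_const|apply cdiff_id]. }
        assert (D2 : forall y, cdiff (fun z => (1 - z)%C) y (0 - 1)).
        { intros y. apply (cdiff_minus (fun _ => RtoC 1) (fun z => z)); [apply cdiff_const|apply cdiff_id]. }
        eexists. apply cdiff_mult.
        + apply (cdiff_comp Q M); [|exact Hl].
          apply (cdiff_plus (fun _ => p)); [apply cdiff_const|].
          apply (cdiff_mult (fun _ => RtoC a)); [apply cdiff_const|].
          apply (cdiff_mult (fun z => (1 - z)%C)); [apply D2|].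
          apply (cdiff_inv (fun z => (1 + z)%C)); [apply D1|auto].
        + apply (cdiff_mult (fun z => (1 + z)%C)); [apply D1|].
          apply (cdiff_inv (fun z => (1 + z + k * (1 - z))%C)); [|auto].
          apply (cdiff_plus (fun z => (1 + z)%C)); [apply D1|].
          apply (cdiff_mult (fun _ => RtoC k)); [apply cdiff_const|apply D2].
      - lra.
      - intros z Hz. replace (z - 0)%C with z in Hz by ring.
        assert (Hz1 : Cmod z < 1) by lra.
        assert (P := proj1 (Cmod_gt_0 _) (N1 z Hz1)).
        destruct (Den z Hz1) as [Den1 Den2].
        unfold W. rewrite !Cmod_mult, Cmod_inv by auto.
        set (d1 := Cmod (1 + z)) in *. set (d2 := Cmod (1 + z + k * (1 - z))) in *.
        assert (Pd2 : 0 < d2) by lra.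
        destruct (Rle_lt_dec d1 eta) as [Hs|Hs].
        + assert (H1z : 1 <= Cmod (1 - z)).
          { assert (T := Cmod_sub_le 2 (1 - z)%C). rewrite Cmod_R, Rabs_pos_eq in T by lra.
            replace (2 - (1 - z))%C with (1 + z)%C in T by ring. fold d1 in T. lra. }
          assert (Hd2 : k <= d2) by nra.
          apply Rle_trans with (A * (eta * / k)).
          * apply Rmult_le_compat; [apply Cmod_ge_0| |apply HA; auto|].
            -- apply Rmult_le_pos; [lra|]. left. apply Rinv_0_lt_compat; lra.
            -- apply Rmult_le_compat; try lra; [left; apply Rinv_0_lt_compat; lra|].
               apply Rinv_le_contravar; lra.
          * apply Rmult_le_reg_r with k; auto.
            replace (A * (eta * / k) * k) with (eta * A) by (field; lra). lra.
        + assert (HM : 1 < fst (M z) < 1 + c).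
          { split; [apply MH; auto|]. assert (E := MRe z Hz1). fold d1 in E.
            assert (fst (M z) - 1 < c); [|lra]. rewrite E.
            apply Rmult_lt_reg_r with (d1 * d1); [nra|].
            unfold Rdiv. rewrite Rmult_assoc, Rinv_l, Rmult_1_r by nra. rewrite Hz.
            assert (eta * eta <= d1 * d1) by nra.
            assert (c * (eta * eta) <= c * (d1 * d1)) by (apply Rmult_le_compat_l; lra).
            nra. }
          specialize (HBd _ HM).
          assert (d1 * / d2 <= 1).
          { apply Rmult_le_reg_r with d2; auto. rewrite Rmult_assoc, Rinv_l by lra. lra. }
          assert (0 <= d1 * / d2).
          { apply Rmult_le_pos; [lra|]. left. apply Rinv_0_lt_compat; lra. }
          assert (Z := Cmod_ge_0 (Q (M z))). nra. }
    rewrite E0, Cmod_mult. rewrite <- RtoC_plus, Cmod_R, Rabs_pos_eq by lra.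
    apply Rmult_le_compat_r; lra. }
  (* The damping factor at 0 is 1/(1 + k). The value of k chosen here allows an excess over B of
     only half the supposed one. *)
  apply Rnot_lt_le. intros L.
  specialize (Main ((Cmod (Q xi) - B) / (2 * B))).
  assert (0 < (Cmod (Q xi) - B) / (2 * B)) by (apply Rdiv_lt_0_compat; lra).
  specialize (Main H). replace (B * (1 + (Cmod (Q xi) - B) / (2 * B))) with (B + (Cmod (Q xi) - B) / 2) in Main by (field; lra).
  lra.
Qed.

(** * Finite sums and Young's inequality *)

Definition rsum {T : Type} (f : T -> R) (l : list T) : R := fold_right Rplus 0 (map f l).
Definition csum {T : Type} (f : T -> C) (l : list T) : C := fold_right Cplus (RtoC 0) (map f l).

Lemma rsum_le {T : Type} (f g : T -> R) (l : list T) :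
  (forall i, In i l -> f i <= g i) -> rsum f l <= rsum g l.
Proof.
  unfold rsum. induction l as [|i l IH]; intros H; simpl; [lra|].
  apply Rplus_le_compat; [apply H; simpl; auto|apply IH; intros j Hj; apply H; simpl; auto].
Qed.

Lemma rsum_ext {T : Type} (f g : T -> R) (l : list T) :
  (forall i, In i l -> f i = g i) -> rsum f l = rsum g l.
Proof. intros H. unfold rsum. f_equal. apply map_ext_in. exact H. Qed.

Lemma rsum_plus {T : Type} (f g : T -> R) (l : list T) :
  rsum (fun i => f i + g i) l = rsum f l + rsum g l.
Proof. unfold rsum. induction l as [|i l IH]; simpl; [ring|]. rewrite IH. ring. Qed.

Lemma rsum_scal {T : Type} (c : R) (f : T -> R) (l : list T) :
  rsum (fun i => c * f i) l = c * rsum f l.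
Proof. unfold rsum. induction l as [|i l IH]; simpl; [ring|]. rewrite IH. ring. Qed.

Lemma rsum_nonneg {T : Type} (f : T -> R) (l : list T) : (forall i, In i l -> 0 <= f i) -> 0 <= rsum f l.
Proof.
  intros H. replace 0 with (rsum (fun _ : T => 0 * 0) l).
  - apply rsum_le. intros i Hi. rewrite Rmult_0_l. auto.
  - rewrite rsum_scal. ring.
Qed.

Lemma rsum_app {T : Type} (f : T -> R) (l m : list T) : rsum f (l ++ m) = rsum f l + rsum f m.
Proof. unfold rsum. induction l as [|i l IH]; simpl; [ring|]. rewrite IH. ring. Qed.

Lemma Cmod_csum {T : Type} (f : T -> C) (l : list T) : Cmod (csum f l) <= rsum (fun i => Cmod (f i)) l.
Proof.
  unfold csum, rsum. induction l as [|i l IH]; simpl; [rewrite Cmod_0; lra|].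
  eapply Rle_trans; [apply Cmod_triangle|]. lra.
Qed.

Lemma csum_RtoC {T : Type} (f : T -> R) (l : list T) : csum (fun i => RtoC (f i)) l = RtoC (rsum f l).
Proof. unfold csum, rsum. induction l as [|i l IH]; simpl; [reflexivity|]. rewrite IH, RtoC_plus. reflexivity. Qed.

Lemma cdiff_csum {T : Type} (f : T -> C -> C) (l : list T) (z : C) :
  (forall i, In i l -> exists m, cdiff (f i) z m) -> exists m, cdiff (fun u => csum (fun i => f i u) l) z m.
Proof.
  induction l as [|i l IH]; intros H.
  - exists (RtoC 0). exact (cdiff_const (RtoC 0) z).
  - destruct (H i) as [m Hm]; [simpl; auto|].
    destruct IH as [m' Hm']; [intros j Hj; apply H; simpl; auto|].
    exists (m + m')%C. apply (cdiff_plus (f i) (fun u => csum (fun i => f i u) l)); auto.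
Qed.

(** Convexity of exp, through its tangent line at the weighted mean of s ln a and s ln b. The form
    with weights 1 - 1/s and 1/s includes s = 1, where the conjugate exponent would be infinite. *)
Lemma young_power (s a b : R) : 1 <= s -> 0 < a -> 0 < b ->
  Rpower a (s - 1) * b <= (1 - / s) * Rpower a s + / s * Rpower b s.
Proof.
  intros Hs Ha Hb. unfold Rpower. rewrite <- (exp_ln b) at 1 by auto. rewrite <- exp_plus.
  set (u := s * ln a). set (v := s * ln b). set (t := / s).
  assert (Ht : 0 < t) by (apply Rinv_0_lt_compat; lra).
  assert (Ets : t * s = 1) by (unfold t; field; lra).
  assert (Ht1 : t <= 1) by nra.
  replace ((s - 1) * ln a + ln b) with ((1 - t) * u + t * v).
  2:{ unfold u, v. replace ((1 - t) * (s * ln a) + t * (s * ln b))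
        with (s * ln a - (t * s) * ln a + (t * s) * ln b) by ring. rewrite Ets. ring. }
  set (m := (1 - t) * u + t * v).
  assert (T : forall x, exp m * (1 + (x - m)) <= exp x).
  { intros x. replace x with (m + (x - m)) at 2 by ring. rewrite exp_plus.
    apply Rmult_le_compat_l; [left; apply exp_pos|]. apply exp_ineq1_le. }
  assert (T1 := T u). assert (T2 := T v).
  assert ((1 - t) * (exp m * (1 + (u - m))) <= (1 - t) * exp u) by (apply Rmult_le_compat_l; lra).
  assert (t * (exp m * (1 + (v - m))) <= t * exp v) by (apply Rmult_le_compat_l; lra).
  assert ((1 - t) * (exp m * (1 + (u - m))) + t * (exp m * (1 + (v - m))) = exp m) by (unfold m; ring).
  lra.
Qed.

(** Translation by i periods of the exponential: under [phi] these points become preimages of one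
    and the same w. *)
Definition vshift (xi : C) (i : nat) : C := (fst xi, snd xi + 2 * PI * INR i).

Lemma vshift_eq (xi : C) (i : nat) : vshift xi i = (xi + (0%R, (2 * PI * INR i)%R))%C.
Proof. apply injective_projections; simpl; ring. Qed.

Lemma csum_scal_limit {T : Type} (c : T -> C) (f : T -> R -> C) (m : T -> C) (l : list T) :
  (forall i, In i l -> forall eps, 0 < eps -> exists d, 0 < d /\ forall h, 0 < h < d -> Cmod (f i h - m i) < eps) ->
  forall eps, 0 < eps -> exists d, 0 < d /\ forall h, 0 < h < d ->
    Cmod (csum (fun i => (c i * f i h)%C) l - csum (fun i => (c i * m i)%C) l) < eps.
Proof.
  induction l as [|i l IH]; intros H eps He.
  - exists 1. split; [lra|]. intros h _. unfold csum; simpl.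
    rewrite Cmod_self. exact He.
  - assert (P := Cmod_ge_0 (c i)).
    destruct (H i ltac:(simpl; auto) (eps / (2 * (Cmod (c i) + 1)))) as [d1 [Hd1 K1]].
    { apply Rdiv_lt_0_compat; lra. }
    destruct (IH ltac:(intros j Hj; apply H; simpl; auto) (eps / 2)) as [d2 [Hd2 K2]]; [lra|].
    exists (Rmin d1 d2). split; [apply Rmin_pos; auto|]. intros h Hh.
    assert (M1 := Rmin_l d1 d2). assert (M2 := Rmin_r d1 d2).
    specialize (K1 h ltac:(lra)). specialize (K2 h ltac:(lra)).
    change (Cmod (c i * f i h + csum (fun i => (c i * f i h)%C) l -
       (c i * m i + csum (fun i => (c i * m i)%C) l)) < eps).
    replace (c i * f i h + csum (fun i => c i * f i h) l - (c i * m i + csum (fun i => c i * m i) l))%C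
      with (c i * (f i h - m i) + (csum (fun i => c i * f i h) l - csum (fun i => c i * m i) l))%C by ring.
    eapply Rle_lt_trans; [apply Cmod_triangle|]. rewrite Cmod_mult.
    apply Rmult_lt_compat_r with (r := Cmod (c i) + 1) in K1; [|lra].
    replace (eps / (2 * (Cmod (c i) + 1)) * (Cmod (c i) + 1)) with (eps / 2) in K1 by (field; lra).
    assert (Q := Cmod_ge_0 (f i h - m i)). nra.
Qed.

(* Linearize the s-th powers by duality (Young's inequality) and apply Phragmen-Lindelof to the
   resulting combination of difference quotients of phi, which avoids differentiating phi' . *)
Lemma power_sum_half_plane (Om : C -> Prop) (tau phi dphi : C -> C) (s B : R) :
  tract Om tau phi dphi -> 1 <= s -> 0 < B ->
  (forall th n, rsum (fun i => Rpower (logder phi dphi (vshift (1, th) i)) s) (seq 0 n) <= B) ->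
  exists B', 0 < B' /\ forall x th n, 1 < x ->
    rsum (fun i => Rpower (logder phi dphi (vshift (x, th) i)) s) (seq 0 n) <= B'.
Proof.
  intros T Hs HB Hsum.
  destruct (logder_harnack Om tau phi dphi 1 2 T Rlt_0_1) as [K [HK1 HK]].
  (* A difference quotient costs 7000 against [logder], and K moves a point of the strip 1 < Re < 2
     back to the line Re = 1. *)
  set (c7 := 7000 * K).
  assert (Hc7 : 1 <= c7) by (unfold c7; lra).
  exists (Rpower c7 s * B). split; [apply Rmult_lt_0_compat; [apply Rpower_pos|auto]|].
  intros x th n Hx. set (l := seq 0 n).
  set (B' := Rpower c7 s * B). assert (HB' : 0 < B') by (apply Rmult_lt_0_compat; [apply Rpower_pos|auto]).
  set (x0 := (x, th) : C).
  set (a := fun i => logder phi dphi (vshift x0 i)).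
  assert (Pa : forall i, 0 < a i) by (intros i; apply (logder_pos Om tau phi dphi (vshift x0 i)); auto; simpl; lra).
  set (A := rsum (fun i => Rpower (a i) s) l).
  change (A <= B').
  set (w := fun i => (dphi (vshift x0 i) * / phi (vshift x0 i))%C).
  assert (Pphi : forall xi, 0 < fst xi -> phi xi <> 0).
  { intros xi H. apply Cmod_gt_0. assert (Z := tract_phi_gt_1 _ _ _ _ _ T H). lra. }
  assert (Mw : forall i, Cmod (w i) = a i).
  { intros i. unfold w, a, logder. rewrite Cmod_mult, Cmod_inv; [reflexivity|].
    apply Pphi. simpl. lra. }
  assert (Nw : forall i, w i <> 0) by (intros i; apply Cmod_gt_0; rewrite Mw; auto).
  (* The dual coefficients at the target point: modulus a_i^(s - 1) and the phase that makes the sum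
     of [cf i * w i] equal to [A]. They stay fixed while xi varies. *)
  set (cf := fun i => (Rpower (a i) (s - 1) * (a i * / w i))%C).
  assert (Mcf : forall i, Cmod (cf i) = Rpower (a i) (s - 1)).
  { intros i. unfold cf. rewrite !Cmod_mult, !Cmod_R, Cmod_inv, Mw by auto.
    rewrite !Rabs_pos_eq by (left; try apply Rpower_pos; auto). field. specialize (Pa i). lra. }
  set (D := fun (h : R) i xi => ((phi (vshift xi i + h) - phi (vshift xi i)) * / (h * phi (vshift xi i)))%C).
  assert (DB : forall h i xi, 0 < h <= / 512 -> 1 < fst xi -> Cmod (D h i xi) <= 7000 * logder phi dphi (vshift xi i)).
  { intros h i xi Hh Hxi. set (z := vshift xi i). assert (Hz : 1 < fst z) by exact Hxi.
    assert (Hz0 : 0 < fst z) by lra.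
    destruct (tract_bounds _ _ _ _ _ T Hz0) as [_ [_ Bd]].
    assert (E : Cmod (phi (z + h)%C - phi z) <= 7000 * Cmod (dphi z) * h).
    { rewrite <- (Rabs_pos_eq h) at 2 by lra. rewrite <- Cmod_R.
      apply (mean_value_bound phi dphi).
      - intros u Hu. apply T. simpl. nra.
      - intros u Hu. apply Bd. replace (z + u * h - z)%C with (RtoC (u * h)) by (rewrite RtoC_mult; ring).
        rewrite Cmod_R, Rabs_pos_eq by nra. nra. }
    assert (Pz := tract_phi_gt_1 _ _ _ _ _ T Hz0).
    unfold D. fold z. rewrite Cmod_mult, Cmod_inv, Cmod_mult, Cmod_R, Rabs_pos_eq; try lra.
    2:{ apply Cmult_neq_0; [|auto]. intros E0. apply RtoC_inj in E0. lra. }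
    unfold logder. apply Rmult_le_reg_r with (h * Cmod (phi z)); [nra|].
    rewrite Rmult_assoc, Rinv_l, Rmult_1_r by nra.
    replace (7000 * (Cmod (dphi z) / Cmod (phi z)) * (h * Cmod (phi z))) with (7000 * Cmod (dphi z) * h) by (field; lra).
    exact E. }
  (* Young's inequality bounds the linear form near Re = 1 by (1 - 1/s) A + B'/s. The global bound
     required by Phragmen-Lindelof comes from [logder] <= 7000/Re and depends on n and h only
     through finite data of the target point. *)
  assert (Main : forall h, 0 < h <= / 512 -> Cmod (csum (fun i => (cf i * D h i x0)%C) l) <= (1 - / s) * A + / s * B').
  { intros h Hh.
    assert (Is : 0 < / s) by (apply Rinv_0_lt_compat; lra).
    assert (Is1 : / s <= 1) by (rewrite <- Rinv_1; apply Rinv_le_contravar; lra).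
    assert (PA : 0 <= A) by (apply rsum_nonneg; intros; left; apply Rpower_pos).
    apply (phragmen_lindelof (fun xi => csum (fun i => (cf i * D h i xi)%C) l)
             (rsum (fun i => Rpower (a i) (s - 1) * (7000 * 7000)) l) _ 1); [lra| | | | |simpl; lra].
    - assert (0 < / s * B') by (apply Rmult_lt_0_compat; auto).
      assert (0 <= (1 - / s) * A) by (apply Rmult_le_pos; lra). lra.
    - intros xi Hxi. apply cdiff_csum. intros i _.
      assert (DV : forall v : C, cdiff (fun u => (vshift u i + v)%C) xi 1).
      { intros v. apply (cdiff_ext_loc (fun u => (u + ((0%R, (2 * PI * INR i)%R) + v))%C) _ xi 1 1); [lra| |].
        - intros u _. rewrite vshift_eq. ring.
        - apply (cdiff_eq _ _ (1 + 0)%C); [|ring].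
          apply (cdiff_plus (fun u => u)); [apply cdiff_id|apply cdiff_const]. }
      assert (DV0 : cdiff (fun u => vshift u i) xi 1).
      { apply (cdiff_ext_loc (fun u => (vshift u i + 0)%C) _ xi 1 1); [lra| |apply DV].
        intros u _. ring. }
      assert (Hv : 0 < fst (vshift xi i)) by (simpl; lra).
      eexists. apply (cdiff_mult (fun _ => cf i)); [apply cdiff_const|].
      unfold D. apply (cdiff_mult (fun u => (phi (vshift u i + h) - phi (vshift u i))%C)).
      + apply (cdiff_minus (fun u => phi (vshift u i + h)%C) (fun u => phi (vshift u i))).
        * apply (cdiff_comp phi (fun u => (vshift u i + h)%C)); [apply DV|]. apply T. simpl. lra.
        * apply (cdiff_comp phi (fun u => vshift u i)); [apply DV0|]. apply T. exact Hv.
      + apply (cdiff_inv (fun u => (h * phi (vshift u i))%C)).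
        * apply (cdiff_mult (fun _ => RtoC h)); [apply cdiff_const|].
          apply (cdiff_comp phi (fun u => vshift u i)); [apply DV0|]. apply T. exact Hv.
        * apply Cmult_neq_0; [|apply Pphi; exact Hv]. intros E0. apply RtoC_inj in E0. lra.
    - intros xi Hxi. eapply Rle_trans; [apply Cmod_csum|]. apply rsum_le. intros i _.
      rewrite Cmod_mult, Mcf. apply Rmult_le_compat_l; [left; apply Rpower_pos|].
      eapply Rle_trans; [apply DB; auto|]. apply Rmult_le_compat_l; [lra|].
      eapply Rle_trans; [apply (logder_le Om tau); auto; simpl; lra|].
      simpl. apply Rmult_le_reg_r with (fst xi); [lra|]. field_simplify; lra.
    - intros xi Hxi. eapply Rle_trans; [apply Cmod_csum|].
      set (b := fun i => c7 * logder phi dphi (vshift (1, snd xi) i)).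
      assert (Pb1 : forall i, 0 < logder phi dphi (vshift (1, snd xi) i)).
      { intros i. apply (logder_pos Om tau); auto. simpl. lra. }
      assert (Pb : forall i, 0 < b i). { intros i. unfold b. specialize (Pb1 i). nra. }
      apply Rle_trans with (rsum (fun i => (1 - / s) * Rpower (a i) s + / s * Rpower (b i) s) l).
      + apply rsum_le. intros i _. rewrite Cmod_mult, Mcf.
        eapply Rle_trans; [|apply young_power; auto].
        apply Rmult_le_compat_l; [left; apply Rpower_pos|].
        eapply Rle_trans; [apply DB; [auto|lra]|]. unfold b, c7. rewrite Rmult_assoc.
        apply Rmult_le_compat_l; [lra|]. apply HK; simpl; try lra.
        replace (fst xi, snd xi + 2 * PI * INR i) with (vshift xi i) by reflexivity.
        match goal with |- Cmod ?y <= _ => replace y with (RtoC (fst xi - 1)) end.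
        2:{ apply injective_projections; simpl; ring. }
        rewrite Cmod_R, Rabs_pos_eq; lra.
      + rewrite rsum_plus, !rsum_scal. fold A. apply Rplus_le_compat_l, Rmult_le_compat_l; [lra|].
        apply Rle_trans with (rsum (fun i => Rpower c7 s * Rpower (logder phi dphi (vshift (1, snd xi) i)) s) l).
        * right. apply rsum_ext. intros i _. unfold b. symmetry. apply Rpower_mult_distr; [lra|auto].
        * rewrite rsum_scal. apply Rmult_le_compat_l; [left; apply Rpower_pos|]. apply Hsum. }
  (* Letting h tend to 0 at the target point gives A <= (1 - 1/s) A + B'/s. Since [A] is a finite
     sum it can be absorbed, leaving A <= B'. *)
  assert (Lim : forall eps, 0 < eps -> A <= (1 - / s) * A + / s * B' + eps).
  { intros eps He.
    destruct (csum_scal_limit cf (fun i h => D h i x0) w l) with (eps := eps) as [d [Hd Kd]]; auto.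
    { intros i _ e Hep. assert (Hz : 0 < fst (vshift x0 i)) by (simpl; lra).
      set (z := vshift x0 i) in *. assert (Pz := tract_phi_gt_1 _ _ _ _ _ T Hz).
      assert (Nz := Pphi z Hz).
      destruct (cdiff_eps _ _ _ (proj2 (proj2 (proj2 (proj2 (proj2 T)))) z Hz) (e / 2)) as [d [Hd Kd]]; [lra|].
      exists d. split; auto. intros h Hh. specialize (Kd (z + h)%C).
      replace (z + h - z)%C with (RtoC h) in Kd by ring. rewrite Cmod_R, Rabs_pos_eq in Kd by lra.
      specialize (Kd ltac:(lra)). unfold D, w. fold z.
      assert (Nh : RtoC h <> 0) by (intros E0; apply RtoC_inj in E0; lra).
      replace ((phi (z + h) - phi z) * / (h * phi z) - dphi z * / phi z)%C
        with ((phi (z + h) - phi z - h * dphi z) * / (h * phi z))%C by (field; auto).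
      rewrite Cmod_mult, Cmod_inv, Cmod_mult, Cmod_R, Rabs_pos_eq by (try lra; apply Cmult_neq_0; auto).
      apply Rmult_lt_reg_r with (h * Cmod (phi z)); [nra|].
      rewrite Rmult_assoc, Rinv_l, Rmult_1_r by nra.
      eapply Rle_lt_trans; [exact Kd|]. assert (0 < e * h) by (apply Rmult_lt_0_compat; lra). nra. }
    set (h := Rmin (/ 512) (d / 2)).
    assert (Hh : 0 < h) by (apply Rmin_pos; lra).
    assert (Hh1 : h <= / 512) by apply Rmin_l. assert (Hh2 : h <= d / 2) by apply Rmin_r.
    specialize (Kd h ltac:(lra)). specialize (Main h ltac:(lra)).
    assert (EA : csum (fun i => (cf i * w i)%C) l = RtoC A).
    { unfold A. rewrite <- csum_RtoC. unfold csum. f_equal. apply map_ext. intros i.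
      unfold cf. replace (Rpower (a i) (s - 1) * (a i * / w i) * w i)%C
        with (RtoC (Rpower (a i) (s - 1)) * RtoC (a i))%C by (field; auto).
      rewrite <- RtoC_mult. f_equal. rewrite <- (Rpower_1 (a i)) at 2 by auto.
      rewrite <- Rpower_plus. f_equal. ring. }
    rewrite EA in Kd.
    assert (PA : 0 <= A) by (apply rsum_nonneg; intros; left; apply Rpower_pos).
    assert (TT := Cmod_sub_le (RtoC A) (csum (fun i => (cf i * D h i x0)%C) l)).
    rewrite Cmod_minus_sym in TT. rewrite Cmod_R, Rabs_pos_eq in TT by auto. lra. }
  apply Rnot_lt_le. intros L.
  assert (Is : 0 < / s) by (apply Rinv_0_lt_compat; lra).
  assert (0 < / s * (A - B')) by (apply Rmult_lt_0_compat; lra).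
  specialize (Lim (/ s * (A - B') / 2) ltac:(lra)). lra.
Qed.

(** * Integral means and dyadic blocks *)

Lemma Rbar_glb_correct (E : Rbar -> Prop) : Rbar_is_glb E (Rbar_glb E).
Proof. unfold Rbar_glb. destruct (Rbar_ex_glb E) as [l H]. exact H. Qed.

Lemma Rbar_lub_correct (E : Rbar -> Prop) : Rbar_is_lub E (Rbar_lub E).
Proof. unfold Rbar_lub. destruct (Rbar_ex_lub E) as [l H]. exact H. Qed.

Lemma limsup_pinfty_le (g : R -> R) (M e : R) : (forall T, M < T -> g T <= e) ->
  Rbar_le (limsup_pinfty g) (Finite e).
Proof.
  intros H. unfold limsup_pinfty. set (E := fun y => _).
  destruct (Rbar_glb_correct E) as [L _].
  eapply Rbar_le_trans; [apply L; exists M; reflexivity|].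
  apply Rbar_lub_correct. intros x [T [HT Ex]]. rewrite Ex. simpl. auto.
Qed.

(** The gap between e' and e is kept because it later becomes a negative power of T. *)
Lemma limsup_pinfty_lt (g : R -> R) (e : R) : Rbar_lt (limsup_pinfty g) (Finite e) ->
  exists M e', e' < e /\ forall T, M < T -> g T <= e'.
Proof.
  intros H.
  assert (H' : exists e', e' < e /\ Rbar_lt (limsup_pinfty g) (Finite e')).
  { destruct (limsup_pinfty g) as [b| |]; simpl in H.
    - exists ((b + e) / 2). simpl. split; lra.
    - contradiction.
    - exists (e - 1). simpl. split; [lra|auto]. }
  destruct H' as [e' [He' Hlt]].
  assert (X : exists M, Rbar_lt (Rbar_lub (fun x => exists T, M < T /\ x = Finite (g T))) (Finite e')).
  { apply NNPP. intros N. apply (Rbar_lt_not_le _ _ Hlt).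
    apply Rbar_glb_correct. intros y [M EM]. rewrite EM.
    apply Rbar_not_lt_le. intros L. apply N. exists M. exact L. }
  destruct X as [M HM]. exists M, e'. split; auto. intros T HT.
  assert (Y : Rbar_le (Finite (g T)) (Finite e')); [|exact Y].
  eapply Rbar_le_trans; [|apply Rbar_lt_le; exact HM].
  apply Rbar_lub_correct. exists T. auto.
Qed.

Lemma limsup_pinfty_gt (g : R -> R) (e : R) : Rbar_lt (Finite e) (limsup_pinfty g) ->
  exists e', e < e' /\ forall M, exists T, M < T /\ e' < g T.
Proof.
  intros H.
  assert (H' : exists e', e < e' /\ Rbar_lt (Finite e') (limsup_pinfty g)).
  { destruct (limsup_pinfty g) as [b| |]; simpl in H.
    - exists ((b + e) / 2). simpl. split; lra.
    - exists (e + 1). simpl. split; [lra|auto].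
    - contradiction. }
  destruct H' as [e' [He' Hlt]]. exists e'. split; auto. intros M.
  apply NNPP. intros N. apply (Rbar_lt_not_le _ _ Hlt).
  apply (limsup_pinfty_le g M). intros T HT. apply Rnot_lt_le. intros L. apply N. exists T. auto.
Qed.

Lemma Rbar_plus_lt_0 (x : Rbar) (c : R) : Rbar_lt (Rbar_plus x (Finite c)) (Finite 0) <-> Rbar_lt x (Finite (- c)).
Proof. destruct x; simpl; split; intros; try tauto; lra. Qed.

Lemma Rbar_plus_gt_0 (x : Rbar) (c : R) : Rbar_lt (Finite 0) (Rbar_plus x (Finite c)) <-> Rbar_lt (Finite (- c)) x.
Proof. destruct x; simpl; split; intros; try tauto; lra. Qed.

Lemma ex_RInt_line (a : R -> R) (u v : R) : (forall y, continuous a y) -> ex_RInt a u v.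
Proof. intros H. apply (ex_RInt_continuous (V := R_CompleteNormedModule)). auto. Qed.

Lemma RInt_Chasles_line (a : R -> R) (u v w : R) : (forall y, continuous a y) ->
  RInt a u v + RInt a v w = RInt a u w.
Proof. intros H. apply (RInt_Chasles (V := R_CompleteNormedModule)); apply ex_RInt_line; auto. Qed.

Lemma RInt_scal_line (c : R) (a : R -> R) (u v : R) : (forall y, continuous a y) ->
  RInt (fun y => c * a y) u v = c * RInt a u v.
Proof. intros H. apply (RInt_scal (V := R_CompleteNormedModule)), ex_RInt_line; auto. Qed.

Lemma RInt_le_line (a b : R -> R) (u v : R) : (forall y, continuous a y) -> (forall y, continuous b y) ->
  u <= v -> (forall y, u < y < v -> a y <= b y) -> RInt a u v <= RInt b u v.
Proof. intros Ha Hb Huv H. apply RInt_le; auto; apply ex_RInt_line; auto. Qed.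

Lemma RInt_nonneg_le (a : R -> R) (u v u' v' : R) : (forall y, continuous a y) -> (forall y, 0 <= a y) ->
  u' <= u -> u <= v -> v <= v' -> RInt a u v <= RInt a u' v'.
Proof.
  intros Hc Ha H1 H2 H3.
  assert (X : forall p q, p <= q -> 0 <= RInt a p q).
  { intros p q Hpq. apply RInt_ge_0; auto. apply ex_RInt_line; auto. }
  rewrite <- (RInt_Chasles_line a u' u v') by auto.
  rewrite <- (RInt_Chasles_line a u v v') by auto.
  assert (X1 := X u' u H1). assert (X2 := X v v' H3). lra.
Qed.

(** The dyadic pieces are dominated by a geometric series of ratio 2^(-eps); [A] in the proof is its
    sum. *)
Lemma dyadic_integral_bound (a : R -> R) (eps T1 : R) :
  (forall y, continuous a y) -> (forall y, 0 <= a y) -> 0 < eps -> 0 < T1 ->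
  (forall T, T1 <= T -> RInt a T (2 * T) <= Rpower T (- eps)) ->
  exists B, forall Y, 0 <= Y -> RInt a 0 Y <= B.
Proof.
  intros Hc Ha He HT H.
  set (r := Rpower 2 (- eps)).
  assert (Hr : 0 < r < 1).
  { split; [apply Rpower_pos|]. unfold r. rewrite <- (Rpower_O 2) by lra. apply Rpower_lt; lra. }
  set (A := Rpower T1 (- eps) / (1 - r)).
  assert (HA : 0 < A) by (apply Rdiv_lt_0_compat; [apply Rpower_pos|lra]).
  assert (F : forall n, RInt a T1 (2 ^ n * T1) <= A * (1 - r ^ n)).
  { induction n as [|n IH].
    - simpl. rewrite Rmult_1_l, RInt_point. unfold zero; simpl. lra.
    - rewrite <- (RInt_Chasles_line a T1 (2 ^ n * T1)) by auto. simpl.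
      assert (P2 : 0 < 2 ^ n) by (apply pow_lt; lra).
      assert (P2' : 1 <= 2 ^ n) by (apply pow_R1_Rle; lra).
      replace (2 * 2 ^ n * T1) with (2 * (2 ^ n * T1)) by ring.
      assert (S := H (2 ^ n * T1) ltac:(nra)).
      rewrite <- Rpower_mult_distr in S by auto.
      assert (E : Rpower (2 ^ n) (- eps) = r ^ n).
      { unfold r. rewrite <- (Rpower_pow n 2), <- (Rpower_pow n (Rpower 2 (- eps))) by (try apply Rpower_pos; lra).
        rewrite !Rpower_mult. f_equal. ring. }
      rewrite E in S.
      assert (E2 : Rpower T1 (- eps) = A * (1 - r)) by (unfold A; field; lra).
      rewrite E2 in S. replace (A * (1 - r * r ^ n)) with (A * (1 - r ^ n) + r ^ n * (A * (1 - r))) by ring. lra. }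
  exists (RInt a 0 T1 + A). intros Y HY.
  destruct (Pow_x_infinity 2) with (b := Y / T1) as [n Hn]; [rewrite Rabs_pos_eq; lra|].
  specialize (Hn n (le_n n)). rewrite Rabs_pos_eq in Hn by (apply pow_le; lra). apply Rge_le in Hn.
  apply Rmult_le_compat_r with (r := T1) in Hn; [|lra].
  replace (Y / T1 * T1) with Y in Hn by (field; lra).
  assert (P2' : 1 <= 2 ^ n) by (apply pow_R1_Rle; lra).
  eapply Rle_trans; [apply (RInt_nonneg_le a 0 Y 0 (2 ^ n * T1)); auto; lra|].
  rewrite <- (RInt_Chasles_line a 0 T1) by auto. specialize (F n).
  assert (0 <= r ^ n) by (apply pow_le; lra). nra.
Qed.

Definition line_pow (phi dphi : C -> C) (t y : R) : R := Rpower (logder phi dphi (1, y)) t.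

Definition block (phi dphi : C -> C) (t T : R) : R :=
  RInt (line_pow phi dphi t) (- (2 * T)) (- T) + RInt (line_pow phi dphi t) T (2 * T).

Definition square_distortion (phi : C -> C) : Prop :=
  exists M T0, forall T, T0 <= T ->
    forall xi xi', Qsq T xi -> ~ Qsq (T / 8) xi -> Qsq T xi' -> ~ Qsq (T / 8) xi' ->
      Cmod (phi xi) <= M * Cmod (phi xi').

Lemma line_pow_continuous (Om : C -> Prop) (tau phi dphi : C -> C) (t y : R) :
  tract Om tau phi dphi -> continuous (line_pow phi dphi t) y.
Proof.
  intros T. apply Rpower_continuous.
  - apply (logder_pos Om tau); auto. simpl. lra.
  - apply (logder_continuous Om tau); auto. lra.
Qed.

Lemma line_pow_pos (phi dphi : C -> C) (t y : R) : 0 < line_pow phi dphi t y.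
Proof. apply Rpower_pos. Qed.

Lemma block_pos (Om : C -> Prop) (tau phi dphi : C -> C) (t T : R) :
  tract Om tau phi dphi -> 0 < T -> 0 < block phi dphi t T.
Proof.
  intros TR HT. apply Rplus_lt_0_compat; apply RInt_gt_0; try lra; intros; try apply line_pow_pos;
    apply (line_pow_continuous Om tau); auto.
Qed.

Lemma Cmod_dphiT (phi dphi : C -> C) (T y : R) : 0 < T -> phi (RtoC T) <> 0 -> phi (1, T * y) <> 0 ->
  Cmod (dphiT phi dphi T (1 / T, y)) =
  T * (Cmod (phi (1, T * y)) / Cmod (phi (RtoC T))) * logder phi dphi (1, T * y).
Proof.
  intros HT Hn Hn'. unfold dphiT, logder.
  replace (RtoC T * ((1 / T)%R, y))%C with ((1, T * y) : C).
  2:{ apply injective_projections; simpl; field; lra. }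
  assert (P := proj1 (Cmod_gt_0 _) Hn). assert (P' := proj1 (Cmod_gt_0 _) Hn').
  rewrite Cmod_div, Cmod_mult, !Cmod_R, !Rabs_pos_eq; try lra.
  - field. split; lra.
  - intros E. apply RtoC_inj in E. lra.
Qed.

(* Rescaling turns the integral means of phi_{j,T} at height 1/T into dyadic blocks on Re = 1. *)
Lemma block_beta (Om : C -> Prop) (tau phi dphi : C -> C) (t : R) :
  tract Om tau phi dphi -> square_distortion phi -> 0 < t ->
  exists c T1, 1 < T1 /\ forall T, T1 <= T ->
    Rabs (ln (block phi dphi t T) - (beta (dphiT phi dphi T) (1 / T) t + (1 - t)) * ln T) <= c.
Proof.
  intros TR [M [T0 HM]] Ht.
  exists (t * ln (Rmax M 1)), (Rmax T0 2). split; [assert (Z := Rmax_r T0 2); lra|].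
  intros T HT.
  assert (HT0 : T0 <= T) by (eapply Rle_trans; [apply Rmax_l|exact HT]).
  assert (HT2 : 2 <= T) by (eapply Rle_trans; [apply Rmax_r|exact HT]).
  set (K := Rmax M 1) in *. assert (HK : 1 <= K) by apply Rmax_r. assert (HMK : M <= K) by apply Rmax_l.
  assert (Pphi : forall xi, 0 < fst xi -> 1 < Cmod (phi xi)).
  { intros xi H. apply (tract_phi_gt_1 Om tau phi dphi); auto. }
  assert (PT : 1 < Cmod (phi (RtoC T))) by (apply Pphi; simpl; lra).
  set (lp := line_pow phi dphi t).
  assert (Clp : forall y, continuous lp y) by (intros; apply (line_pow_continuous Om tau); auto).
  (* Both T and 1 + iTy lie in Q_T outside Q_(T/8): the first by its real part, the second because T
     <= |Ty| <= 2T. The square hypothesis is used in both directions. *)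
  assert (Comp : forall y, 1 <= Rabs y <= 2 ->
     / K <= Cmod (phi (1, T * y)) / Cmod (phi (RtoC T)) <= K).
  { intros y Hy.
    assert (P1 : 1 < Cmod (phi (1, T * y))) by (apply Pphi; simpl; lra).
    assert (Q1 : Qsq T (1, T * y)).
    { split; simpl; [lra|]. rewrite Rabs_mult, (Rabs_pos_eq T) by lra. nra. }
    assert (Q1' : ~ Qsq (T / 8) (1, T * y)).
    { intros [_ H]. simpl in H. rewrite Rabs_mult, (Rabs_pos_eq T) in H by lra. nra. }
    assert (Q2 : Qsq T (RtoC T)) by (split; simpl; [lra|rewrite Rabs_R0; lra]).
    assert (Q2' : ~ Qsq (T / 8) (RtoC T)) by (intros [H _]; simpl in H; lra).
    assert (A1 := HM T HT0 _ _ Q1 Q1' Q2 Q2'). assert (A2 := HM T HT0 _ _ Q2 Q2' Q1 Q1').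
    split.
    - apply Rmult_le_reg_r with (K * Cmod (phi (RtoC T))); [nra|].
      replace (/ K * (K * Cmod (phi (RtoC T)))) with (Cmod (phi (RtoC T))) by (field; lra).
      replace (Cmod (phi (1, T * y)) / Cmod (phi (RtoC T)) * (K * Cmod (phi (RtoC T))))
        with (K * Cmod (phi (1, T * y))) by (field; lra). nra.
    - apply Rmult_le_reg_r with (Cmod (phi (RtoC T))); [lra|].
      unfold Rdiv. rewrite Rmult_assoc, Rinv_l, Rmult_1_r by lra. nra. }
  set (h := fun y => Rpower (Cmod (dphiT phi dphi T (1 / T, y))) t).
  assert (N0 : forall z, 1 < Cmod z -> z <> 0) by (intros z Hz; apply Cmod_gt_0; lra).
  assert (Eh : forall y, h y = Rpower (T * (Cmod (phi (1, T * y)) / Cmod (phi (RtoC T)))) t * lp (T * y)).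
  { intros y. assert (P1 : 1 < Cmod (phi (1, T * y))) by (apply Pphi; simpl; lra).
    unfold h, lp, line_pow. rewrite Cmod_dphiT by (auto; lra).
    symmetry. apply Rpower_mult_distr.
    - apply Rmult_lt_0_compat; [lra|]. apply Rdiv_lt_0_compat; lra.
    - apply (logder_pos Om tau); auto. simpl. lra. }
  assert (Hbd : forall y, 1 <= Rabs y <= 2 ->
     Rpower (T * / K) t * lp (T * y) <= h y <= Rpower (T * K) t * lp (T * y)).
  { intros y Hy. rewrite Eh. destruct (Comp y Hy) as [C1 C2].
    assert (IK : 0 < / K) by (apply Rinv_0_lt_compat; lra).
    split; apply Rmult_le_compat_r; try (left; apply line_pow_pos);
      apply Rpower_le_base; try lra; try nra. }
  assert (Ch : forall y, continuous h y).
  { intros y. assert (P1 : 1 < Cmod (phi (1, T * y))) by (apply Pphi; simpl; lra).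
    apply (continuous_ext (fun y => Rpower (T * / Cmod (phi (RtoC T)) * (Cmod (dphi (1, T * y)))) t)).
    - intros z. assert (P2 : 1 < Cmod (phi (1, T * z))) by (apply Pphi; simpl; lra).
      unfold h. rewrite Cmod_dphiT by (auto; lra). f_equal. unfold logder. field. split; lra.
    - apply Rpower_continuous.
      + assert (IT : 0 < / Cmod (phi (RtoC T))) by (apply Rinv_0_lt_compat; lra).
        assert (0 < Cmod (dphi (1, T * y))) by (apply (tract_bounds Om tau phi dphi); auto; simpl; lra).
        apply Rmult_lt_0_compat; auto. apply Rmult_lt_0_compat; lra.
      + apply continuous_mult_const, (continuous_scale_arg T (fun s => Cmod (dphi (1, s)))).
        apply continuous_Cmod_vertical. apply (dphi_continuous Om tau phi); auto. simpl; lra. }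
  assert (Scale : forall u v, RInt (fun y => lp (T * y)) u v = / T * RInt lp (T * u) (T * v)).
  { intros u v.
    assert (E := RInt_comp_lin (V := R_CompleteNormedModule) lp T 0 u v (ex_RInt_line _ _ _ Clp)).
    rewrite !Rplus_0_r in E.
    assert (E2 := RInt_scal_line T (fun y => lp (T * y)) u v (fun y => continuous_scale_arg T lp y (Clp _))).
    cbv beta in E2.
    assert (E3 : RInt (fun y => T * lp (T * y)) u v = RInt lp (T * u) (T * v)).
    { rewrite <- E. apply RInt_ext. intros y _. rewrite Rplus_0_r. reflexivity. }
    rewrite <- E3, E2, <- Rmult_assoc, Rinv_l, Rmult_1_l by lra. reflexivity. }
  assert (Cl1 : forall y, continuous (fun y => lp (T * y)) y) by (intros; apply continuous_scale_arg; auto).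
  assert (Clc : forall c y, continuous (fun y => c * lp (T * y)) y).
  { intros. apply (continuous_mult_const c (fun y => lp (T * y))). auto. }
  set (J := RInt h (-2) (-1) + RInt h 1 2).
  set (Bk := block phi dphi t T).
  assert (HBk : 0 < Bk) by (apply (block_pos Om tau); auto; lra).
  assert (EBk : RInt (fun y => lp (T * y)) (-2) (-1) + RInt (fun y => lp (T * y)) 1 2 = / T * Bk).
  { rewrite !Scale. unfold Bk, block. fold lp.
    replace (T * -2) with (- (2 * T)) by ring. replace (T * -1) with (- T) by ring.
    replace (T * 1) with T by ring. replace (T * 2) with (2 * T) by ring. ring. }
  assert (Jlow : Rpower (T * / K) t * (/ T * Bk) <= J).
  { rewrite <- EBk, Rmult_plus_distr_l, <- !(RInt_scal_line _ (fun y => lp (T * y))) by auto.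
    apply Rplus_le_compat; apply RInt_le_line; auto; try lra; intros y Hy; apply Hbd;
      [rewrite Rabs_left; lra|rewrite Rabs_pos_eq; lra]. }
  assert (Jup : J <= Rpower (T * K) t * (/ T * Bk)).
  { rewrite <- EBk, Rmult_plus_distr_l, <- !(RInt_scal_line _ (fun y => lp (T * y))) by auto.
    apply Rplus_le_compat; apply RInt_le_line; auto; try lra; intros y Hy; apply Hbd;
      [rewrite Rabs_left; lra|rewrite Rabs_pos_eq; lra]. }
  assert (IT : 0 < / T) by (apply Rinv_0_lt_compat; lra).
  assert (IK : 0 < / K) by (apply Rinv_0_lt_compat; lra).
  assert (PJ : 0 < J).
  { eapply Rlt_le_trans; [|exact Jlow]. apply Rmult_lt_0_compat; [apply Rpower_pos|nra]. }
  assert (PlnT : 0 < ln T) by (rewrite <- ln_1; apply ln_increasing; lra).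
  (* The integral J equals T^t from the derivative of phi_T, times 1/T from the change of variable,
     times the block, up to K^t in either direction. In logarithms this is the shift 1 - t. *)
  assert (Ebeta : beta (dphiT phi dphi T) (1 / T) t * ln T = ln J).
  { unfold beta. fold h. fold J. replace (1 / (1 / T)) with T by (field; lra). field. lra. }
  rewrite Rmult_plus_distr_r, Ebeta.
  assert (Lup : ln J <= t * (ln T + ln K) + (- ln T + ln Bk)).
  { assert (LL : ln J <= ln (Rpower (T * K) t * (/ T * Bk)))
      by (apply ln_le; auto).
    rewrite ln_mult, (ln_mult (/ T)), ln_Rinv in LL by (try apply Rpower_pos; try nra; try lra).
    unfold Rpower in LL. rewrite ln_exp, ln_mult in LL by lra. lra. }
  assert (Llow : t * (ln T - ln K) + (- ln T + ln Bk) <= ln J).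
  { assert (LL : ln (Rpower (T * / K) t * (/ T * Bk)) <= ln J).
    { apply ln_le; auto. apply Rmult_lt_0_compat; [apply Rpower_pos|nra]. }
    rewrite ln_mult, (ln_mult (/ T)), ln_Rinv in LL by (try apply Rpower_pos; try nra; try lra).
    unfold Rpower in LL. rewrite ln_exp, ln_mult, ln_Rinv in LL by lra. lra. }
  apply Rabs_le. lra.
Qed.

Lemma ln_ge_of_exp_le (a T : R) : exp a <= T -> a <= ln T.
Proof.
  intros H. assert (P := exp_pos a). rewrite <- (ln_exp a).
  apply ln_le; auto.
Qed.

Lemma exp_le_compat (a b : R) : a <= b -> exp a <= exp b.
Proof. intros [H|H]; [left; apply exp_increasing, H|rewrite H; lra]. Qed.

(** Half of the gap below zero becomes the exponent eps; the other half absorbs the additive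
    constant of [block_beta] as soon as eps ln T >= c. *)
Lemma b_neg_block (Om : C -> Prop) (tau phi dphi : C -> C) (t : R) :
  tract Om tau phi dphi -> square_distortion phi -> 0 < t ->
  Rbar_lt (b_inf_j phi dphi t) (Finite 0) ->
  exists eps T1, 0 < eps /\ 0 < T1 /\ forall T, T1 <= T -> block phi dphi t T <= Rpower T (- eps).
Proof.
  intros TR SD Ht Hb.
  apply Rbar_plus_lt_0, limsup_pinfty_lt in Hb. destruct Hb as [M [e' [He' HM]]].
  destruct (block_beta Om tau phi dphi t TR SD Ht) as [c [T1 [HT1 HB]]].
  set (eps := (- (1 - t) - e') / 2). assert (Heps : 0 < eps) by (unfold eps; lra).
  exists eps, (Rmax (Rmax (M + 1) T1) (exp (c / eps))).
  split; auto. split.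
  { eapply Rlt_le_trans; [apply (exp_pos (c / eps))|apply Rmax_r]. }
  intros T HT.
  assert (Z1 := Rmax_l (Rmax (M + 1) T1) (exp (c / eps))).
  assert (Z2 := Rmax_r (Rmax (M + 1) T1) (exp (c / eps))).
  assert (Z3 := Rmax_l (M + 1) T1). assert (Z4 := Rmax_r (M + 1) T1).
  specialize (HB T ltac:(lra)). specialize (HM T ltac:(lra)). cbv beta in HM.
  assert (HlT : 0 < ln T) by (rewrite <- ln_1; apply ln_increasing; lra).
  assert (Hc : c / eps <= ln T) by (apply ln_ge_of_exp_le; lra).
  assert (Hc' : c <= eps * ln T).
  { apply Rmult_le_compat_r with (r := eps) in Hc; [|lra].
    replace (c / eps * eps) with c in Hc by (field; lra). lra. }
  assert (Pb := block_pos Om tau phi dphi t T TR ltac:(lra)).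
  apply Rabs_le_between in HB.
  assert (L : ln (block phi dphi t T) <= - eps * ln T).
  { assert ((beta (dphiT phi dphi T) (1 / T) t + (1 - t)) * ln T <= - (2 * eps) * ln T).
    { apply Rmult_le_compat_r; [lra|]. unfold eps. lra. }
    nra. }
  rewrite <- (exp_ln (block phi dphi t T)) by auto. unfold Rpower.
  apply exp_le_compat. exact L.
Qed.

(** The factor K only adds ln K, which half of eps ln T absorbs. Allowing it is what makes the
    comparison between different exponents t possible. *)
Lemma block_b_neg (Om : C -> Prop) (tau phi dphi : C -> C) (t eps K T1 : R) :
  tract Om tau phi dphi -> square_distortion phi -> 0 < t -> 0 < eps -> 0 < K ->
  (forall T, T1 <= T -> block phi dphi t T <= K * Rpower T (- eps)) ->
  Rbar_lt (b_inf_j phi dphi t) (Finite 0).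
Proof.
  intros TR SD Ht He HK H.
  destruct (block_beta Om tau phi dphi t TR SD Ht) as [c [T2 [HT2 HB]]].
  apply Rbar_plus_lt_0.
  apply Rbar_le_lt_trans with (Finite (- (1 - t) - eps / 2)); [|simpl; lra].
  apply (limsup_pinfty_le _ (Rmax (Rmax T1 T2) (exp (2 * (ln K + c) / eps)))).
  intros T HT.
  assert (Z1 := Rmax_l (Rmax T1 T2) (exp (2 * (ln K + c) / eps))).
  assert (Z2 := Rmax_r (Rmax T1 T2) (exp (2 * (ln K + c) / eps))).
  assert (Z3 := Rmax_l T1 T2). assert (Z4 := Rmax_r T1 T2).
  specialize (HB T ltac:(lra)). specialize (H T ltac:(lra)).
  assert (HlT : 0 < ln T) by (rewrite <- ln_1; apply ln_increasing; lra).
  assert (Hc : 2 * (ln K + c) / eps <= ln T) by (apply ln_ge_of_exp_le; lra).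
  assert (Hc' : 2 * (ln K + c) <= eps * ln T).
  { apply Rmult_le_compat_r with (r := eps) in Hc; [|lra].
    replace (2 * (ln K + c) / eps * eps) with (2 * (ln K + c)) in Hc by (field; lra). lra. }
  assert (Pb := block_pos Om tau phi dphi t T TR ltac:(lra)).
  assert (L : ln (block phi dphi t T) <= ln K - eps * ln T).
  { replace (ln K - eps * ln T) with (ln (K * Rpower T (- eps))).
    - apply ln_le; auto.
    - rewrite ln_mult; [unfold Rpower; rewrite ln_exp; ring|auto|apply Rpower_pos]. }
  apply Rabs_le_between in HB.
  apply Rmult_le_reg_r with (ln T); auto. nra.
Qed.

(** A positive upper limit guarantees growth only along some arbitrarily large T, which is enough
    for divergence of a sum of positive terms. *)
Lemma b_pos_block (Om : C -> Prop) (tau phi dphi : C -> C) (t : R) :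
  tract Om tau phi dphi -> square_distortion phi -> 0 < t ->
  Rbar_lt (Finite 0) (b_inf_j phi dphi t) ->
  exists eps, 0 < eps /\ forall M, exists T, M < T /\ 0 < T /\ Rpower T eps <= block phi dphi t T.
Proof.
  intros TR SD Ht Hb.
  apply Rbar_plus_gt_0, limsup_pinfty_gt in Hb. destruct Hb as [e' [He' HM]].
  destruct (block_beta Om tau phi dphi t TR SD Ht) as [c [T1 [HT1 HB]]].
  set (eps := (e' - - (1 - t)) / 2). assert (Heps : 0 < eps) by (unfold eps; lra).
  exists eps. split; auto. intros M.
  destruct (HM (Rmax (Rmax M T1) (exp (c / eps)))) as [T [HT Hg]].
  assert (Z1 := Rmax_l (Rmax M T1) (exp (c / eps))).
  assert (Z2 := Rmax_r (Rmax M T1) (exp (c / eps))).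
  assert (Z3 := Rmax_l M T1). assert (Z4 := Rmax_r M T1).
  exists T. split; [lra|]. split; [lra|].
  specialize (HB T ltac:(lra)).
  assert (HlT : 0 < ln T) by (rewrite <- ln_1; apply ln_increasing; lra).
  assert (Hc : c / eps <= ln T) by (apply ln_ge_of_exp_le; lra).
  assert (Hc' : c <= eps * ln T).
  { apply Rmult_le_compat_r with (r := eps) in Hc; [|lra].
    replace (c / eps * eps) with c in Hc by (field; lra). lra. }
  assert (Pb := block_pos Om tau phi dphi t T TR ltac:(lra)).
  apply Rabs_le_between in HB.
  assert (L : eps * ln T <= ln (block phi dphi t T)).
  { assert (2 * eps * ln T <= (beta (dphiT phi dphi T) (1 / T) t + (1 - t)) * ln T).
    { apply Rmult_le_compat_r; [lra|]. unfold eps. lra. }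
    nra. }
  rewrite <- (exp_ln (block phi dphi t T)) by auto. unfold Rpower.
  apply exp_le_compat. exact L.
Qed.

Lemma Rpower_split (a s t : R) : 0 < a -> Rpower a t = Rpower a (t - s) * Rpower a s.
Proof. intros H. rewrite <- Rpower_plus. f_equal. ring. Qed.

Lemma b_neg_monotone (Om : C -> Prop) (tau phi dphi : C -> C) (t t' : R) :
  tract Om tau phi dphi -> square_distortion phi -> 0 < t <= t' ->
  Rbar_lt (b_inf_j phi dphi t) (Finite 0) -> Rbar_lt (b_inf_j phi dphi t') (Finite 0).
Proof.
  intros TR SD Ht Hb.
  destruct (b_neg_block Om tau phi dphi t TR SD ltac:(lra) Hb) as [eps [T1 [He [HT1 HB]]]].
  set (K := Rpower 7000 (t' - t)). assert (HK : 0 < K) by apply Rpower_pos.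
  apply (block_b_neg Om tau phi dphi t' eps K T1); auto; [lra|].
  intros T HT. apply Rle_trans with (K * block phi dphi t T).
  - assert (Pt : forall y, line_pow phi dphi t' y <= K * line_pow phi dphi t y).
    { intros y. unfold line_pow.
      assert (P : 0 < logder phi dphi (1, y)) by (apply (logder_pos Om tau); auto; simpl; lra).
      assert (U : logder phi dphi (1, y) <= 7000).
      { replace 7000 with (7000 / fst ((1, y) : C)) by (simpl; field).
        apply (logder_le Om tau); auto. simpl; lra. }
      rewrite (Rpower_split _ t t') by auto. apply Rmult_le_compat_r; [left; apply Rpower_pos|].
      apply Rpower_le_base; auto; lra. }
    assert (Cp : forall s y, continuous (line_pow phi dphi s) y) by (intros; apply (line_pow_continuous Om tau); auto).
    unfold block. rewrite Rmult_plus_distr_l, <- !(RInt_scal_line K (line_pow phi dphi t)) by auto.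
    apply Rplus_le_compat; apply RInt_le_line; auto; try lra; intros y; apply continuous_mult_const; auto.
  - apply Rmult_le_compat_l; [lra|]. auto.
Qed.

Lemma b_neg_integral_bound (Om : C -> Prop) (tau phi dphi : C -> C) (t : R) :
  tract Om tau phi dphi -> square_distortion phi -> 0 < t ->
  Rbar_lt (b_inf_j phi dphi t) (Finite 0) ->
  exists B, forall u v, u <= v -> RInt (line_pow phi dphi t) u v <= B.
Proof.
  intros TR SD Ht Hb.
  destruct (b_neg_block Om tau phi dphi t TR SD Ht Hb) as [eps [T1 [He [HT1 HB]]]].
  set (a := line_pow phi dphi t) in *.
  assert (Ca : forall y, continuous a y) by (intros; apply (line_pow_continuous Om tau); auto).
  assert (Pa : forall y, 0 <= a y) by (intros; left; apply line_pow_pos).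
  (* The dyadic bound concerns the positive half-line; reflection supplies the other one. *)
  set (a' := fun y => a (- y)).
  assert (Ca' : forall y, continuous a' y).
  { intros y. apply (continuous_comp (fun y => - y) a); auto.
    apply (continuous_opp (K := R_AbsRing) (V := R_NormedModule) (fun y => y)). apply continuous_id. }
  assert (Ea' : forall u v, RInt a' u v = RInt a (- v) (- u)).
  { intros u v.
    assert (E := RInt_comp_lin (V := R_CompleteNormedModule) a (-1) 0 u v (ex_RInt_line _ _ _ Ca)).
    assert (E2 : RInt (fun y => (-1) * a (-1 * y + 0)) u v = RInt (fun y => (-1) * a' y) u v).
    { apply RInt_ext. intros y _. unfold a'. f_equal. f_equal. ring. }
    assert (E3 := RInt_scal_line (-1) a' u v Ca').
    replace (-1 * u + 0) with (- u) in E by ring. replace (-1 * v + 0) with (- v) in E by ring.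
    change (RInt (fun y => (-1) * a (-1 * y + 0)) u v = RInt a (- u) (- v)) in E.
    assert (E4 : RInt a (- v) (- u) = - RInt a (- u) (- v)).
    { symmetry. apply (opp_RInt_swap (V := R_CompleteNormedModule)). apply ex_RInt_line; auto. }
    rewrite E4. lra. }
  assert (Pos : forall u v, u <= v -> 0 <= RInt a u v).
  { intros u v Huv. apply RInt_ge_0; auto. apply ex_RInt_line; auto. }
  destruct (dyadic_integral_bound a eps T1) as [B1 HB1]; auto.
  { intros T HT. specialize (HB T HT). unfold block in HB. fold a in HB.
    assert (Z := Pos (- (2 * T)) (- T) ltac:(lra)). lra. }
  destruct (dyadic_integral_bound a' eps T1) as [B2 HB2]; auto.
  { intros y. unfold a'. auto. }
  { intros T HT. specialize (HB T HT). unfold block in HB. fold a in HB.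
    rewrite Ea'. assert (Z := Pos T (2 * T) ltac:(lra)). lra. }
  exists (B1 + B2). intros u v Huv.
  set (Y := Rmax (Rabs u) (Rabs v)).
  assert (Y1 : Rabs u <= Y) by apply Rmax_l. assert (Y2 : Rabs v <= Y) by apply Rmax_r.
  assert (Q1 := Rabs_pos u). apply Rabs_le_between in Y1. apply Rabs_le_between in Y2.
  eapply Rle_trans; [apply (RInt_nonneg_le a u v (- Y) Y); auto; lra|].
  rewrite <- (RInt_Chasles_line a (- Y) 0) by auto. assert (Z1 := HB1 Y ltac:(lra)). assert (Z2 := HB2 Y ltac:(lra)).
  rewrite Ea', Ropp_0 in Z2. lra.
Qed.

(** * Sums over vertical progressions of preimages *)

Definition vsum (phi dphi : C -> C) (t x th : R) (n : nat) : R :=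
  rsum (fun i => Rpower (logder phi dphi (vshift (x, th) i)) t) (seq 0 n).

Lemma vsum_S (phi dphi : C -> C) (t x th : R) (n : nat) :
  vsum phi dphi t x th (S n) = vsum phi dphi t x th n + Rpower (logder phi dphi (vshift (x, th) n)) t.
Proof. unfold vsum. rewrite seq_S, rsum_app. unfold rsum at 2. simpl. ring. Qed.

(** On a window of length 2 pi the integrand is comparable with its value at the left end, by
    distortion at bounded distance. The constant depends neither on th nor on n. *)
Lemma vsum_integral (Om : C -> Prop) (tau phi dphi : C -> C) (t : R) :
  tract Om tau phi dphi -> 0 <= t -> exists K, 0 < K /\ forall th n,
    vsum phi dphi t 1 th n <= K * RInt (line_pow phi dphi t) th (th + 2 * PI * INR n) /\
    RInt (line_pow phi dphi t) th (th + 2 * PI * INR n) <= K * vsum phi dphi t 1 th n.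
Proof.
  intros TR Ht. assert (P2 : 0 < 2 * PI) by (assert (Z := PI_RGT_0); lra).
  assert (P3 : 2 * PI <= 8) by (assert (Z := PI_4); lra).
  assert (P4 : 1 <= 2 * PI) by (assert (Z := PI2_1); lra).
  destruct (logder_harnack Om tau phi dphi 1 8 TR Rlt_0_1) as [K0 [HK0 HK]].
  set (K1 := Rpower K0 t). assert (HK1 : 0 < K1) by apply Rpower_pos.
  set (a := line_pow phi dphi t).
  assert (Ca : forall y, continuous a y) by (intros; apply (line_pow_continuous Om tau); auto).
  assert (Pa : forall y, 0 < a y) by (intros; apply line_pow_pos).
  assert (Cmp : forall y y', Rabs (y' - y) <= 8 -> a y' <= K1 * a y).
  { intros y y' Hy. unfold a, line_pow, K1.
    assert (Ph : forall z, 0 < logder phi dphi (1, z)) by (intros; apply (logder_pos Om tau); auto; simpl; lra).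
    rewrite Rpower_mult_distr by (auto; lra). apply Rpower_le_base; auto.
    apply HK; simpl; try lra.
    replace ((1, y') - (1, y))%C with (Ci * RtoC (y' - y))%C by (apply injective_projections; simpl; ring).
    rewrite Cmod_mult, Cmod_Ci, Cmod_R. lra. }
  (* The 8 bounds the window length 2 pi; the converse estimate uses that this length is at least
     1. *)
  exists (8 * K1). split; [lra|]. intros th.
  assert (Step : forall z, a z <= K1 * RInt a z (z + 2 * PI) /\ RInt a z (z + 2 * PI) <= 8 * K1 * a z).
  { intros z.
    assert (Cst : forall c, RInt (fun _ => c) z (z + 2 * PI) = 2 * PI * c).
    { intros c. rewrite RInt_const. unfold scal; simpl; unfold mult; simpl. ring. }
    split.
    - assert (L : RInt (fun _ => / K1 * a z) z (z + 2 * PI) <= RInt a z (z + 2 * PI)).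
      { apply RInt_le; [lra|apply ex_RInt_const|apply ex_RInt_line; auto|].
        intros y Hy. assert (Z := Cmp y z ltac:(apply Rabs_le; lra)).
        apply Rmult_le_reg_l with K1; auto. rewrite <- Rmult_assoc, Rinv_r, Rmult_1_l by lra. exact Z. }
      rewrite Cst in L. apply Rmult_le_compat_l with (r := K1) in L; [|lra].
      replace (K1 * (2 * PI * (/ K1 * a z))) with (2 * PI * a z) in L by (field; lra).
      specialize (Pa z). nra.
    - assert (L : RInt a z (z + 2 * PI) <= RInt (fun _ => K1 * a z) z (z + 2 * PI)).
      { apply RInt_le; [lra|apply ex_RInt_line; auto|apply ex_RInt_const|].
        intros y Hy. apply Cmp. apply Rabs_le; lra. }
      rewrite Cst in L. assert (0 < K1 * a z) by (apply Rmult_lt_0_compat; auto). nra. }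
  induction n as [|n [IH1 IH2]].
  - simpl. replace (th + 2 * PI * 0) with th by ring. rewrite RInt_point.
    unfold vsum, rsum, zero; simpl. lra.
  - rewrite vsum_S, S_INR.
    assert (Ch : RInt a th (th + 2 * PI * (INR n + 1)) =
       RInt a th (th + 2 * PI * INR n) + RInt a (th + 2 * PI * INR n) (th + 2 * PI * INR n + 2 * PI)).
    { replace (th + 2 * PI * (INR n + 1)) with (th + 2 * PI * INR n + 2 * PI) by ring.
      symmetry. apply RInt_Chasles_line; auto. }
    rewrite Ch. destruct (Step (th + 2 * PI * INR n)) as [S1 S2].
    change (Rpower (logder phi dphi (vshift (1, th) n)) t) with (a (th + 2 * PI * INR n)).
    assert (Z : 0 <= RInt a (th + 2 * PI * INR n) (th + 2 * PI * INR n + 2 * PI)).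
    { apply RInt_ge_0; [lra|apply ex_RInt_line; auto|]. intros; left; auto. }
    split; [|nra].
    assert (0 <= K1 * RInt a (th + 2 * PI * INR n) (th + 2 * PI * INR n + 2 * PI)) by (apply Rmult_le_pos; lra).
    lra.
Qed.

Lemma vsum_compare (Om : C -> Prop) (tau phi dphi : C -> C) (t a b : R) :
  tract Om tau phi dphi -> 0 <= t -> 0 < a -> exists K, 0 < K /\ forall x y th n,
    a <= x <= b -> a <= y <= b -> vsum phi dphi t x th n <= K * vsum phi dphi t y th n.
Proof.
  intros TR Ht Ha.
  destruct (logder_harnack Om tau phi dphi a (b - a) TR Ha) as [K0 [HK0 HK]].
  exists (Rpower K0 t). split; [apply Rpower_pos|]. intros x y th n Hx Hy.
  unfold vsum. rewrite <- rsum_scal. apply rsum_le. intros i _.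
  rewrite Rpower_mult_distr; [|lra|apply (logder_pos Om tau); auto; simpl; lra].
  apply Rpower_le_base; auto; [apply (logder_pos Om tau); auto; simpl; lra|].
  apply HK; simpl; try lra. rewrite !vshift_eq; simpl.
  replace ((x, th) + (0%R, (2 * PI * INR i)%R) - ((y, th) + (0%R, (2 * PI * INR i)%R)))%C with (RtoC (x - y))
    by (apply injective_projections; simpl; ring).
  rewrite Cmod_R. apply Rabs_le. lra.
Qed.

Lemma b_neg_vsum_bound (Om : C -> Prop) (tau phi dphi : C -> C) (t : R) :
  tract Om tau phi dphi -> square_distortion phi -> 0 < t ->
  Rbar_lt (b_inf_j phi dphi t) (Finite 0) ->
  exists B, 0 < B /\ forall th n, vsum phi dphi t 1 th n <= B.
Proof.
  intros TR SD Ht Hb.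
  destruct (b_neg_integral_bound Om tau phi dphi t TR SD Ht Hb) as [B HB].
  destruct (vsum_integral Om tau phi dphi t TR ltac:(lra)) as [K [HK HV]].
  assert (P2 : 0 < PI) by apply PI_RGT_0.
  exists (K * Rmax B 1). split; [apply Rmult_lt_0_compat; auto; assert (Z := Rmax_r B 1); lra|].
  intros th n. eapply Rle_trans; [apply HV|]. apply Rmult_le_compat_l; [lra|].
  eapply Rle_trans; [|apply Rmax_l]. apply HB. assert (Z := pos_INR n). nra.
Qed.

(* For large x: |logder|^(t - s) decays like x^(s - t), and the s-th power sums stay bounded. *)
Lemma vsum_decay (Om : C -> Prop) (tau phi dphi : C -> C) (s t g : R) :
  tract Om tau phi dphi -> square_distortion phi -> 1 <= s -> s <= t -> 0 < g ->
  Rbar_lt (b_inf_j phi dphi s) (Finite 0) ->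
  exists B, 0 < B /\ forall x th n, g <= x -> vsum phi dphi t x th n <= B * Rpower x (- (t - s)).
Proof.
  intros TR SD Hs Hst Hg Hb.
  destruct (b_neg_vsum_bound Om tau phi dphi s TR SD ltac:(lra) Hb) as [B1 [PB1 HB1]].
  assert (Hbt : Rbar_lt (b_inf_j phi dphi t) (Finite 0)).
  { apply (b_neg_monotone Om tau phi dphi s t TR SD); auto. lra. }
  destruct (b_neg_vsum_bound Om tau phi dphi t TR SD ltac:(lra) Hbt) as [B2 [PB2 HB2]].
  destruct (power_sum_half_plane Om tau phi dphi s B1 TR Hs PB1) as [B3 [PB3 HB3]].
  { intros th n. apply HB1. }
  (* The range from g' to 2 contains the abscissa 1 even when g exceeds it, so one comparison
     constant serves all x <= 2. *)
  set (g' := Rmin g 1). assert (Hg' : 0 < g') by (apply Rmin_pos; lra).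
  assert (Hg1 : g' <= g) by apply Rmin_l. assert (Hg2 : g' <= 1) by apply Rmin_r.
  destruct (vsum_compare Om tau phi dphi t g' 2 TR ltac:(lra) Hg') as [K [HK HV]].
  set (e := t - s). assert (He : 0 <= e) by (unfold e; lra).
  exists (Rpower 7000 e * B3 + K * B2 * Rpower 2 e).
  assert (P1 : 0 < Rpower 7000 e) by apply Rpower_pos. assert (P2 : 0 < Rpower 2 e) by apply Rpower_pos.
  assert (Q1 : 0 < Rpower 7000 e * B3) by (apply Rmult_lt_0_compat; auto).
  assert (Q0 : 0 < K * B2) by (apply Rmult_lt_0_compat; auto).
  assert (Q2 : 0 < K * B2 * Rpower 2 e) by (apply Rmult_lt_0_compat; auto).
  split; [lra|]. intros x th n Hx.
  assert (Px : 0 < Rpower x (- e)) by apply Rpower_pos.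
  destruct (Rle_lt_dec x 2) as [H2|H2].
  (* For x <= 2 boundedness suffices: the factor 2^e keeps the claimed decay term above a
     constant. *)
  - assert (R1 : 1 <= Rpower 2 e * Rpower x (- e)).
    { rewrite Rpower_Ropp. apply Rmult_le_reg_r with (Rpower x e); [apply Rpower_pos|].
      rewrite Rmult_assoc, Rinv_l, Rmult_1_l, Rmult_1_r by (assert (Z := Rpower_pos x e); lra).
      apply Rpower_le_base; lra. }
    eapply Rle_trans; [apply (HV x 1 th n); lra|].
    specialize (HB2 th n).
    apply Rle_trans with (K * B2); [apply Rmult_le_compat_l; lra|].
    assert (K * B2 * 1 <= K * B2 * (Rpower 2 e * Rpower x (- e))) by (apply Rmult_le_compat_l; lra).
    assert (0 < Rpower 7000 e * B3 * Rpower x (- e)) by (apply Rmult_lt_0_compat; auto). nra.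
  - specialize (HB3 x th n ltac:(lra)).
    apply Rle_trans with (Rpower 7000 e * Rpower x (- e) * B3).
    + eapply Rle_trans; [|apply Rmult_le_compat_l; [|exact HB3]].
      2:{ left. apply Rmult_lt_0_compat; auto. }
      unfold vsum. rewrite <- rsum_scal. apply rsum_le. intros i _.
      assert (Pl : 0 < logder phi dphi (vshift (x, th) i)) by (apply (logder_pos Om tau); auto; simpl; lra).
      rewrite (Rpower_split _ s t) by auto. fold e. apply Rmult_le_compat_r; [left; apply Rpower_pos|].
      replace (Rpower x (- e)) with (Rpower (/ x) e).
      2:{ unfold Rpower. f_equal. rewrite ln_Rinv by lra. ring. }
      rewrite Rpower_mult_distr; [|lra|apply Rinv_0_lt_compat; lra].
      apply Rpower_le_base; auto. apply (logder_le Om tau phi dphi (vshift (x, th) i)); auto. simpl. lra.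
    + assert (0 < K * B2 * Rpower 2 e * Rpower x (- e)) by (apply Rmult_lt_0_compat; auto). nra.
Qed.

(** A block occupies both half-lines, so the progression starts N periods below th and runs over 2N
    terms until its window covers [-2T, 2T]. *)
Lemma b_pos_vsum_unbounded (Om : C -> Prop) (tau phi dphi : C -> C) (t x th : R) :
  tract Om tau phi dphi -> square_distortion phi -> 0 < t -> 0 < x ->
  Rbar_lt (Finite 0) (b_inf_j phi dphi t) ->
  forall B, exists N n : nat, B < vsum phi dphi t x (th - 2 * PI * INR N) n.
Proof.
  intros TR SD Ht Hx Hb B.
  destruct (b_pos_block Om tau phi dphi t TR SD Ht Hb) as [eps [He HB]].
  destruct (vsum_integral Om tau phi dphi t TR ltac:(lra)) as [K [HK HV]].
  set (g := Rmin x 1). assert (Hg : 0 < g) by (apply Rmin_pos; lra).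
  assert (Hg1 : g <= x) by apply Rmin_l. assert (Hg2 : g <= 1) by apply Rmin_r.
  destruct (vsum_compare Om tau phi dphi t g (Rmax x 1) TR ltac:(lra) Hg) as [K' [HK' HC]].
  (* K and K' are the costs of passing from the integral to the sum and from Re = 1 to Re = x. The
     block is taken beyond T = D^(1/eps), where T^eps exceeds D. *)
  set (D := Rmax 1 (K * K' * (Rabs B + 1))).
  assert (HD1 : 1 <= D) by apply Rmax_l. assert (HD2 : K * K' * (Rabs B + 1) <= D) by apply Rmax_r.
  destruct (HB (Rpower D (/ eps))) as [T [HT [HT0 HTb]]].
  assert (Big : D <= block phi dphi t T).
  { eapply Rle_trans; [|exact HTb].
    replace D with (Rpower (Rpower D (/ eps)) eps) at 1.
    - apply Rpower_le_base; [apply Rpower_pos|lra|lra].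
    - rewrite Rpower_mult, Rinv_l by lra. apply Rpower_1. lra. }
  assert (P2 : 3 < 2 * PI) by (assert (Z := PI2_3_2); lra).
  set (Y := 2 * T + Rabs th).
  destruct (INR_unbounded Y) as [N HN].
  assert (HN' : Y < INR N) by exact HN.
  assert (Qt := Rabs_pos th). assert (HY : 0 < Y) by (unfold Y; lra).
  exists N, (2 * N)%nat.
  set (th' := th - 2 * PI * INR N).
  assert (I1 : D <= RInt (line_pow phi dphi t) th' (th' + 2 * PI * INR (2 * N))).
  { assert (Ca : forall y, continuous (line_pow phi dphi t) y) by (intros; apply (line_pow_continuous Om tau); auto).
    assert (Pa : forall y, 0 <= line_pow phi dphi t y) by (intros; left; apply line_pow_pos).
    eapply Rle_trans; [exact Big|].
    assert (Hth := Rle_abs th). assert (Hth' := Rle_abs (- th)). rewrite Rabs_Ropp in Hth'.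
    apply Rle_trans with (RInt (line_pow phi dphi t) (- (2 * T)) (2 * T)).
    - unfold block.
      rewrite <- (RInt_Chasles_line _ (- (2 * T)) (- T) (2 * T)) by auto. apply Rplus_le_compat_l. apply RInt_nonneg_le; auto; lra.
    - rewrite mult_INR. simpl (INR 2). apply RInt_nonneg_le; auto; unfold th', Y in *; nra. }
  destruct (HV th' (2 * N)%nat) as [_ V2].
  assert (V3 := HC 1 x th' (2 * N)%nat ltac:(split; [lra|apply Rmax_r]) ltac:(split; [lra|apply Rmax_l])).
  apply Rnot_le_lt. intros L.
  assert (A1 : vsum phi dphi t 1 th' (2 * N) <= K' * B).
  { eapply Rle_trans; [exact V3|]. apply Rmult_le_compat_l; lra. }
  assert (A2 : D <= K * (K' * B)).
  { eapply Rle_trans; [exact I1|]. eapply Rle_trans; [exact V2|]. apply Rmult_le_compat_l; lra. }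
  assert (0 < K * K') by (apply Rmult_lt_0_compat; auto).
  assert (Qb := Rle_abs B). nra.
Qed.

(** * The transfer operator *)

(** The derivative of ln|phi(1 + iy)| is at most |phi'/phi|. It is computed on (1/2) ln(u^2 + v^2),
    with u and v the real and imaginary parts of phi, and bounded by the Cauchy-Schwarz
    inequality. *)
Lemma logder_le_line_integral (Om : C -> Prop) (tau phi dphi : C -> C) (Y : R) :
  tract Om tau phi dphi -> 0 <= Y ->
  ln (Cmod (phi (1, Y))) <= ln (Cmod (phi (1, 0))) + RInt (line_pow phi dphi 1) 0 Y.
Proof.
  intros TR HY. set (a := line_pow phi dphi 1).
  assert (Ca : forall y, continuous a y) by (intros; apply (line_pow_continuous Om tau); auto).
  assert (Ea : forall y, a y = Cmod (dphi (1, y)) / Cmod (phi (1, y))).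
  { intros y. unfold a, line_pow. rewrite Rpower_1; [reflexivity|].
    apply (logder_pos Om tau); auto. simpl; lra. }
  assert (P1 : forall y, 1 < Cmod (phi (1, y))).
  { intros y. apply (tract_phi_gt_1 Om tau phi dphi); auto. simpl; lra. }
  set (u := fun y => Re (1 * phi (1, y))). set (v := fun y => Re (- Ci * phi (1, y))).
  assert (Dp : forall y, is_derive (K := R_AbsRing) (V := C_R_NormedModule) (fun y => phi (1, y)) y (Ci * dphi (1, y))%C).
  { intros y. apply (is_derive_ext (K := R_AbsRing) (V := C_R_NormedModule) (fun y => phi ((1, 0) + RtoC y * Ci)%C)).
    - intros s. f_equal. symmetry. apply vertical_line.
    - apply is_derive_line. replace ((1, 0) + RtoC y * Ci)%C with ((1, y) : C) by apply vertical_line.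
      apply TR. simpl. lra. }
  set (du := fun y => Re (1 * (Ci * dphi (1, y)))). set (dv := fun y => Re (- Ci * (Ci * dphi (1, y)))).
  assert (Du : forall y, is_derive u y (du y)) by (intros; apply is_derive_Re; auto).
  assert (Dv : forall y, is_derive v y (dv y)) by (intros; apply is_derive_Re; auto).
  assert (Sq : forall y, u y * u y + v y * v y = Cmod (phi (1, y)) * Cmod (phi (1, y))).
  { intros y. unfold u, v, Re. destruct (phi (1, y)) as [x1 x2]. unfold Cmod; simpl.
    rewrite sqrt_sqrt; [ring|nra]. }
  assert (Sqd : forall y, du y * du y + dv y * dv y = Cmod (dphi (1, y)) * Cmod (dphi (1, y))).
  { intros y. unfold du, dv, Re. destruct (dphi (1, y)) as [x1 x2]. unfold Cmod; simpl.
    rewrite sqrt_sqrt; [ring|nra]. }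
  set (h := fun y => / 2 * ln (u y * u y + v y * v y)).
  set (dh := fun y => (u y * du y + v y * dv y) / (u y * u y + v y * v y)).
  assert (Dh : forall y, is_derive h y (dh y)).
  { intros y. unfold h, dh.
    assert (Pos : 0 < u y * u y + v y * v y) by (rewrite Sq; specialize (P1 y); nra).
    evar_last.
    - apply is_derive_scal. apply (is_derive_comp ln (fun y => u y * u y + v y * v y)).
      + apply is_derive_Reals. apply derivable_pt_lim_ln. exact Pos.
      + apply (is_derive_plus (K := R_AbsRing) (V := R_NormedModule) (fun y => u y * u y) (fun y => v y * v y)).
        * apply (is_derive_mult (K := R_AbsRing) u u); try apply Du. intros; apply Rmult_comm.
        * apply (is_derive_mult (K := R_AbsRing) v v); try apply Dv. intros; apply Rmult_comm.
    - unfold scal, plus, mult; simpl. unfold mult; simpl. field. lra. }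
  assert (Dle : forall y, dh y <= a y).
  { intros y. unfold dh. rewrite Ea, Sq. specialize (P1 y).
    set (p := Cmod (phi (1, y))) in *. set (d := Cmod (dphi (1, y))) in *.
    assert (Hd : 0 <= d) by apply Cmod_ge_0.
    assert (S1 := Sq y). assert (S2 := Sqd y). fold p in S1. fold d in S2.
    assert (CS : u y * du y + v y * dv y <= p * d).
    { apply Rsqr_incr_0_var; [|nra]. unfold Rsqr.
      replace (p * d * (p * d)) with ((p * p) * (d * d)) by ring. rewrite <- S1, <- S2.
      assert (0 <= (u y * dv y - v y * du y) * (u y * dv y - v y * du y)) by apply Rle_0_sqr. nra. }
    apply Rmult_le_reg_r with (p * p); [nra|]. unfold Rdiv. rewrite Rmult_assoc, Rinv_l by nra.
    replace (d * / p * (p * p)) with (p * d) by (field; lra). lra. }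
  set (k := fun y => RInt a 0 y - h y).
  assert (Dk : forall y, is_derive k y (a y - dh y)).
  { intros y. apply (is_derive_minus (K := R_AbsRing) (V := R_NormedModule) (fun y => RInt a 0 y) h); auto.
    apply (is_derive_RInt (V := R_NormedModule) a (fun y => RInt a 0 y) 0 y); auto.
    apply filter_forall. intros x. apply (RInt_correct (V := R_CompleteNormedModule)).
    apply ex_RInt_line; auto. }
  assert (Hh : forall y, h y = ln (Cmod (phi (1, y)))).
  { intros y. unfold h. rewrite Sq, ln_mult by (specialize (P1 y); lra). field. }
  destruct (MVT_gen k 0 Y (fun y => a y - dh y)) as [c [_ E]].
  - intros x _. apply Dk.
  - intros x _. apply continuity_pt_filterlim. apply (ex_derive_continuous (K := R_AbsRing) (V := R_NormedModule)).
    eexists; apply Dk.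
  - unfold k in E. rewrite RInt_point, !Hh in E. unfold zero in E; simpl in E.
    assert (0 <= (a c - dh c) * (Y - 0)) by (apply Rmult_le_pos; [specialize (Dle c); lra|lra]). lra.
Qed.

(** * From class D to its tracts *)

Lemma classD_tract (N : nat) (Om : nat -> C -> Prop) (tau phi dphi : nat -> C -> C) (f df : C -> C) (j : nat) :
  classD N Om tau phi dphi f df -> (j < N)%nat -> tract (Om j) (tau j) (phi j) (dphi j).
Proof.
  intros [_ [[H1 [_ [_ [H4 _]]]] [Hd Hc]]] Hj.
  destruct (H1 j Hj) as [C1 [C2 C3]].
  repeat split; try apply C3; try apply C2; auto.
  - intros z Hz. destruct (C1 z Hz) as [l Hl]. exists l. apply is_derive_cdiff. exact Hl.
  - destruct Hc as [[_ [_ [D _]]]|[_ [D _]]]; [apply (D j Hj)|apply (proj1 (D j Hj))].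
  - intros z Hz. apply H4. intros eps He. exists z. split; [exists j; auto|].
    rewrite Cmod_self. exact He.
  - intros xi Hxi. apply is_derive_cdiff. auto.
Qed.

(** Equal sines and cosines give cos of the difference equal to 1, hence sin of half the difference
    equal to 0, whose zeros are the multiples of pi. *)
Lemma Cexp_eq (a b : C) : Cexp a = Cexp b -> fst a = fst b /\ exists k : Z, snd a = snd b + 2 * PI * IZR k.
Proof.
  intros E. assert (E1 : fst a = fst b).
  { apply exp_inv. rewrite <- !Cmod_Cexp, E. reflexivity. }
  split; auto. unfold Cexp in E. rewrite E1 in E. injection E as Ec Es.
  assert (P := exp_pos (fst b)).
  apply Rmult_eq_reg_l in Ec; [|lra]. apply Rmult_eq_reg_l in Es; [|lra].
  assert (Z0 : sin ((snd a - snd b) / 2) = 0).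
  { assert (H : cos (2 * ((snd a - snd b) / 2)) = 1).
    { replace (2 * ((snd a - snd b) / 2)) with (snd a - snd b) by field.
      rewrite cos_minus, Ec, Es. rewrite <- (sin2_cos2 (snd b)). unfold Rsqr. ring. }
    rewrite cos_2a_sin in H. nra. }
  apply sin_eq_0_0 in Z0. destruct Z0 as [k Hk]. exists k. lra.
Qed.

(* Points phi_j(1 + 2 pi i n) all lie over e; a finite accumulation point would lie in some tract,
   where tau_j is continuous. *)
Lemma classD_line_unbounded (N : nat) (Om : nat -> C -> Prop) (tau phi dphi : nat -> C -> C)
    (f df : C -> C) (j : nat) (M : R) :
  classD N Om tau phi dphi f df -> (j < N)%nat -> (forall y, 0 <= y -> Cmod (phi j (1, y)) <= M) -> False.
Proof.
  intros HD Hj HM. assert (TR := classD_tract _ _ _ _ _ _ _ j HD Hj).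
  destruct HD as [_ [[H1 [H2 [H3 _]]] [_ Hc]]].
  assert (PP := PI_RGT_0).
  destruct Hc as [[F1 [_ [F3 F4]]]|[_ [_ F]]].
  - set (zs := fun n : nat => phi j (1, 2 * PI * INR n)).
    assert (Oz : forall n, Om j (zs n)) by (intros; apply TR; simpl; lra).
    assert (Tz : forall n, tau j (zs n) = (1, 2 * PI * INR n)) by (intros; apply TR; simpl; lra).
    assert (Fz : forall n, f (zs n) = Cexp 1).
    { intros n. rewrite (H2 j Hj _ (Oz n)), Tz. unfold Cexp; simpl.
      replace (2 * PI * INR n) with (0 + 2 * INR n * PI) by ring.
      rewrite cos_period, sin_period. reflexivity. }
    (* Around each point of the square there is a disc of radius 2d free of all [zs n] with n >=
       1/d. A uniform d then excludes every large n, although all [zs n] lie in the square. *)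
    destruct (lebesgue_number_2d (- M) M (- M) M (fun u v d =>
       forall n, 1 <= INR n * d -> 2 * d <= Cmod (zs n - (u, v)))) as [d [Hd K]].
    { intros u v _ _. set (z := (u, v) : C).
      assert (Cf : ccont f z) by (apply (cdiff_ccont _ _ (df z)), is_derive_cdiff, F1).
      destruct (Ceq_dec (f z) (Cexp 1)) as [E|n0].
      - assert (He : ext_disk (f z)).
        { rewrite E. unfold ext_disk. rewrite Cmod_Cexp. simpl. rewrite <- exp_0 at 1. apply exp_increasing. lra. }
        apply F4 in He. destruct He as [k [Hk Oz0]].
        destruct (F3 k Hk) as [_ [Ok _]]. destruct (Ok z Oz0) as [e [He Ke]].
        destruct (proj1 (H1 k Hk) z Oz0) as [m Hm]. apply is_derive_cdiff in Hm.
        destruct (cdiff_ccont _ _ _ Hm 1 Rlt_0_1) as [e2 [He2 Ke2]].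
        (* Near z, tau_k stays within 1 of tau_k(z), while tau_j(zs n) = 1 + 2 pi i n. So a nearby
           [zs n], for which k = j by disjointness, has n < L, and d <= 1/L excludes n >= 1/d. *)
        set (L := Cmod (tau k z) + 2).
        assert (HL : 2 <= L) by (unfold L; assert (Z := Cmod_ge_0 (tau k z)); lra).
        assert (IL : 0 < / L) by (apply Rinv_0_lt_compat; lra).
        set (d := Rmin (/ L) (Rmin (e / 2) (e2 / 2))).
        assert (D1 : d <= / L) by apply Rmin_l.
        assert (D2 : d <= e / 2) by (eapply Rle_trans; [apply Rmin_r|apply Rmin_l]).
        assert (D3 : d <= e2 / 2) by (eapply Rle_trans; [apply Rmin_r|apply Rmin_r]).
        exists d. split; [repeat apply Rmin_pos; lra|].
        intros n Hn. apply Rnot_lt_le. intros Hlt.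
        assert (Ozk : Om k (zs n)) by (apply Ke; lra).
        assert (Ekj : k = j).
        { destruct (Nat.eq_dec k j) as [|n1]; auto. exfalso. apply (H3 k j Hk Hj n1 (zs n)); auto. }
        specialize (Ke2 (zs n) ltac:(lra)). rewrite Ekj in Ke2 at 1. rewrite Tz in Ke2.
        assert (Z := Cmod_sub_le (1, 2 * PI * INR n) (tau k z)).
        assert (Z2 := Rabs_snd_le (1, 2 * PI * INR n)). simpl in Z2.
        assert (Pn := pos_INR n). rewrite Rabs_pos_eq in Z2 by nra.
        assert (Hn1 : INR n < L) by (unfold L; assert (W := PI2_1); nra).
        assert (INR n * d <= INR n * / L) by (apply Rmult_le_compat_l; lra).
        assert (INR n * / L < 1).
        { apply Rmult_lt_reg_r with L; [lra|]. rewrite Rmult_assoc, Rinv_l by lra. lra. }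
        lra.
      (* If f(z) differs from e, continuity of f alone keeps a neighbourhood free of the points
         [zs n]. *)
      - assert (Pos := proj1 (Cmod_gt_0 _) (Cminus_neq_0 _ _ n0)).
        destruct (Cf _ Pos) as [e [He Ke]]. exists (e / 2). split; [lra|].
        intros n _. apply Rnot_lt_le. intros Hlt.
        specialize (Ke (zs n) ltac:(unfold z in *; lra)). rewrite Fz, Cmod_minus_sym in Ke. lra. }
    destruct (INR_unbounded (/ d)) as [n Hn]. apply Rgt_lt in Hn.
    assert (Bz : Cmod (zs n) <= M) by (apply HM; assert (Z := pos_INR n); nra).
    assert (B1 := Rabs_fst_le (zs n)). assert (B2 := Rabs_snd_le (zs n)).
    assert (B1' : Rabs (fst (zs n)) <= M) by lra. assert (B2' : Rabs (snd (zs n)) <= M) by lra.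
    apply Rabs_le_between in B1'. apply Rabs_le_between in B2'.
    destruct (K (fst (zs n)) (snd (zs n)) B1' B2') as [u [v [e [_ [_ [Q1 [Q2 [Q3 Q4]]]]]]]].
    assert (1 <= INR n * e).
    { apply Rmult_lt_compat_r with (r := d) in Hn; auto. rewrite Rinv_l in Hn by lra.
      assert (Pn := pos_INR n). nra. }
    specialize (Q4 n H). assert (Z := Cmod_le_sum (zs n - (u, v))). simpl in Z.
    unfold Rminus in Q1, Q2. lra.
  (* For a model function the properness of phi_j at infinity is part of the definition. *)
  - assert (X := F j Hj (fun n => (1, INR n))).
    assert (U : is_lim_seq (fun n => Cmod (phi j (1, INR n))) p_infty).
    { apply X; [intros n; unfold right_half_plane; simpl; lra|].
      apply (is_lim_seq_le_p_loc INR); [|apply is_lim_seq_INR].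
      exists O. intros n _. eapply Rle_trans; [apply Rle_abs|]. apply (Rabs_snd_le (1, INR n)). }
    apply is_lim_seq_spec in U. destruct (U M) as [n0 Hn0]. specialize (Hn0 n0 (le_n _)).
    specialize (HM (INR n0) (pos_INR n0)). lra.
Qed.

Lemma b_1_not_neg (N : nat) (Om : nat -> C -> Prop) (tau phi dphi : nat -> C -> C)
    (f df : C -> C) (j : nat) :
  classD N Om tau phi dphi f df -> (j < N)%nat -> ~ Rbar_lt (b_inf_j (phi j) (dphi j) 1) (Finite 0).
Proof.
  intros HD Hj Hb. assert (TR := classD_tract _ _ _ _ _ _ _ j HD Hj).
  assert (SD : square_distortion (phi j)).
  { destruct HD as [_ [[_ [_ [_ [_ H5]]]] _]]. exact (H5 j Hj). }
  destruct (b_neg_integral_bound _ _ _ _ 1 TR SD Rlt_0_1 Hb) as [B HB].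
  apply (classD_line_unbounded N Om tau phi dphi f df j (exp (ln (Cmod (phi j (1, 0))) + B)) HD Hj).
  intros y Hy. assert (P := tract_phi_gt_1 _ _ _ _ (1, y) TR ltac:(simpl; lra)).
  rewrite <- (exp_ln (Cmod (phi j (1, y)))) by lra.
  assert (L := logder_le_line_integral _ _ _ _ y TR Hy). specialize (HB 0 y Hy).
  assert (L' : ln (Cmod (phi j (1, y))) <= ln (Cmod (phi j (1, 0))) + B) by lra.
  apply exp_le_compat, L'.
Qed.

Lemma fold_Rmax_in (l : list R) (x0 : R) : In (fold_right Rmax x0 l) (x0 :: l).
Proof.
  induction l as [|y l IH]; simpl; [auto|]. unfold Rmax. destruct (Rle_dec _ _); simpl in IH; tauto.
Qed.

Lemma fold_Rbar_max_lt (l : list Rbar) (x : Rbar) (c : Rbar) :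
  Rbar_lt (fold_right Rbar_max m_infty l) c -> In x l -> Rbar_lt x c.
Proof.
  induction l as [|y l IH]; simpl; [tauto|]. unfold Rbar_max at 1.
  destruct (Rbar_le_dec y (fold_right Rbar_max m_infty l)) as [h|h]; intros H [E|E].
  - subst y. eapply Rbar_le_lt_trans; eauto.
  - auto.
  - subst y. auto.
  - apply IH; auto. eapply Rbar_lt_trans; [|exact H]. apply Rbar_not_le_lt. exact h.
Qed.

Lemma rsum_map {S T : Type} (F : T -> R) (h : S -> T) (l : list S) :
  rsum F (map h l) = rsum (fun i => F (h i)) l.
Proof. unfold rsum. rewrite map_map. reflexivity. Qed.

Lemma rsum_flat_map {S T : Type} (F : T -> R) (g : S -> list T) (l : list S) :
  rsum F (flat_map g l) = rsum (fun j => rsum F (g j)) l.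
Proof.
  induction l as [|i l IH]; [reflexivity|]. simpl. rewrite rsum_app, IH. reflexivity.
Qed.

Lemma rsum_const {T : Type} (c : R) (l : list T) : rsum (fun _ => c) l = INR (length l) * c.
Proof.
  unfold rsum. induction l as [|i l IH]; [simpl; ring|]. cbn [map fold_right length].
  rewrite IH, S_INR. ring.
Qed.

Lemma rsum_incl {T : Type} (F : T -> R) (l l' : list T) : (forall x, 0 <= F x) ->
  NoDup l -> incl l l' -> rsum F l <= rsum F l'.
Proof.
  intros HF. revert l'. induction l as [|x l IH]; intros l' Hn Hi.
  - apply rsum_nonneg. auto.
  - inversion Hn as [|y m Hx Hm]; subst.
    destruct (in_split x l') as [l1 [l2 E]]; [apply Hi; simpl; auto|]. subst l'.
    assert (IHl : rsum F l <= rsum F (l1 ++ l2)).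
    { apply IH; auto. intros y Hy. assert (Z := Hi y (or_intror Hy)).
      apply in_app_iff in Z. apply in_app_iff. destruct Z as [Z|[Z|Z]]; auto.
      subst y. contradiction. }
    rewrite rsum_app in *. change (rsum F (x :: l)) with (F x + rsum F l).
    change (rsum F (x :: l2)) with (F x + rsum F l2). lra.
Qed.

(** In a tract f' = f tau' and phi'(tau) tau' = 1, so |f'(z)|_1 = |tau'(z)| |z| = |phi|/|phi'| at
    tau(z). *)
Lemma logderiv_norm_tract (N : nat) (Om : nat -> C -> Prop) (tau phi dphi : nat -> C -> C)
    (f df : C -> C) (j : nat) (z : C) (t : R) :
  classD N Om tau phi dphi f df -> (j < N)%nat -> Om j z ->
  Rpower (logderiv_norm f df z) (- t) = Rpower (logder (phi j) (dphi j) (tau j z)) t.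
Proof.
  intros HD Hj Hz. assert (TR := classD_tract _ _ _ _ _ _ _ j HD Hj).
  destruct HD as [_ [[H1 [H2 _]] [_ Hc]]].
  assert (Df : cdiff f z (df z)).
  { apply is_derive_cdiff. destruct Hc as [[F _]|[F _]]; apply F. exists j; auto. }
  assert (TR' := TR). destruct TR as [T1 [T2 [T3 [T4 [T5 T6]]]]].
  destruct (T2 z Hz) as [Hpos Ephi]. destruct (T3 z Hz) as [m Hm]. destruct (T4 z Hz) as [d [Hd Kd]].
  assert (E1 : df z = (Cexp (tau j z) * m)%C).
  { apply (cdiff_unique f z); auto.
    apply (cdiff_ext_loc (fun u => Cexp (tau j u)) f z _ d); auto.
    - intros u Hu. symmetry. apply (H2 j Hj). auto.
    - apply (cdiff_comp Cexp (tau j)); auto. apply cdiff_Cexp. }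
  assert (E2 : (dphi j (tau j z) * m)%C = 1).
  { apply (cdiff_unique (fun u => phi j (tau j u)) z).
    - apply (cdiff_comp (phi j) (tau j)); auto.
    - apply (cdiff_ext_loc (fun u => u) _ z 1 d); auto.
      + intros u Hu. symmetry. apply T2. auto.
      + apply cdiff_id. }
  assert (Pz := T5 z Hz).
  assert (M2 : Cmod (dphi j (tau j z)) * Cmod m = 1) by (rewrite <- Cmod_mult, E2; apply Cmod_1).
  assert (Pd : 0 < Cmod (dphi j (tau j z))) by (apply (tract_bounds _ _ _ _ _ TR' Hpos)).
  assert (EL : logderiv_norm f df z = / logder (phi j) (dphi j) (tau j z)).
  { unfold logderiv_norm, logder. rewrite Ephi, (H2 j Hj z Hz), E1, Cmod_mult.
    assert (Pe : 0 < Cmod (Cexp (tau j z))) by (rewrite Cmod_Cexp; apply exp_pos).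
    replace (Cmod m) with (/ Cmod (dphi j (tau j z))).
    - field. repeat split; lra.
    - apply Rmult_eq_reg_l with (Cmod (dphi j (tau j z))); [|lra]. rewrite M2. field. lra. }
  rewrite EL. assert (Pl := logder_pos _ _ _ _ _ TR' Hpos).
  unfold Rpower. f_equal. rewrite ln_Rinv by auto. ring.
Qed.

(** Any finite list of preimages of w is contained in the union, over the tracts, of the images of
    one common window of consecutive vertical translates; positivity of the terms does the rest. *)
Lemma transfer1_le (N : nat) (Om : nat -> C -> Prop) (tau phi dphi : nat -> C -> C)
    (f df : C -> C) (t B : R) (w : C) :
  classD N Om tau phi dphi f df ->
  (forall j th n, (j < N)%nat -> vsum (phi j) (dphi j) t (ln (Cmod w)) th n <= B) ->
  Rbar_le (transfer1 N Om f df t w) (Finite (INR N * B)).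
Proof.
  intros HD HB.
  assert (PN : (0 < N)%nat) by apply HD.
  (* The case n = 0 of the hypothesis is an empty sum. *)
  assert (B0 : 0 <= B) by (specialize (HB O 0 O PN); exact HB).
  apply (Lub_Rbar_correct). intros s [l [Hnd [Hl Es]]]. subst s.
  assert (PINR := pos_INR N). assert (PP := PI_RGT_0).
  (* For a nonempty list the base height is read off from one preimage z0, so no argument of w has
     to be chosen. *)
  destruct l as [|z0 l0]; [simpl; apply Rmult_le_pos; auto|].
  set (l := z0 :: l0) in *. set (F := fun z => Rpower (logderiv_norm f df z) (- t)).
  destruct (proj1 (Hl z0 (or_introl eq_refl))) as [j0 [Hj0 Oz0]].
  set (th0 := snd (tau j0 z0)). set (x := ln (Cmod w)).
  assert (Loc : forall z, In z l -> exists j (k : Z), (j < N)%nat /\ z = phi j (x, th0 + 2 * PI * IZR k)).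
  { intros z Hz. destruct (Hl z Hz) as [[j [Hj Oz]] Fz].
    destruct (Hl z0 (or_introl eq_refl)) as [_ Fz0].
    assert (HDc := HD). destruct HDc as [_ [[_ [H2 _]] _]].
    rewrite (H2 j Hj z Oz) in Fz. rewrite (H2 j0 Hj0 z0 Oz0) in Fz0.
    destruct (Cexp_eq (tau j z) (tau j0 z0)) as [_ [k Hk]]; [congruence|].
    exists j, k. split; auto.
    assert (Ex : fst (tau j z) = x).
    { unfold x. rewrite <- Fz, Cmod_Cexp, ln_exp. reflexivity. }
    assert (TR := classD_tract _ _ _ _ _ _ _ j HD Hj).
    replace (x, th0 + 2 * PI * IZR k) with (tau j z).
    - symmetry. apply TR. auto.
    - unfold th0. rewrite <- Ex, <- Hk. apply surjective_pairing. }
  assert (Bd : exists K : nat, forall z, In z l -> exists j (k : Z), (j < N)%nat /\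
     z = phi j (x, th0 + 2 * PI * IZR k) /\ (- Z.of_nat K <= k <= Z.of_nat K)%Z).
  { revert Loc. generalize l as m. induction m as [|z m IH]; intros Loc.
    - exists O. intros z [].
    - destruct IH as [K HK]; [intros; apply Loc; simpl; auto|].
      destruct (Loc z (or_introl eq_refl)) as [j [k [Hj Ez]]].
      exists (K + Z.to_nat (Z.abs k))%nat. intros y [Ey|Hy].
      + subst y. exists j, k. split; auto. split; auto. lia.
      + destruct (HK y Hy) as [j' [k' [A1 [A2 A3]]]]. exists j', k'. split; auto. split; auto. lia. }
  destruct Bd as [K HK].
  (* Starting K periods lower turns the integers from -K to K into the indices 0 to 2K, whence the
     length 2K + 1. *)
  set (th := th0 - 2 * PI * INR K).
  set (l' := flat_map (fun j => map (fun i => phi j (vshift (x, th) i)) (seq 0 (2 * K + 1))) (seq 0 N)).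
  change (Rbar_le (Finite (rsum F l)) (Finite (INR N * B))). simpl.
  apply Rle_trans with (rsum F l').
  - apply rsum_incl; auto.
    + intros z. left. apply Rpower_pos.
    + intros z Hz. destruct (HK z Hz) as [j [k [Hj [Ez Hk]]]].
      apply in_flat_map. exists j. split; [apply in_seq; lia|].
      apply in_map_iff. exists (Z.to_nat (k + Z.of_nat K)). split; [|apply in_seq; lia].
      rewrite Ez. f_equal. unfold vshift; cbn [fst snd]. f_equal. unfold th.
      rewrite (INR_IZR_INZ (Z.to_nat _)), Z2Nat.id by lia.
      rewrite plus_IZR, <- INR_IZR_INZ. ring.
  - unfold l'. rewrite rsum_flat_map.
    apply Rle_trans with (rsum (fun _ : nat => B) (seq 0 N)).
    + apply rsum_le. intros j Hj. apply in_seq in Hj. assert (Hj' : (j < N)%nat) by lia.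
      rewrite rsum_map. eapply Rle_trans; [|apply (HB j th (2 * K + 1)%nat Hj')].
      right. apply rsum_ext. intros i _. unfold F.
      assert (TR := classD_tract _ _ _ _ _ _ _ j HD Hj').
      assert (Hx : 0 < x).
      { unfold x. destruct (Hl z0 (or_introl eq_refl)) as [_ Fz0].
        assert (HDc := HD). destruct HDc as [_ [[_ [H2 _]] _]].
        rewrite (H2 j0 Hj0 z0 Oz0) in Fz0. rewrite <- Fz0, Cmod_Cexp, ln_exp.
        apply (classD_tract _ _ _ _ _ _ _ j0 HD Hj0). exact Oz0. }
      destruct (proj1 TR (vshift (x, th) i) Hx) as [O1 O2].
      rewrite (logderiv_norm_tract N Om tau phi dphi f df j _ t HD Hj' O1), O2. reflexivity.
    + rewrite rsum_const, length_seq. lra.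
Qed.

(** The n translates give distinct preimages, because tau_j separates them, and hence an admissible
    list in the supremum. *)
Lemma transfer1_ge (N : nat) (Om : nat -> C -> Prop) (tau phi dphi : nat -> C -> C)
    (f df : C -> C) (t x th : R) (j n : nat) :
  classD N Om tau phi dphi f df -> (j < N)%nat -> 0 < x ->
  Rbar_le (Finite (vsum (phi j) (dphi j) t x th n)) (transfer1 N Om f df t (Cexp (x, th))).
Proof.
  intros HD Hj Hx. assert (TR := classD_tract _ _ _ _ _ _ _ j HD Hj). assert (PP := PI_RGT_0).
  assert (HV : forall i, Om j (phi j (vshift (x, th) i)) /\ tau j (phi j (vshift (x, th) i)) = vshift (x, th) i).
  { intros i. apply TR. exact Hx. }
  apply (Lub_Rbar_correct).
  exists (map (fun i => phi j (vshift (x, th) i)) (seq 0 n)). split; [|split].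
  - apply FinFun.Injective_map_NoDup; [|apply seq_NoDup]. intros i k E.
    apply (f_equal (tau j)) in E. rewrite (proj2 (HV i)), (proj2 (HV k)) in E.
    apply (f_equal snd) in E. simpl in E. apply INR_eq. nra.
  - intros z Hz. apply in_map_iff in Hz. destruct Hz as [i [Ez _]]. subst z.
    split; [exists j; split; auto; apply HV|].
    destruct HD as [_ [[_ [H2 _]] _]]. rewrite (H2 j Hj _ (proj1 (HV i))), (proj2 (HV i)).
    unfold Cexp, vshift; cbn [fst snd].
    replace (th + 2 * PI * INR i) with (th + 2 * INR i * PI) by ring.
    rewrite cos_period, sin_period. reflexivity.
  - change (vsum (phi j) (dphi j) t x th n = rsum (fun z => Rpower (logderiv_norm f df z) (- t))
      (map (fun i => phi j (vshift (x, th) i)) (seq 0 n))).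
    rewrite rsum_map. apply rsum_ext. intros i _.
    rewrite (logderiv_norm_tract N Om tau phi dphi f df j _ t HD Hj (proj1 (HV i))), (proj2 (HV i)).
    reflexivity.
Qed.

(** Divergence is claimed for every t < Theta, also for t <= 0, which the block estimates exclude.
    There the bound [logder] <= 7000/x makes each term at least the positive constant (7000/x)^t. *)
Lemma vsum_unbounded_nonpos (Om : C -> Prop) (tau phi dphi : C -> C) (t x th : R) :
  tract Om tau phi dphi -> t <= 0 -> 0 < x -> forall B, exists n, B < vsum phi dphi t x th n.
Proof.
  intros TR Ht Hx B. set (c := Rpower (7000 / x) t). assert (Hc : 0 < c) by apply Rpower_pos.
  destruct (INR_unbounded (B / c)) as [n Hn]. exists n.
  apply Rgt_lt in Hn. apply Rmult_lt_compat_r with (r := c) in Hn; auto.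
  replace (B / c * c) with B in Hn by (field; lra).
  eapply Rlt_le_trans; [exact Hn|]. rewrite <- (length_seq n 0) at 1. rewrite <- rsum_const.
  apply rsum_le. intros i _. unfold c.
  assert (P : 0 < logder phi dphi (vshift (x, th) i)) by (apply (logder_pos Om tau); auto).
  assert (U : logder phi dphi (vshift (x, th) i) <= 7000 / x).
  { apply (logder_le Om tau phi dphi (vshift (x, th) i)); auto. }
  replace t with (- - t) by ring. rewrite !(Rpower_Ropp _ (- t)).
  apply Rinv_le_contravar; [apply Rpower_pos|]. apply Rpower_le_base; auto. lra.
Qed.

(** The closure may be unbounded, so compactness is used only on the square [-2, 2]^2; outside it
    the modulus already exceeds 2. The result keeps ln|w| away from 0, where the decay estimate
    would degenerate. *)
Lemma closure_distance (A : C -> Prop) : (forall w, closureC A w -> 1 < Cmod w) ->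
  exists g, 0 < g /\ forall w, closureC A w -> g <= ln (Cmod w).
Proof.
  intros H.
  destruct (lebesgue_number_2d (-2) 2 (-2) 2 (fun u v d =>
     forall z, A z -> Cmod (z - (u, v)) < 2 * d -> 1 + d <= Cmod z)) as [d [Hd K]].
  { intros u v _ _. destruct (Rle_lt_dec (Cmod (u, v)) 1) as [h|h].
    - assert (X : exists e, 0 < e /\ forall z, A z -> e <= Cmod (z - (u, v))).
      (* A point of the closed unit disc is at positive distance from the set, since it would
         otherwise belong to the closure. *)
      { apply NNPP. intros Nn. assert (C1 : closureC A (u, v)); [|specialize (H _ C1); lra].
        intros e He. apply NNPP. intros Nn2. apply Nn. exists e. split; auto.
        intros z Hz. apply Rnot_lt_le. intros L. apply Nn2. exists z. auto. }
      destruct X as [e [He Ke]]. exists (e / 2). split; [lra|]. intros z Hz Hlt.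
      specialize (Ke z Hz). lra.
    - exists ((Cmod (u, v) - 1) / 4). split; [lra|]. intros z Hz Hlt.
      assert (T := Cmod_sub_le (u, v) z). rewrite Cmod_minus_sym in T. lra. }
  set (d' := Rmin d 1). assert (Hd' : 0 < d') by (apply Rmin_pos; lra).
  assert (L1 : d' <= d) by apply Rmin_l. assert (L2 : d' <= 1) by apply Rmin_r.
  assert (HA : forall z, A z -> 1 + d' <= Cmod z).
  { intros z Hz. destruct (Rle_lt_dec (Cmod z) 2) as [h|h]; [|lra].
    assert (B1 := Rabs_fst_le z). assert (B2 := Rabs_snd_le z).
    assert (B1' : Rabs (fst z) <= 2) by lra. assert (B2' : Rabs (snd z) <= 2) by lra.
    apply Rabs_le_between in B1'. apply Rabs_le_between in B2'.
    destruct (K (fst z) (snd z) ltac:(lra) ltac:(lra)) as [u [v [e [_ [_ [Q1 [Q2 [Q3 Q4]]]]]]]].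
    assert (T := Cmod_le_sum (z - (u, v))). simpl in T. unfold Rminus in Q1, Q2.
    specialize (Q4 z Hz ltac:(lra)). lra. }
  exists (ln (1 + d')). split; [rewrite <- ln_1; apply ln_increasing; lra|].
  intros w Hw.
  assert (Hw' : 1 + d' <= Cmod w).
  { apply Rnot_lt_le. intros L. destruct (Hw (1 + d' - Cmod w)) as [z [Hz Hzw]]; [lra|].
    specialize (HA z Hz). assert (T := Cmod_sub_le z w). lra. }
  apply ln_le; lra.
Qed.

Lemma finite_uniform_bound (N : nat) (P : nat -> R -> Prop) :
  (forall j B B', P j B -> B <= B' -> P j B') -> (forall j, (j < N)%nat -> exists B, P j B) ->
  exists B, forall j, (j < N)%nat -> P j B.
Proof.
  intros Hm. induction N as [|N IH]; intros H.
  - exists 0. intros j Hj. lia.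
  - destruct IH as [B1 H1]; [intros; apply H; lia|]. destruct (H N ltac:(lia)) as [B2 H2].
    exists (Rmax B1 B2). intros j Hj. destruct (Nat.eq_dec j N) as [E|n].
    + subst j. apply (Hm N B2); auto. apply Rmax_r.
    + apply (Hm j B1); [apply H1; lia|apply Rmax_l].
Qed.

Theorem theorem4p4 (N : nat) (Om : nat -> C -> Prop)
    (tau phi dphi : nat -> C -> C) (f df : C -> C) (Theta : R) :
  classD N Om tau phi dphi f df ->
  is_Theta N phi dphi Theta ->
  negative_spectrum N phi dphi Theta ->
  (forall t, Theta < t ->
     (exists M : R, forall w,
        closureC (fun z => exists j, (j < N)%nat /\ Om j z) w ->
        Rbar_le (transfer1 N Om f df t w) (Finite M)) /\
     (forall gt p, 0 < gt < 1 -> 1 < p -> 1 / p < t / Theta - 1 ->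
        exists Cpt : R, forall w, exp gt < Cmod w ->
          Rbar_le (transfer1 N Om f df t w)
                  (Finite (Cpt * Rpower (ln (Cmod w)) (- (1 / p)))))) /\
  (forall t, t < Theta ->
     forall w, (exists j, (j < N)%nat /\ Om j w) ->
       transfer1 N Om f df t w = p_infty).
Proof.
  intros HD [th [Hth ETh]] Hneg.
  assert (PN : (0 < N)%nat) by apply HD.
  assert (TR : forall j, (j < N)%nat -> tract (Om j) (tau j) (phi j) (dphi j)).
  { intros j Hj. apply (classD_tract N Om tau phi dphi f df); auto. }
  assert (SD : forall j, (j < N)%nat -> square_distortion (phi j)).
  { intros j Hj. destruct HD as [_ [[_ [_ [_ [_ H5]]]] _]]. exact (H5 j Hj). }
  assert (Bneg : forall t j, Theta < t -> (j < N)%nat -> Rbar_lt (b_inf_j (phi j) (dphi j) t) (Finite 0)).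
  { intros t j Ht Hj. apply (fold_Rbar_max_lt _ _ _ (Hneg t Ht)).
    apply in_map_iff. exists j. split; auto. apply in_seq. lia. }
  assert (Th1 : 1 <= Theta).
  { apply Rnot_lt_le. intros L. apply (b_1_not_neg N Om tau phi dphi f df O HD PN). apply Bneg; auto. }
  split.
  - intros t Ht.
    (* One estimate on ln|w| >= g serves both claims of the first part, with g the distance from
       [closure_distance] or g = gt. *)
    assert (Main : forall g p, 0 < g -> 1 < p -> 1 / p < t / Theta - 1 ->
      exists K, 0 <= K /\ forall w, g <= ln (Cmod w) ->
        Rbar_le (transfer1 N Om f df t w) (Finite (K * Rpower (ln (Cmod w)) (- (1 / p))))).
    { intros g p Hg Hp Hpt.
      assert (Pp : 0 < 1 / p) by (apply Rdiv_lt_0_compat; lra).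
      set (s := t - 1 / p).
      (* Theta >= 1 gives t/Theta - 1 = (t - Theta)/Theta <= t - Theta, so 1/p leaves s above Theta,
         where the spectrum is negative. *)
      assert (Hs : Theta < s).
      { assert (t / Theta - 1 <= t - Theta); [|unfold s; lra].
        replace (t / Theta - 1) with ((t - Theta) / Theta) by (field; lra).
        apply Rmult_le_reg_r with Theta; [lra|]. unfold Rdiv. rewrite Rmult_assoc, Rinv_l by lra. nra. }
      destruct (finite_uniform_bound N (fun j B => forall x th n, g <= x ->
          vsum (phi j) (dphi j) t x th n <= B * Rpower x (- (1 / p)))) as [B HB].
      { intros j B B' H1 H2 x a n Hx. eapply Rle_trans; [apply H1; auto|].
        apply Rmult_le_compat_r; auto. left. apply Rpower_pos. }
      { intros j Hj. destruct (vsum_decay _ _ _ _ s t g (TR j Hj) (SD j Hj)) as [B [_ HB]]; auto.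
        - lra.
        - unfold s; lra.
        - exists B. intros x a n Hx. replace (1 / p) with (t - s) by (unfold s; ring). auto. }
      assert (B0 : 0 <= B).
      { assert (Z := HB O PN g 0 O ltac:(lra)). unfold vsum, rsum in Z; simpl in Z.
        assert (W := Rpower_pos g (- (1 / p))). nra. }
      exists (INR N * B). split; [apply Rmult_le_pos; auto; apply pos_INR|].
      intros w Hw. rewrite Rmult_assoc. apply (transfer1_le N Om tau phi dphi f df); auto. }
    split.
    + destruct (closure_distance (fun z => exists j, (j < N)%nat /\ Om j z)) as [g [Hg Kg]].
      { destruct HD as [_ [[_ [_ [_ [H4 _]]]] _]]. exact H4. }
      set (c := t / Theta - 1).
      assert (Hc : 0 < c).
      { unfold c. replace (t / Theta - 1) with ((t - Theta) / Theta) by (field; lra).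
        apply Rdiv_lt_0_compat; lra. }
      assert (Ic : 0 < / c) by (apply Rinv_0_lt_compat; lra).
      (* Any admissible exponent will do: p = 2 + 1/c satisfies p > 1 and 1/p < c. *)
      destruct (Main g (2 + / c) Hg ltac:(lra)) as [K [HK0 HK]].
      { fold c. apply Rmult_lt_reg_r with (2 + / c); [lra|].
        unfold Rdiv. rewrite Rmult_assoc, Rinv_l, Rmult_plus_distr_l, Rinv_r by lra. lra. }
      exists (K * Rpower g (- (1 / (2 + / c)))). intros w Hw. specialize (Kg w Hw).
      eapply Rbar_le_trans; [apply HK; exact Kg|]. simpl. apply Rmult_le_compat_l; auto.
      rewrite !Rpower_Ropp. apply Rinv_le_contravar; [apply Rpower_pos|].
      apply Rpower_le_base; auto. left. apply Rdiv_lt_0_compat; lra.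
    + intros gt p Hgt Hp Hpt. destruct (Main gt p ltac:(lra) Hp Hpt) as [K [_ HK]].
      exists K. intros w Hw. apply HK. left. rewrite <- (ln_exp gt). apply ln_increasing; auto. apply exp_pos.
  - intros t Ht w [j1 [Hj1 Ow]].
    assert (Pw : 1 < Cmod w) by (apply (TR j1 Hj1); exact Ow).
    destruct (Cexp_surjective w) as [[x a] [Ew Ex]]; [apply Cmod_gt_0; lra|]. simpl in Ex.
    assert (Hx : 0 < x) by (rewrite Ex, <- ln_1; apply ln_increasing; lra).
    assert (Unb : exists j, (j < N)%nat /\ forall B, exists K n : nat,
        B < vsum (phi j) (dphi j) t x (a - 2 * PI * INR K) n).
    { destruct (Rle_lt_dec t 0) as [H0|H0].
      - exists O. split; auto. intros B. exists O.
        apply (vsum_unbounded_nonpos _ _ _ _ t x _ (TR O PN) H0 Hx).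
      - assert (Hj : exists j, (j < N)%nat /\ Theta = th j).
        { assert (Z := fold_Rmax_in (map th (seq 0 N)) (th O)). rewrite <- ETh in Z.
          destruct Z as [E|Z]; [exists O; auto|].
          apply in_map_iff in Z. destruct Z as [j [E Hj]]. apply in_seq in Hj.
          exists j. split; [lia|auto]. }
        destruct Hj as [j [Hj Ej]]. exists j. split; auto.
        destruct (Hth j Hj) as [_ [Z1 Z2]]. rewrite <- Ej in Z1, Z2.
        apply (b_pos_vsum_unbounded _ _ _ _ t x a (TR j Hj) (SD j Hj) H0 Hx).
        assert (N0 := Z2 t (conj H0 Ht)).
        (* The value 0 is excluded by minimality of the zero, and a negative value would persist up
           to Theta, where b vanishes. The remaining case includes the value +infinity. *)
        destruct (Rbar_total_order (b_inf_j (phi j) (dphi j) t) (Finite 0)) as [[L|E]|G]; auto.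
        + exfalso. assert (L2 := b_neg_monotone _ _ _ _ t Theta (TR j Hj) (SD j Hj) ltac:(lra) L).
          rewrite Z1 in L2. simpl in L2. lra.
        + contradiction. }
    destruct Unb as [j [Hj Unb]].
    assert (Ge : forall B, Rbar_lt (Finite B) (transfer1 N Om f df t w)).
    { intros B. destruct (Unb B) as [K [n HK]].
      eapply Rbar_lt_le_trans; [|].
      - exact (HK : Rbar_lt (Finite B) (Finite _)).
      (* Lowering the argument by K full periods changes the window of preimages but not the point
         w. *)
      - assert (Ew' : w = Cexp (x, a - 2 * PI * INR K)).
        { rewrite <- Ew. unfold Cexp; cbn [fst snd].
          replace a with (a - 2 * PI * INR K + 2 * INR K * PI) at 1 2 by ring.
          rewrite cos_period, sin_period. reflexivity. }
        rewrite Ew'. apply (transfer1_ge N Om tau phi dphi f df); auto. }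
    destruct (transfer1 N Om f df t w) as [r| |]; auto.
    + specialize (Ge r). simpl in Ge. lra.
    + specialize (Ge 0). contradiction.
Qed.
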